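(* Let $G_1,G_2,G_3,G_4$ be the following graphs. $G_1$: vertices $a,b,c,d$, edges $ab,bc,ca,ad,db$. $G_2$: vertices $a,b,c,d,e,f$, edges $ab,bc,ca,cd,ae,bf$. $G_3$: vertices $a,b,c,d,e,f$, edges $ab,bc,ca,ad,de,eb,ef$. $G_4$: vertices $a,b,c,d,e,f,h,k$, edges $ab,bc,ca,ad,dh,df,fe,eb,ek$. Then any graph $G$ that contains at least one of $G_1,G_2,G_3,G_4$ as a subgraph has no $vi$-simultaneous proper $5$-coloring, i.e. $\chi_{vi}(G)\ge 6$. In particular, for any outerplanar graph $G$ with maximum degree $3$ that contains at least one of these subgraphs, $\chi_{vi}(G)=6$.
   Context: All graphs are finite, simple and undirected. An incidence of $G$ is a pair $(v,e)$ with $v\in V(G)$, $e\in E(G)$, $v\in e$; $I(G)$ is the set of incidences. Let $G^{1/3}$ be obtained from $G$ by replacing each edge $e=\{u,v\}$ by the path $u,(u,e),(v,e),v$. A $vi$-simultaneous proper $k$-coloring of $G$ is a map $c:V(G)\cup I(G)\to\{1,\dots,k\}$ such that any two distinct elements at distance at most $3$ in $G^{1/3}$ receive distinct colors; $\chi_{vi}(G)$ is the least $k$ for which such a coloring exists. A graph is outerplanar if it has a planar drawing with all vertices on the outer face. *)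

(* Defs.v *)
From HB Require Import structures.
From mathcomp Require Import all_boot all_order all_algebra.
From mathcomp Require Import all_classical all_reals all_analysis.
Set Implicit Arguments.
Unset Strict Implicit.
Unset Printing Implicit Defensive.
Import Order.TTheory GRing.Theory Num.Theory.
Import numFieldNormedType.Exports.

Local Open Scope classical_set_scope.
Local Open Scope ring_scope.
Local Open Scope nat_scope.

Record sgraph := SGraph {
  vertex :> finType;
  adj : rel vertex;
  adj_sym : symmetric adj;
  adj_irr : irreflexive adj }.

Definition edges (G : sgraph) : {set {set G}} :=
  [set [set p.1; p.2]%SET | p in [pred p : G * G | adj p.1 p.2]]%SET.

Definition max_degree (G : sgraph) : nat :=
  \max_(x : G) #|[set y | adj x y]%SET|.

(* G has a (not necessarily induced) subgraph isomorphic to H. *)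
Definition has_subgraph (G H : sgraph) : Prop :=
  exists2 f : H -> G, injective f & forall x y, adj x y -> adj (f x) (f y).

Definition dist_le (G : sgraph) (n : nat) (x y : G) : bool :=
  [exists m : 'I_n.+1, [exists p : m.-tuple G,
     path (@adj G) x p && (last x p == y)]].

Definition incidence (G : sgraph) : finType :=
  {p : G * {set G} | (p.2 \in edges G) && (p.1 \in p.2)}.

(* The vertices of G^{1/3} are V(G) + I(G): the edge e = {u, v} becomes the
   path u, (u, e), (v, e), v. *)
Definition third_adj (G : sgraph) : rel (G + incidence G) :=
  fun x y => match x, y with
  | inl _, inl _ => false
  | inl v, inr i => (val i).1 == v
  | inr i, inl v => (val i).1 == v
  | inr i, inr j => ((val i).2 == (val j).2) && ((val i).1 != (val j).1)
  end.

Lemma third_adj_sym (G : sgraph) : symmetric (@third_adj G).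
Proof.
by move=> [v|i] [w|j] //=; rewrite eq_sym [X in _ && ~~ X]eq_sym.
Qed.

Lemma third_adj_irr (G : sgraph) : irreflexive (@third_adj G).
Proof. by move=> [v|i] //=; rewrite !eqxx. Qed.

Definition third_subdivision (G : sgraph) : sgraph :=
  SGraph (@third_adj_sym G) (@third_adj_irr G).

Definition vi_proper (G : sgraph) (k : nat)
    (c : {ffun third_subdivision G -> 'I_k}) : bool :=
  [forall x, forall y, (x != y) && dist_le 3 x y ==> (c x != c y)].

Definition vi_colorable (G : sgraph) (k : nat) : bool :=
  [exists c : {ffun third_subdivision G -> 'I_k}, vi_proper c].

Lemma vi_colorable_ex (G : sgraph) : exists k, vi_colorable G k.
Proof.
exists #|third_subdivision G|; apply/existsP; exists [ffun x => enum_rank x].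
apply/forallP => x; apply/forallP => y; apply/implyP => /andP[nxy _].
by rewrite !ffunE (inj_eq enum_rank_inj).
Qed.

Definition chi_vi (G : sgraph) : nat := ex_minn (vi_colorable_ex G).

Section EdgeList.
Variables (n : nat) (s : seq (nat * nat)).

Definition edge_list_adj : rel 'I_n := fun x y =>
  (x != y) && (((x : nat, y : nat) \in s) || ((y : nat, x : nat) \in s)).

Lemma edge_list_adj_sym : symmetric edge_list_adj.
Proof. by move=> x y; rewrite /edge_list_adj eq_sym orbC. Qed.

Lemma edge_list_adj_irr : irreflexive edge_list_adj.
Proof. by move=> x; rewrite /edge_list_adj eqxx. Qed.

Definition edge_list_graph : sgraph :=
  SGraph edge_list_adj_sym edge_list_adj_irr.

End EdgeList.

Definition G1 : sgraph :=
  let a := 0 in let b := 1 in let c := 2 in let d := 3 in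
  edge_list_graph 4 [:: (a, b); (b, c); (c, a); (a, d); (d, b)].

Definition G2 : sgraph :=
  let a := 0 in let b := 1 in let c := 2 in let d := 3 in
  let e := 4 in let f := 5 in
  edge_list_graph 6 [:: (a, b); (b, c); (c, a); (c, d); (a, e); (b, f)].

Definition G3 : sgraph :=
  let a := 0 in let b := 1 in let c := 2 in let d := 3 in
  let e := 4 in let f := 5 in
  edge_list_graph 6
    [:: (a, b); (b, c); (c, a); (a, d); (d, e); (e, b); (e, f)].

Definition G4 : sgraph :=
  let a := 0 in let b := 1 in let c := 2 in let d := 3 in
  let e := 4 in let f := 5 in let h := 6 in let k := 7 in
  edge_list_graph 8
    [:: (a, b); (b, c); (c, a); (a, d); (d, h); (d, f); (f, e); (e, b); (e, k)].

Section Drawing.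
Variables (R : realType) (G : sgraph).
Local Notation plane := (R * R)%type.

(* Vertex v is the point pos v; edge e is the simple arc arc e, parametrized by
   [0, 1] (its values elsewhere, and at non-edges e, are irrelevant). *)
Record planar_drawing (pos : G -> plane) (arc : {set G} -> R -> plane) : Prop :=
  PlanarDrawing {
  pos_inj : injective pos;
  arc_continuous : forall e, e \in edges G ->
    {within `[0%R, 1%R], continuous (arc e)};
  arc_inj : forall e, e \in edges G ->
    {in `[0%R, 1%R] &, injective (arc e)};
  arc_ends : forall e, e \in edges G ->
    exists u v : G, [/\ e = [set u; v]%SET,
                        arc e 0%R = pos u & arc e 1%R = pos v];
  arc_avoids_vertices : forall e (t : R) v, e \in edges G ->
    t \in `]0%R, 1%R[ -> arc e t <> pos v;
  arcs_disjoint : forall e e' (t t' : R), e \in edges G -> e' \in edges G ->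
    e != e' -> t \in `]0%R, 1%R[ -> t' \in `]0%R, 1%R[ -> arc e t <> arc e' t' }.

Definition drawn_set (pos : G -> plane) (arc : {set G} -> R -> plane)
    : set plane :=
  range pos `|` \bigcup_(e in [set e | e \in edges G]) (arc e @` `[0%R, 1%R]).

(* The outer face is the unbounded connected component of the complement. *)
Definition outer_face (pos : G -> plane) (arc : {set G} -> R -> plane)
    (F : set plane) : Prop :=
  (exists2 x, (~` drawn_set pos arc) x &
              F = connected_component (~` drawn_set pos arc) x) /\
  ~ bounded_set F.

(* A vertex is never in a face, so lying on (the boundary of) the outer face
   means lying in its closure. *)
Definition outerplanar : Prop :=
  exists (pos : G -> plane) (arc : {set G} -> R -> plane),
    planar_drawing pos arc /\
    exists2 F, outer_face pos arc F & forall v, closure F (pos v).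

End Drawing.

(* Main.v *)
(** A colouring of vertices and incidences is proper iff around each vertex [u]
    its own colour and the colours of its incidences are distinct, and are avoided
    by the incidences on the far side; this makes the exclusion of five colours
    for G1, ..., G4 a small exhaustive search.

    For the upper bound, an outerplanar graph contains no subdivision of K_{2,3}
    (a theta). Let a theta-free graph have degrees 2 and 3 only, vertices of degree
    at most 1 being easily coloured last. A smallest nonempty vertex set with at
    most one leaving edge carries a Hamiltonian cycle, whose chords do not cross;
    looking under an innermost chord one finds two adjacent vertices of degree 2,
    or a triangle with an apex of degree 2, or a K_4. Each
    can be deleted, and a 6-colouring of the rest extends.

    A theta has no planar drawing with an inner vertex of each leg on a common
    face. Close to one hub the three legs meet a small circle. Approximate
    the outer parts by polygons and join them inside the circle at a point [o];
    this gives three closed polygons, whose crossing parities around any point sum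
    to zero. Leg [k] and the face avoid the polygon through the two other legs, so
    the parity of that polygon can be transported from the face, along leg [k], to
    a point next to [o]. Near [o] the parities of the three polygons at these
    points sum to one, a contradiction. *)
From HB Require Import structures.
Require Import Defs.
From mathcomp Require Import all_boot all_order all_algebra.
From mathcomp Require Import zify ring lra.
From mathcomp Require Import all_classical all_reals all_analysis.
Set Implicit Arguments.
Unset Strict Implicit.
Unset Printing Implicit Defensive.
Local Open Scope nat_scope.

(** * Proper colourings around a vertex *)

(** Outerplanarity reaches the colouring only as the absence of thetas. K_4 has too few vertices to
    contain a theta, which is why it appears as a third reducible configuration. The colouring
    induction runs over vertex sets [S] of one fixed graph, with neighbourhoods cut down to [S], so
    [theta_free] is available at every stage without being inherited.

    Six colours suffice because of a count: a new incidence on the far side of a surviving vertex of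
    degree at most 3 has to avoid the colour of that vertex and at most three incidences at it,
    which leaves two choices. This pair of choices is what the finite searches exploit.

    In the plane, separation is expressed by the parity of the crossings of an upward ray with a
    closed polygon. Arcs are merely continuous, so polygons only stay near them. The order of
    quantifiers matters: a radius is fixed first, from the points to be compared, and the parity
    statement then holds for all polygons within that radius, so that one choice of polygons serves
    all comparisons at once. *)

Lemma uniq_map_inj_in (T1 T2 : eqType) (h : T1 -> T2) (s : seq T1) :
  uniq (map h s) -> {in s &, injective h}.
Proof.
elim: s => //= x s IHs /andP[hx us] y z.
rewrite !inE => /predU1P[->|ys] /predU1P[->|zs] // e.
- by rewrite e map_f in hx.
- by rewrite -e map_f in hx.
- exact: IHs.
Qed.

Section ArcColorings.
Variable G : sgraph.
Implicit Types (S : {set G}) (u v w : G).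

Definition nbrs S u : seq G := enum [pred v | (v \in S) && adj u v].

Lemma mem_nbrs S u v : (v \in nbrs S u) = (v \in S) && adj u v.
Proof. by rewrite mem_enum. Qed.

Lemma nbrs_uniq S u : uniq (nbrs S u).
Proof. exact: enum_uniq. Qed.

Variable T : eqType.
Implicit Types (c : G -> T) (f : G -> G -> T).

(* [f u v] stands for the colour of the incidence [(u, {u, v})]. *)
Definition star_proper c f u (ns : seq G) : bool :=
  [&& uniq (c u :: map (f u) ns), all (fun v => c v != c u) ns &
      all (fun v => f v u \notin c u :: map (f u) ns) ns].

Definition arc_proper S c f := forall u, u \in S -> star_proper c f u (nbrs S u).

Lemma star_properP c f u ns : uniq ns ->
  reflect ((forall v, v \in ns ->
              [/\ c u != c v, c u != f u v, c u != f v u & f u v != f v u]) /\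
           (forall v w, v \in ns -> w \in ns -> v != w ->
              f u v != f u w /\ f u v != f w u))
          (star_proper c f u ns).
Proof.
move=> uns; apply: (iffP and3P) => [[/= /andP[cN fU] cA inA]|[H1 H2]].
  have Hc v : v \in ns -> c u != f u v.
    by move=> vn; apply: contraNneq cN => ->; apply: map_f.
  have Hi v w : v \in ns -> w \in ns -> f u v != f w u.
    move=> vn wn; move/allP/(_ w wn): inA; rewrite inE negb_or => /andP[_].
    by apply: contraNneq => <-; apply: map_f.
  split=> [v vn|v w vn wn vw].
    split; [by rewrite eq_sym; apply: (allP cA)|exact: Hc| |exact: Hi].
    by move/allP/(_ v vn): inA; rewrite inE negb_or eq_sym => /andP[].
  split; last exact: Hi.
  apply: contra vw => /eqP fe.
  by apply/eqP; apply: (uniq_map_inj_in fU).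
split.
- rewrite /= map_inj_in_uniq ?uns ?andbT.
    by apply/negP=> /mapP[v /H1[_ /eqP]].
  move=> v w vn wn /eqP fe; apply/eqP; apply: contraTT fe => vw.
  by have [] := H2 v w vn wn vw.
- by apply/allP=> v /H1[]; rewrite eq_sym.
- apply/allP=> v vn; rewrite inE negb_or; apply/andP; split.
    by have [_ _ + _] := H1 v vn; rewrite eq_sym.
  apply/negP=> /mapP[w wn fe]; have [wv|wv] := eqVneq w v.
    by have [_ _ _] := H1 v vn; rewrite fe wv eqxx.
  by have [_] := H2 w v wn vn wv; rewrite fe eqxx.
Qed.

Lemma star_proper_sub c f u ns ns' : uniq ns -> uniq ns' -> {subset ns' <= ns} ->
  star_proper c f u ns -> star_proper c f u ns'.
Proof.
move=> uns uns' sub /(star_properP _ _ _ uns)[H1 H2].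
apply/star_properP => //; split=> [v /sub/H1|v w /sub vn /sub wn]; [by []|exact: H2].
Qed.

End ArcColorings.

Lemma dist_leP (G : sgraph) (n : nat) (x y : G) :
  reflect (exists p, [/\ size p <= n, path (@adj G) x p & last x p = y])
          (dist_le n x y).
Proof.
apply: (iffP existsP) => [[m /existsP[p /andP[px /eqP <-]]]|[p [sp px <-]]].
  by exists p; rewrite size_tuple -ltnS ltn_ord.
exists (Ordinal (sp : size p < n.+1)); apply/existsP; exists (in_tuple p).
by rewrite px eqxx.
Qed.

(** * Distance at most 3 in the subdivided graph *)

Section Incidences.
Variable G : sgraph.
Implicit Types u v w : G.

Lemma mem_edges u v : ([set u; v]%SET \in edges G) = adj u v.
Proof.
apply/imsetP/idP => [[[a b] /= ab /setP e]|uv]; last by exists (u, v).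
have nab : a != b by apply: contraTneq ab => ->; rewrite inE /= adj_irr.
move: ab; rewrite inE /= => ab.
have /esym := e u; rewrite !inE eqxx /= => /orP[]/eqP ua;
have /esym := e v; rewrite !inE eqxx orbT /= => /orP[]/eqP va; subst u v.
- by move: (e b); rewrite !inE eqxx orbT orbb eq_sym (negbTE nab).
- by [].
- by rewrite adj_sym.
- by move: (e a); rewrite !inE eqxx orbb (negbTE nab).
Qed.

Lemma adj_neq u v : adj u v -> u != v.
Proof. by apply: contraTneq => ->; rewrite adj_irr. Qed.

Lemma inc_subproof u v : adj u v ->
  (((u, [set u; v]%SET).2 \in edges G) && ((u, [set u; v]%SET).1 \in (u, [set u; v]%SET).2)).
Proof. by move=> uv; rewrite /= mem_edges uv !inE eqxx. Qed.

Definition inc u v (uv : adj u v) : incidence G := exist _ (u, [set u; v]%SET) (inc_subproof uv).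

Lemma incP (i : incidence G) : exists u v (uv : adj u v), i = inc uv.
Proof.
case: i => [[u e] /= ue]; have := ue => /andP[/= eE ueI].
have /imsetP[[a b] /=] := eE; rewrite inE /= => ab ee.
have [v [uv ev]] : exists v, adj u v /\ e = [set u; v]%SET.
  move: ueI; rewrite ee !inE => /orP[]/eqP ->; first by exists b.
  by exists a; rewrite adj_sym finset.setUC.
exists u, v, uv; apply: val_inj => /=; by rewrite ev.
Qed.

Lemma set2_inj u v w : ([set u; v]%SET == [set u; w]%SET) -> v = w.
Proof.
move/eqP/setP => e; have := e v; have := e w; rewrite !inE !eqxx !orbT.
by case/orP=> /eqP // ->; rewrite orbb => /esym/eqP.
Qed.

Lemma third_adj_vertex v (y : third_subdivision G) : third_adj (inl v) y ->
  exists w (vw : adj v w), y = inr (inc vw).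
Proof.
case: y => // i /=; case: (incP i) => u [w [uw ->]] /= /eqP uv; subst u.
by exists w, uw.
Qed.

Lemma third_adj_inc u v (uv : adj u v) (y : third_subdivision G) :
  third_adj (inr (inc uv)) y ->
  y = inl u \/ exists vu : adj v u, y = inr (inc vu).
Proof.
case: y => [x /= /eqP ->|i]; first by left.
case: (incP i) => a [b [ab ->]] /= /andP[/eqP e na]; right.
have /setP/(_ a) := e; rewrite !inE eqxx /= [a == u]eq_sym (negbTE na) /= => /eqP av; subst a.
have /set2_inj bu : ([set v; u]%SET == [set v; b]%SET) by rewrite finset.setUC e.
by subst b; exists ab.
Qed.

Lemma inc_irrel u v (h h' : adj u v) : inc h = inc h'.
Proof. exact: val_inj. Qed.

Definition inc_other (i : incidence G) : G :=
  odflt (val i).1 [pick w in (val i).2 :\ (val i).1].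

Lemma inc_otherE u v (uv : adj u v) : inc_other (inc uv) = v.
Proof.
rewrite /inc_other /=; case: pickP => [w|/(_ v)] /=; rewrite !inE.
  by case/andP => /negbTE -> /eqP.
by rewrite eqxx orbT andbT eq_sym => /negbFE/eqP e; have := adj_neq uv; rewrite e eqxx.
Qed.

(** Within distance 3 of a vertex lie its neighbours and both incidences of each of its edges.
    Within distance 3 of the incidence of [u] on [uv] lie [u], [v], the other incidence of [uv],
    both incidences of the other edges [uw], and the incidences of [v]. Every such pair is seen
    together in the star of some vertex. *)
Theorem vi_colorableP (k : nat) : reflect
  (exists (c : G -> 'I_k) (f : G -> G -> 'I_k), arc_proper [set: G] c f)
  (vi_colorable G k).
Proof.
(* For non-adjacent [u] and [v] the value [inl u] is a filler. *)
pose incs u v : third_subdivision G :=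
  if insub (u, [set u; v]%SET) is Some i then inr i else inl u.
have incsE u v (uv : adj u v) : incs u v = inr (inc uv).
  by rewrite /incs (insubT (fun p : G * {set G} => (p.2 \in edges G) && (p.1 \in p.2)) (inc_subproof uv)).
apply: (iffP existsP) => [[c /forallP cP]|[c [f cfP]]].
  have H x y : x != y -> (exists p, [/\ size p <= 3, path (@third_adj G) x p & last x p = y]) ->
      c x != c y.
    move=> xy /(dist_leP (G := third_subdivision G)) d.
    by move/forallP/(_ y)/implyP: (cP x); apply; rewrite xy.
  have aV u v (uv : adj u v) : third_adj (inl u : third_subdivision G) (inr (inc uv)).
    by rewrite /= eqxx.
  have aI u v (uv : adj u v) (vu : adj v u) :
      third_adj (inr (inc uv) : third_subdivision G) (inr (inc vu)).
    by rewrite /= finset.setUC eqxx (adj_neq uv).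
  have aW u v (uv : adj u v) : third_adj (inr (inc uv) : third_subdivision G) (inl u).
    by rewrite /= eqxx.
  exists (fun u => c (inl u)), (fun u v => c (incs u v)) => u _.
  apply/star_properP; first exact: nbrs_uniq.
  split=> [v|v w]; rewrite !mem_nbrs !inE /=.
    move=> uv; have vu : adj v u by rewrite adj_sym.
    rewrite !incsE; split; apply: H => //.
    - by apply/eqP => -[] e; have := adj_neq uv; rewrite e eqxx.
    - by exists [:: inr (inc uv); inr (inc vu); inl v]; rewrite /= !eqxx finset.setUC eqxx adj_neq.
    - by exists [:: inr (inc uv)]; rewrite /= !eqxx.
    - by exists [:: inr (inc uv); inr (inc vu)]; rewrite /= !eqxx finset.setUC eqxx adj_neq.
    - by apply/eqP => -[] e _; have := adj_neq uv; rewrite e eqxx.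
    - by exists [:: inr (inc vu)]; rewrite /= finset.setUC eqxx adj_neq.
  move=> uv uw vw; have wu : adj w u by rewrite adj_sym.
  rewrite !incsE; split; apply: H.
  - by apply/eqP => -[] /eqP/set2_inj e; rewrite e eqxx in vw.
  - by exists [:: inl u; inr (inc uw)]; rewrite /= !eqxx.
  - by apply/eqP => -[] e _; have := adj_neq uw; rewrite e eqxx.
  - by exists [:: inl u; inr (inc uw); inr (inc wu)]; rewrite /= !eqxx finset.setUC eqxx adj_neq.
pose col (x : third_subdivision G) : 'I_k :=
  match x with inl v => c v | inr i => f (val i).1 (inc_other i) end.
have colI u v (uv : adj u v) : col (inr (inc uv)) = f u v by rewrite /col inc_otherE.
have H1 u v : adj u v -> [/\ c u != c v, c u != f u v, c u != f v u & f u v != f v u].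
  move=> uv; have [+ _] := star_properP c f u (nbrs_uniq _ u) (cfP u (finset.in_setT u)).
  by move/(_ v); rewrite mem_nbrs inE; apply.
have H2 u v w : adj u v -> adj u w -> v != w -> f u v != f u w /\ f u v != f w u.
  move=> uv uw vw; have [_] := star_properP c f u (nbrs_uniq _ u) (cfP u (finset.in_setT u)).
  by move/(_ v w); rewrite !mem_nbrs !inE; apply.
have symm u v : adj u v -> adj v u by rewrite adj_sym.
exists [ffun x => col x]; apply/forallP => x; apply/forallP => y.
apply/implyP => /andP[xy /dist_leP[p [sp px lp]]]; rewrite !ffunE; subst y.
have CV v w (h : adj v w) : col (inl v) != col (inr (inc h)).
  by rewrite colI; case: (H1 _ _ h).
have CV' v w (h : adj w v) : col (inl v) != col (inr (inc h)).
  by rewrite colI; case: (H1 _ _ (symm _ _ h)).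
have CI u v (h : adj u v) (h' : adj v u) : col (inr (inc h)) != col (inr (inc h')).
  by rewrite !colI; case: (H1 _ _ h).
have CO u v w (h : adj u v) (h' : adj u w) :
    inr (inc h) != inr (inc h') :> third_subdivision G ->
    col (inr (inc h)) != col (inr (inc h')).
  rewrite !colI => e; have [vw|] := eqVneq v w; last by case/(H2 _ _ _ h h').
  by subst w; rewrite (inc_irrel h h') eqxx in e.
have CX u v w (h : adj u v) (h' : adj w u) : col (inr (inc h)) != col (inr (inc h')).
  rewrite !colI; have [vw|vw] := eqVneq v w; first by subst w; case: (H1 _ _ h).
  by case: (H2 _ _ _ h (symm _ _ h') vw).
have CX' u v w (h : adj u v) (h' : adj v w) : col (inr (inc h)) != col (inr (inc h')).
  by rewrite eq_sym; apply: CX.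
(* Walks of at most three steps are enumerated; one that turns back either returns to its start or
   ends where a shorter walk already does. *)
move: sp px xy; case: p => [|x1 p] //=; first by rewrite eqxx.
case: x => [v|i] sp /andP[+ px].
  case/third_adj_vertex => w [vw x1E]; subst x1; move: px sp.
  case: p => [_ _ _|x2 p]; first exact: CV.
  case/andP => /third_adj_inc[->|[wv ->]].
    case: p => [|x3 p]; first by rewrite eqxx.
    by case/andP => /third_adj_vertex[w' [vw' ->]]; case: p => // _ _ _; apply: CV.
  case: p => [_ _ _|x3 p]; first exact: CV'.
  case/andP => /third_adj_inc[->|[wv' ->]]; case: p => // _ _ _; last exact: CV.
  by case: (H1 _ _ vw).
case: (incP i) => u [v [uv ->]]; case/third_adj_inc => [|[vu]] x1E; subst x1; move: px sp.
  case: p => [_ _ _|x2 p]; first by rewrite eq_sym; apply: CV.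
  case/andP => /third_adj_vertex[w [uw ->]].
  case: p => [_ _|x3 p]; first exact: CO.
  case/andP => /third_adj_inc[->|[wu ->]]; case: p => // _ _ _; last exact: CX.
  by rewrite eq_sym; apply: CV.
case: p => [_ _ _|x2 p]; first exact: CI.
case/andP => /third_adj_inc[->|[uv' ->]].
  case: p => [_ _ _|x3 p]; first by rewrite eq_sym; apply: CV'.
  by case/andP => /third_adj_vertex[w [vw ->]]; case: p => // _ _ _; apply: CX'.
case: p => [_ _|x3 p]; first by rewrite (inc_irrel uv' uv) eqxx.
case/andP => /third_adj_inc[->|[vu' ->]]; case: p => // _ _ _; last exact: CI.
by rewrite eq_sym; apply: CV.
Qed.

End Incidences.

(** * The four graphs need six colours *)

(* The [if] (rather than [==>]) keeps the pruning effective under call-by-value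
   evaluation. *)
Fixpoint inextensible (T : eqType) (conflict : rel T) (k : nat) (todo : seq T)
    (done : seq (T * nat)) : bool :=
  if todo is x :: todo' then
    all (fun a => if all (fun yb => conflict x yb.1 ==> (yb.2 != a)) done
                  then inextensible conflict k todo' ((x, a) :: done) else true)
        (iota 0 k)
  else false.

Lemma inextensibleN (T : eqType) (conflict : rel T) (k : nat) (col : T -> nat)
    (todo : seq T) (done : seq (T * nat)) :
  (forall x, col x < k) ->
  {in todo ++ map fst done &, forall x y, conflict x y -> col x != col y} ->
  all (fun yb => yb.2 == col yb.1) done ->
  ~~ inextensible conflict k todo done.
Proof.
move=> ck; elim: todo done => //= x todo IH done colP doneP.
rewrite -has_predC; apply/hasP; exists (col x); first by rewrite mem_iota add0n ck.
rewrite /= ifT.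
  apply: IH => /=; last by rewrite eqxx.
  move=> y z yT zT; apply: colP; rewrite !(inE, mem_cat) /= in yT zT *.
    by move: yT => /or3P[] ->; rewrite ?orbT.
  by move: zT => /or3P[] ->; rewrite ?orbT.
apply/allP => yb yd; apply/implyP => xy.
rewrite (eqP (allP doneP _ yd)) eq_sym; apply: colP xy; first by rewrite mem_head.
by rewrite inE mem_cat map_f ?orbT.
Qed.

Section SubgraphColoring.
Variables (n : nat) (s : seq (nat * nat)).

(* The pair [(u, u)] encodes the vertex [u], and [(u, v)] with [u != v] the
   incidence [(u, {u, v})]. *)
Definition edge_list_mem (x : nat * nat) : bool :=
  [&& x.1 < n.+1, x.2 < n.+1 & [|| x.1 == x.2, x \in s | (x.2, x.1) \in s]].

Definition edge_list_conflict : rel (nat * nat) := fun x y =>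
  if x.1 == x.2 then
    if y.1 == y.2 then ((x.1, y.1) \in s) || ((y.1, x.1) \in s)
    else (x.1 == y.1) || (x.1 == y.2)
  else if y.1 == y.2 then (y.1 == x.1) || (y.1 == x.2)
  else (x != y) && [|| x.1 == y.1, x.1 == y.2 | x.2 == y.1].

(** The embedding preserves adjacency and is injective, so conflicts in the listed graph remain
    conflicts in [G], whatever further edges [G] has. The list [vars] fixes the order of the search;
    its first [k] entries are coloured in advance. *)
Lemma subgraph_not_colorable (G : sgraph) (k : nat) (vars : seq (nat * nat)) :
  has_subgraph G (edge_list_graph n.+1 s) -> all (fun e => e.1 != e.2) s ->
  all edge_list_mem vars -> pairwise edge_list_conflict (take k vars) ->
  size (take k vars) = k ->
  inextensible edge_list_conflict k (drop k vars) (zip (take k vars) (iota 0 k)) ->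
  ~~ vi_colorable G k.
Proof.
move=> [h hinj hadj] sP varsP clique szk; apply: contraTN => /vi_colorableP[c [f cfP]].
pose g (i : nat) : G := h (inord i).
have gadj i j : edge_list_mem (i, j) -> i != j -> adj (g i) (g j).
  move=> /and3P[/= ilt jlt]; case: eqVneq => //= ij mem _; apply: hadj.
  by rewrite /= /edge_list_adj -val_eqE /= !inordK // ij.
have ginj i j : i < n.+1 -> j < n.+1 -> g i = g j -> i = j.
  by move=> il jl /hinj e; rewrite -(inordK il) e inordK.
have H1 u v : adj u v -> [/\ c u != c v, c u != f u v, c u != f v u & f u v != f v u].
  move=> uv; have [+ _] := star_properP c f u (nbrs_uniq _ u) (cfP u (finset.in_setT u)).
  by move/(_ v); rewrite mem_nbrs inE; apply.
have H2 u v w : adj u v -> adj u w -> v != w -> f u v != f u w /\ f u v != f w u.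
  move=> uv uw vw; have [_] := star_properP c f u (nbrs_uniq _ u) (cfP u (finset.in_setT u)).
  by move/(_ v w); rewrite !mem_nbrs !inE; apply.
have symm (u v : G) : adj u v -> adj v u by rewrite adj_sym.
pose col (x : nat * nat) : 'I_k :=
  if x.1 == x.2 then c (g x.1) else f (g x.1) (g x.2).
suff colP : {in vars &, forall x y, edge_list_conflict x y -> col x != col y}.
  (* The first [k] elements pairwise conflict, so up to a permutation of the
     colours they are coloured [0, 1, ..., k - 1]. *)
  pose l := map col (take k vars).
  have lu : uniq l.
    rewrite uniq_pairwise pairwise_map.
    apply: (sub_in_pairwise (P := mem vars)) clique => //.
    by apply/allP => x /mem_take.
  have lT (a : 'I_k) : a \in l.
    have [||_ ->] := @uniq_min_size _ l (enum 'I_k) lu; last by rewrite mem_enum.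
      by move=> x _; rewrite mem_enum.
    by rewrite size_enum_ord size_map szk.
  have sl : size l = k by rewrite size_map.
  apply: (@inextensibleN _ _ _ (fun x => index (col x) l)).
  - by move=> x; rewrite -[X in _ < X]sl index_mem.
  - move=> x y; rewrite -/(unzip1 _) unzip1_zip ?size_iota ?szk //.
    rewrite !mem_cat ![(_ \in drop _ _) || _]orbC -!mem_cat cat_take_drop => xv yv xy.
    by apply: contra (colP x y xv yv xy) => /eqP e; rewrite -(nth_index (col x) (lT (col x))) e nth_index.
  - apply/(all_nthP ((0, 0), 0)) => i; rewrite size_zip size_iota szk minnn => ik.
    rewrite nth_zip ?size_iota ?szk //= nth_iota // add0n.
    by rewrite -(nth_map _ (col (0, 0))) ?szk // index_uniq ?sl.
move=> [a b] [u v] => /(allP varsP) ab /(allP varsP) uv.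
rewrite /edge_list_conflict /col /=; have [e1|n1] := eqVneq a b.
  subst b; have [e2|n2] := eqVneq u v.
    subst v; move=> au; have au' : edge_list_mem (a, u) /\ a != u.
      rewrite /edge_list_mem /=; case/and3P: ab => /= -> _ _; case/and3P: uv => /= -> _ _ /=.
      case/orP: au => ua; first by rewrite ua orbT; split=> //; have := allP sP _ ua.
      by rewrite ua !orbT; split=> //; have := allP sP _ ua; rewrite eq_sym.
    by have [/= + _ _ _] := H1 _ _ (gadj _ _ au'.1 au'.2).
  have [/= _ h1 h2 _] := H1 _ _ (gadj _ _ uv n2).
  have [_ h3 h4 _] := H1 _ _ (symm _ _ (gadj _ _ uv n2)).
  by case/orP => /eqP ->.
have ab' := gadj _ _ ab n1.
have [e2|n2] := eqVneq u v.
  subst v; have [/= _ h1 h2 _] := H1 _ _ ab'.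
  have [_ h3 h4 _] := H1 _ _ (symm _ _ ab').
  by case/orP => /eqP ->; rewrite eq_sym.
have uv' := gadj _ _ uv n2.
have gneq i j : i < n.+1 -> j < n.+1 -> i != j -> g i != g j.
  by move=> il jl; apply: contra => /eqP/ginj ->.
case/and3P: ab => /= al bl _; case/and3P: uv => /= ul vl _.
case/andP => + /or3P[] /eqP e; rewrite xpair_eqE.
- subst u; rewrite eqxx /= => bv.
  by case: (H2 _ _ _ ab' uv' (gneq _ _ bl vl bv)).
- subst v => _; have [bu|bu] := eqVneq b u.
    by subst u; case: (H1 _ _ ab').
  by case: (H2 _ _ _ ab' (symm _ _ uv') (gneq _ _ bl ul bu)).
- subst u => _; have [va|va] := eqVneq v a.
    by subst v; case: (H1 _ _ ab').
  case: (H2 _ _ _ uv' (symm _ _ ab') (gneq _ _ vl al va)) => _.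
  by rewrite eq_sym.
Qed.

End SubgraphColoring.

(** The list starts with a vertex of degree 3, its three incidences and one far incidence: a clique
    that uses up the five colours. The far incidences from the two other neighbours are then forced
    to the fifth colour, which keeps the search short. The lists for the other three graphs start in
    the same way. *)
Lemma G1_not_colorable (G : sgraph) : has_subgraph G G1 -> ~~ vi_colorable G 5.
Proof.
move=> h; apply: (subgraph_not_colorable (vars := [:: (0, 0); (0, 1); (0, 2); (0, 3);
  (1, 0); (2, 0); (3, 0); (1, 1); (1, 2); (1, 3); (2, 1); (2, 2); (3, 1); (3, 3)]) h); [by []..| by vm_compute].
Qed.

Lemma G2_not_colorable (G : sgraph) : has_subgraph G G2 -> ~~ vi_colorable G 5.
Proof.
move=> h; apply: (subgraph_not_colorable (vars := [:: (0, 0); (0, 1); (0, 2); (0, 4);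
  (1, 0); (2, 0); (4, 0); (1, 1); (1, 2); (2, 2); (2, 1); (1, 5); (2, 3); (3, 2); (5, 1);
  (3, 3); (4, 4); (5, 5)]) h); [by []..| by vm_compute].
Qed.

Lemma G3_not_colorable (G : sgraph) : has_subgraph G G3 -> ~~ vi_colorable G 5.
Proof.
move=> h; apply: (subgraph_not_colorable (vars := [:: (0, 0); (0, 1); (0, 2); (0, 3);
  (1, 0); (2, 0); (3, 0); (1, 1); (1, 2); (2, 2); (2, 1); (1, 4); (4, 1); (3, 3); (3, 4);
  (4, 4); (4, 3); (4, 5); (5, 4); (5, 5)]) h); [by []..| by vm_compute].
Qed.

Lemma G4_not_colorable (G : sgraph) : has_subgraph G G4 -> ~~ vi_colorable G 5.
Proof.
move=> h; apply: (subgraph_not_colorable (vars := [:: (0, 0); (0, 1); (0, 2); (0, 3);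
  (1, 0); (2, 0); (3, 0); (1, 1); (1, 2); (2, 2); (2, 1); (1, 4); (4, 1); (3, 3); (3, 6);
  (3, 5); (6, 3); (5, 3); (6, 6); (5, 5); (5, 4); (4, 4); (4, 5); (4, 7); (7, 4); (7, 7)]) h); [by []..| by vm_compute].
Qed.

(** * Extending colourings *)

(* A neighbour [v] of a centre [u] contributes the triple [(c v, f u v, f v u)]. *)
Definition star_colors (T : eqType) (a : T) (nb : seq (T * T * T)) : bool :=
  [&& uniq (a :: [seq x.1.2 | x <- nb]), all (fun x => x.1.1 != a) nb &
      all (fun x => x.2 \notin a :: [seq x.1.2 | x <- nb]) nb].

Lemma star_properE (G : sgraph) (T : eqType) (c : G -> T) (f : G -> G -> T) u ns :
  star_proper c f u ns = star_colors (c u) [seq (c v, f u v, f v u) | v <- ns].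
Proof. by rewrite /star_colors -map_comp !all_map. Qed.

(** Only the pattern of equalities among the colours matters, so a colouring found by a search over
    [nat] can be carried to ['I_6]. *)
Lemma star_colors_map (T1 T2 : eqType) (h : T1 -> T2) (s : seq T1) a nb :
  {in s &, injective h} -> a \in s ->
  all (fun x => [&& x.1.1 \in s, x.1.2 \in s & x.2 \in s]) nb ->
  star_colors (h a) [seq (h x.1.1, h x.1.2, h x.2) | x <- nb] = star_colors a nb.
Proof.
move=> hI as_ nbs; rewrite /star_colors -map_comp !all_map.
have -> : [seq ((fun x : T2 * T2 * T2 => x.1.2) \o (fun x => (h x.1.1, h x.1.2, h x.2))) i | i <- nb] =
    map h [seq x.1.2 | x <- nb] by rewrite -map_comp.
set o := [seq x.1.2 | x <- nb].
have os : {subset a :: o <= s}.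
  by move=> x; rewrite inE => /predU1P[->//|/mapP[y /(allP nbs)/and3P[_ ys _] ->]].
have mo x : x \in s -> (h x \in h a :: map h o) = (x \in a :: o).
  rewrite -map_cons => xs; apply/mapP/idP => [[y yo /hI e]|xo]; last by exists x.
  by rewrite e // os.
congr [&& _, _ & _].
- by rewrite -!map_cons map_inj_in_uniq // => x y /os xs /os ys; apply: hI.
- by apply: eq_in_all => x /(allP nbs)/and3P[xs _ _] /=; rewrite (inj_in_eq hI).
- by apply: eq_in_all => x /(allP nbs)/and3P[_ _ xs] /=; rewrite mo.
Qed.

Lemma star_colors_sub (T : eqType) (a : T) nb nb' : subseq nb' nb ->
  star_colors a nb -> star_colors a nb'.
Proof.
move=> sub; have sm : subseq (a :: map (fun x => x.1.2) nb') (a :: map (fun x => x.1.2) nb).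
  by rewrite /= eqxx map_subseq.
case/and3P=> h1 h2 h3; apply/and3P; split; first exact: subseq_uniq h1.
- by apply/allP => x /(mem_subseq sub)/(allP h2).
- apply/allP => x /(mem_subseq sub)/(allP h3); apply: contra; exact: mem_subseq.
Qed.

(** A variant of [has] built on [if], so that evaluation stops at the first witness. *)
Fixpoint lazy_has (T : Type) (P : T -> bool) (s : seq T) : bool :=
  if s is x :: s' then if P x then true else lazy_has P s' else false.

Lemma lazy_hasE (T : Type) (P : T -> bool) s : lazy_has P s = has P s.
Proof. by elim: s => //= x s ->; case: (P x). Qed.

Section Offers.
Variable T : eqType.

(* A vertex [x] outside the deleted set offers [(a, s, r, k)] to a deleted
   neighbour [t]: its colour is [k], the incidence at [x] towards [t] will get
   [a], and the incidence at [t] towards [x] may get [s] or [r]. *)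
Definition edge_extension (a1 s1 r1 k1 a2 s2 r2 k2 g h p q cu cv : T) : bool :=
  [&& g \in [:: s1; r1], h \in [:: s2; r2],
      star_colors cu [:: (cv, p, q); (k1, g, a1)] &
      star_colors cv [:: (cu, q, p); (k2, h, a2)]].

Definition triangle_extension (a1 s1 r1 k1 a2 s2 r2 k2 g h xy yx xv vx yv vy cx cy cv : T) :
  bool :=
  [&& g \in [:: s1; r1], h \in [:: s2; r2],
      star_colors cx [:: (cv, xv, vx); (cy, xy, yx); (k1, g, a1)],
      star_colors cy [:: (cv, yv, vy); (cx, yx, xy); (k2, h, a2)] &
      star_colors cv [:: (cx, vx, xv); (cy, vy, yv)]].

End Offers.

(** The list [forbidden] only cuts branches early; soundness rests on the predicate tested at the
    leaves. *)
Definition some6 (forbidden : seq nat) (P : nat -> bool) : bool :=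
  lazy_has (fun a => if a \in forbidden then false else P a) (iota 0 6).

Definition edge_extendable (a1 s1 r1 k1 a2 s2 r2 k2 : nat) : bool :=
  lazy_has (fun g => lazy_has (fun h =>
  some6 [:: g; a1; h] (fun p => some6 [:: p; h; a2; g] (fun q =>
  some6 [:: a1; g; p; q; k1] (fun cu => some6 [:: a2; h; p; q; k2; cu] (fun cv =>
    edge_extension a1 s1 r1 k1 a2 s2 r2 k2 g h p q cu cv)))))
  [:: s2; r2]) [:: s1; r1].

Definition triangle_extendable (a1 s1 r1 k1 a2 s2 r2 k2 : nat) : bool :=
  lazy_has (fun g => lazy_has (fun h =>
  some6 [:: g; a1; h] (fun xy => some6 [:: xy; h; a2; g] (fun yx =>
  some6 [:: g; xy; a1; yx] (fun xv => some6 [:: xv; g; xy] (fun vx =>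
  some6 [:: h; yx; a2; xy; vx] (fun yv => some6 [:: yv; h; yx; vx; xv] (fun vy =>
  some6 [:: a1; g; k1; xy; yx; xv; vx] (fun cx =>
  some6 [:: a2; h; k2; xy; yx; yv; vy; cx] (fun cy =>
  some6 [:: xv; vx; yv; vy; cx; cy] (fun cv =>
    triangle_extension a1 s1 r1 k1 a2 s2 r2 k2 g h xy yx xv vx yv vy cx cy cv))))))))))
  [:: s2; r2]) [:: s1; r1].

Definition offers6 (P : nat -> nat -> nat -> nat -> bool) : bool :=
  all (fun a => all (fun s => all (fun r => all (fun k =>
    if uniq [:: a; s; r; k] then P a s r k else true)
  (iota 0 6)) (iota 0 6)) (iota 0 6)) (iota 0 6).

(** With the first offer normalized, the second runs through the 360 quadruples of distinct
    colours. *)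
Lemma edge_extendable_all : offers6 (edge_extendable 0 1 2 3).
Proof. by vm_compute. Qed.

Lemma triangle_extendable_all : offers6 (triangle_extendable 0 1 2 3).
Proof. by vm_compute. Qed.

Lemma some6P forbidden (P : nat -> bool) : some6 forbidden P -> exists2 a, a < 6 & P a.
Proof.
rewrite /some6 lazy_hasE => /hasP[a]; rewrite mem_iota add0n; case: ifP => // _ a6 Pa.
by exists a.
Qed.

Lemma offers6P (P : nat -> nat -> nat -> nat -> bool) a s r k : offers6 P ->
  a < 6 -> s < 6 -> r < 6 -> k < 6 -> uniq [:: a; s; r; k] -> P a s r k.
Proof.
move=> H a6 s6 r6 k6 u; have m i : i < 6 -> i \in iota 0 6 by rewrite mem_iota.
move: H => /allP/(_ a (m _ a6))/allP/(_ s (m _ s6))/allP/(_ r (m _ r6))/allP/(_ k (m _ k6)).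
by rewrite u.
Qed.

(* Renames the colours so that the first offer becomes [(0, 1, 2, 3)]. *)
Lemma color_code (a s r k : 'I_6) : uniq [:: a; s; r; k] ->
  exists (dec : nat -> 'I_6) (enc : 'I_6 -> nat),
    [/\ {in iota 0 6 &, injective dec}, cancel enc dec, forall x, enc x < 6 &
        [/\ dec 0 = a, dec 1 = s, dec 2 = r & dec 3 = k]].
Proof.
move=> u; pose l := [:: a; s; r; k] ++ [seq x <- enum 'I_6 | x \notin [:: a; s; r; k]].
have lu : uniq l.
  rewrite /l cat_uniq u filter_uniq ?enum_uniq // andbT.
  by apply/hasPn => x; rewrite mem_filter => /andP[].
have lT x : x \in l.
  by rewrite /l mem_cat mem_filter mem_enum andbT; case: (x \in [:: _; _; _; _]).
have sl : size l = 6.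
  have [||<- _] := @uniq_min_size _ (enum 'I_6) l (enum_uniq _); first by move=> x _.
    by apply: uniq_leq_size => // x _; rewrite mem_enum.
  by rewrite size_enum_ord.
exists (nth a l), (fun x => index x l); split=> //.
- move=> i j; rewrite !mem_iota !add0n /= => i6 j6 /eqP.
  by rewrite nth_uniq ?sl // => /eqP.
- by move=> x; rewrite /= nth_index.
- by move=> x; have := lT x; rewrite -index_mem sl.
Qed.

Lemma edge_extension_exists (a1 s1 r1 k1 a2 s2 r2 k2 : 'I_6) :
  uniq [:: a1; s1; r1; k1] -> uniq [:: a2; s2; r2; k2] ->
  exists g h p q cu cv, edge_extension a1 s1 r1 k1 a2 s2 r2 k2 g h p q cu cv.
Proof.
move=> /color_code[dec [enc [decI encK enc6 [<- <- <- <-]]]] u2.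
have u2' : uniq [:: enc a2; enc s2; enc r2; enc k2].
  by have /map_inj_uniq/(_ [:: a2; s2; r2; k2]) := can_inj encK; rewrite u2.
have := offers6P edge_extendable_all (enc6 a2) (enc6 s2) (enc6 r2) (enc6 k2) u2'.
rewrite /edge_extendable lazy_hasE => /hasP[g gI]; rewrite lazy_hasE => /hasP[h hI].
move=> /some6P[p p6 /some6P[q q6 /some6P[cu cu6 /some6P[cv cv6 /and4P[_ _ H1 H2]]]]].
exists (dec g), (dec h), (dec p), (dec q), (dec cu), (dec cv).
have m i : i < 6 -> i \in iota 0 6 by rewrite mem_iota.
have g6 : g < 6 by move: gI; rewrite !inE => /orP[]/eqP ->.
have h6 : h < 6 by move: hI; rewrite !inE => /orP[]/eqP ->; apply: enc6.
apply/and4P; split.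
- by move: gI; rewrite !inE => /orP[]/eqP ->; rewrite eqxx ?orbT.
- by move: hI; rewrite !inE => /orP[]/eqP ->; rewrite encK eqxx ?orbT.
- by rewrite -(star_colors_map decI) // ?m //= !m in H1.
- rewrite -(star_colors_map decI) /= ?encK // ?m //= in H2; rewrite !m //; exact: enc6.
Qed.

Lemma triangle_extension_exists (a1 s1 r1 k1 a2 s2 r2 k2 : 'I_6) :
  uniq [:: a1; s1; r1; k1] -> uniq [:: a2; s2; r2; k2] ->
  exists g h xy yx xv vx yv vy cx cy cv,
    triangle_extension a1 s1 r1 k1 a2 s2 r2 k2 g h xy yx xv vx yv vy cx cy cv.
Proof.
move=> /color_code[dec [enc [decI encK enc6 [<- <- <- <-]]]] u2.
have u2' : uniq [:: enc a2; enc s2; enc r2; enc k2].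
  by have /map_inj_uniq/(_ [:: a2; s2; r2; k2]) := can_inj encK; rewrite u2.
have := offers6P triangle_extendable_all (enc6 a2) (enc6 s2) (enc6 r2) (enc6 k2) u2'.
rewrite /triangle_extendable lazy_hasE => /hasP[g gI]; rewrite lazy_hasE => /hasP[h hI].
move=> /some6P[xy xy6 /some6P[yx yx6 /some6P[xv xv6 /some6P[vx vx6]]]].
move=> /some6P[yv yv6 /some6P[vy vy6 /some6P[cx cx6 /some6P[cy cy6 /some6P[cv cv6]]]]].
move=> /and5P[_ _ H1 H2 H3].
exists (dec g), (dec h), (dec xy), (dec yx), (dec xv), (dec vx), (dec yv), (dec vy).
exists (dec cx), (dec cy), (dec cv).
have m i : i < 6 -> i \in iota 0 6 by rewrite mem_iota.
have g6 : g < 6 by move: gI; rewrite !inE => /orP[]/eqP ->.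
have h6 : h < 6 by move: hI; rewrite !inE => /orP[]/eqP ->; apply: enc6.
apply/and5P; split.
- by move: gI; rewrite !inE => /orP[]/eqP ->; rewrite eqxx ?orbT.
- by move: hI; rewrite !inE => /orP[]/eqP ->; rewrite encK eqxx ?orbT.
- by rewrite -(star_colors_map decI) // ?m //= !m in H1.
- rewrite -(star_colors_map decI) /= ?encK // ?m //= in H2; rewrite !m //; exact: enc6.
- by rewrite -(star_colors_map decI) // ?m //= !m in H3.
Qed.

Lemma size_unused (T : finType) (l : seq T) :
  #|T| - size l <= size [seq x <- enum T | x \notin l].
Proof.
rewrite cardE -(count_predC (mem l) (enum T)) size_filter leq_subLR leq_add2r.
rewrite -size_filter; apply: uniq_leq_size; first by rewrite filter_uniq // enum_uniq.
by move=> x; rewrite mem_filter => /andP[].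
Qed.

(** Here [O] and [I] are the colours of the surviving near and far incidences at a vertex coloured
    [k], and [m] counts its deleted neighbours. New near incidences avoid [k], [O] and [I], at most
    [7 - 2 * m] colours, which leaves [m] of the six as soon as [m] is positive. New far incidences
    avoid [k], [O] and [A], at most four colours, which leaves [s] and [r]. *)
Lemma offer_colors (k : 'I_6) (O I : seq 'I_6) (m : nat) :
  size O + m <= 3 -> size I <= size O ->
  exists (A : seq 'I_6) s r, [/\ size A = m, uniq (A ++ [:: s; r; k]),
    {in A, forall x, x \notin O ++ I} & (s \notin O) && (r \notin O)].
Proof.
move=> Om IO; pose F1 := [seq x <- enum 'I_6 | x \notin k :: O ++ I].
pose A := take m F1.
have sA : size A = m.
  apply: size_takel; apply: leq_trans (size_unused _); rewrite card_ord /= size_cat; lia.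
pose F2 := [seq x <- enum 'I_6 | x \notin k :: O ++ A].
have sF2 : 2 <= size F2.
  apply: leq_trans (size_unused _); rewrite card_ord /= size_cat sA; lia.
have AF x : x \in A -> x \notin k :: O ++ I.
  by move/mem_take; rewrite mem_filter => /andP[].
have uA : uniq A by rewrite take_uniq // filter_uniq // enum_uniq.
have uF2 : uniq F2 by rewrite filter_uniq // enum_uniq.
have F2P x : x \in F2 -> x \notin k :: O ++ A by rewrite mem_filter => /andP[].
move: sF2 uF2 F2P; case: F2 => [|s [|r F2]] // _ /= /andP[sr _] F2P.
exists A, s, r; have := F2P s; have := F2P r; move: sr.
rewrite !inE !mem_cat !negb_or !eqxx !orbT => /andP[sr _] /(_ isT)/and3P[rk rO rA].
case/(_ isT)/and3P=> sk sO sA'; split=> //; last by rewrite sO.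
- rewrite cat_uniq uA /= !inE !orbF !negb_or sr sk rk sA' rA !andbT /=.
  by apply/negP => /AF; rewrite inE eqxx.
- by move=> x /AF; rewrite inE negb_or => /andP[].
Qed.

Section Extension.
Variable G : sgraph.
Implicit Types (S T : {set G}).

(** The vertex [o t] is the only possible surviving neighbour of a deleted [t]. At one surviving
    vertex the colours [a t] are pairwise distinct, while all deleted neighbours share the same pair
    [s], [r]: two far incidences may agree, a near and a far one may not. Hence choices made at
    different deleted vertices do not interfere in a surviving star. *)
Lemma offers_exist S T (c : G -> 'I_6) (f : G -> G -> 'I_6) (o : G -> G) :
  arc_proper S c f -> [disjoint S & T] ->
  {in S, forall u, size (nbrs (S :|: T) u) <= 3} ->
  {in S & T, forall u t, adj u t -> u = o t} ->
  exists a s r : G -> 'I_6, (forall t, uniq [:: a t; s t; r t; c (o t)]) /\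
    forall c' f', {in S, c' =1 c} -> {in S &, f' =2 f} ->
      {in T, forall t, o t \in S -> adj (o t) t ->
        [/\ f' (o t) t = a t, f' t (o t) \in [:: s t; r t] & c' t != c (o t)]} ->
      {in S, forall u, star_proper c' f' u (nbrs (S :|: T) u)}.
Proof.
move=> cf dST deg3 oP.
have : forall u, exists Asr : seq 'I_6 * 'I_6 * 'I_6, u \in S ->
    [/\ size Asr.1.1 = size (nbrs T u), uniq (Asr.1.1 ++ [:: Asr.1.2; Asr.2; c u]),
        {in Asr.1.1, forall x, x \notin map (f u) (nbrs S u) ++ map (f^~ u) (nbrs S u)} &
        (Asr.1.2 \notin map (f u) (nbrs S u)) && (Asr.2 \notin map (f u) (nbrs S u))].
  move=> u; have [uS|uS] := boolP (u \in S); last by exists ([::], ord0, ord0).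
  have [||A [s [r H]]] := @offer_colors (c u) (map (f u) (nbrs S u))
     (map (f^~ u) (nbrs S u)) (size (nbrs T u)); last by exists (A, s, r).
    rewrite size_map; apply: leq_trans (deg3 u uS).
    rewrite -size_cat; apply: uniq_leq_size => [|x].
      rewrite cat_uniq !nbrs_uniq andbT; apply/hasPn => x; rewrite !mem_nbrs => /andP[xT _].
      by rewrite (disjointFl dST).
    by rewrite mem_cat !mem_nbrs inE => /orP[]/andP[-> ->]; rewrite ?orbT.
  by rewrite !size_map.
case/choice => F FP.
have : forall t, exists asr : 'I_6 * 'I_6 * 'I_6, uniq [:: asr.1.1; asr.1.2; asr.2; c (o t)] /\
    (o t \in S -> t \in nbrs T (o t) ->
     asr = (nth ord0 (F (o t)).1.1 (index t (nbrs T (o t))), (F (o t)).1.2, (F (o t)).2)).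
  move=> t; have [/andP[oS tN]|H] := boolP ((o t \in S) && (t \in nbrs T (o t))); last first.
    (* A deleted vertex without surviving neighbour also receives a quadruple of distinct colours,
       so that the searches treat both situations alike. *)
    have [||A [s [r [sA u _ _]]]] := @offer_colors (c (o t)) [::] [::] 1 => //.
    exists (head ord0 A, s, r); split; last by move=> h1 h2; rewrite h1 h2 in H.
    by case: A sA u => [|x []].
  exists (nth ord0 (F (o t)).1.1 (index t (nbrs T (o t))), (F (o t)).1.2, (F (o t)).2).
  split=> //; have [sz u _ _] := FP _ oS; move: u.
  rewrite cat_uniq => /and3P[_ /= hn u]; rewrite u andbT !inE.
  have xA : nth ord0 (F (o t)).1.1 (index t (nbrs T (o t))) \in (F (o t)).1.1.
    by rewrite mem_nth // sz index_mem.
  by move: hn; rewrite !negb_or => /and4P[h1 h2 h3 _]; rewrite !(memPn _ _ xA).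
case/choice => H HP.
exists (fun t => (H t).1.1), (fun t => (H t).1.2), (fun t => (H t).2).
split=> [t|c' f' cE fE tP u uS]; first by case: (HP t).
have [/= szA uA AP sr] := FP _ uS.
have HE t : t \in T -> adj u t -> [/\ o t = u,
    (H t).1.1 = nth ord0 (F u).1.1 (index t (nbrs T u)), (H t).1.2 = (F u).1.2 & (H t).2 = (F u).2].
  move=> tT ut; have ou := oP _ _ uS tT ut; have [_] := HP t; rewrite -ou uS.
  by rewrite mem_nbrs tT ut => /(_ isT isT) ->.
have TP t : t \in T -> adj u t -> [/\ f' u t = (H t).1.1,
    f' t u \in [:: (F u).1.2; (F u).2] & c' t != c u].
  move=> tT ut; have [ou _ hs hr] := HE t tT ut; have := tP t tT.
  by rewrite ou -hs -hr; apply.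
have aA t : t \in T -> adj u t -> (H t).1.1 \in (F u).1.1.
  move=> tT ut; have [_ -> _ _] := HE t tT ut; rewrite mem_nth // szA index_mem.
  by rewrite mem_nbrs tT.
have aI t t' : t \in T -> adj u t -> t' \in T -> adj u t' -> t != t' -> (H t).1.1 != (H t').1.1.
  move=> tT ut tT' ut'; have [_ -> _ _] := HE t tT ut; have [_ -> _ _] := HE t' tT' ut'.
  have tN : t \in nbrs T u by rewrite mem_nbrs tT.
  have tN' : t' \in nbrs T u by rewrite mem_nbrs tT'.
  move: uA; rewrite cat_uniq => /and3P[uA _ _].
  rewrite nth_uniq ?szA ?index_mem //; apply: contra => /eqP e.
  by rewrite -(nth_index u tN) e nth_index.
have aX t x : t \in T -> adj u t -> x \in [:: (F u).1.2; (F u).2; c u] -> (H t).1.1 != x.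
  move=> tT ut xI; move: uA; rewrite cat_uniq => /and3P[_ /hasPn/(_ x xI) xA _].
  by apply: contraNneq xA => <-; apply: aA.
have inSR t t' : t \in T -> adj u t -> t' \in T -> adj u t' -> (H t).1.1 != f' t' u.
  move=> tT ut tT' ut'; have [_ + _] := TP t' tT' ut'.
  by rewrite !inE => /orP[]/eqP ->; apply: aX; rewrite ?inE ?eqxx ?orbT.
have srO x : x \in [:: (F u).1.2; (F u).2] -> x \notin map (f u) (nbrs S u).
  by rewrite !inE; case/andP: sr => h1 h2 /orP[]/eqP ->.
have [H1 H2] := star_properP c f u (nbrs_uniq S u) (cf u uS).
have memU v : v \in nbrs (S :|: T) u -> (v \in S) /\ (v \in nbrs S u) \/ (v \in T) /\ adj u v.
  by rewrite !mem_nbrs inE => /andP[/orP[] -> ->]; [left|right].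
apply/star_properP; first exact: nbrs_uniq.
split=> [v /memU[[vS vN]|[vT uv]]|v w /memU[[vS vN]|[vT uv]] /memU[[wS wN]|[wT uw]] vw].
- by rewrite !cE // !fE //; apply: H1.
- have [h1 h2 h3] := TP v vT uv; rewrite cE // h1; split.
  + by rewrite eq_sym.
  + by rewrite eq_sym; apply: aX; rewrite ?inE ?eqxx ?orbT.
  + move: uA h2; rewrite cat_uniq => /and3P[_ _ /= /and3P[+ + _]].
    by rewrite !inE negb_or => /andP[_ n1] n2 /orP[]/eqP ->; rewrite eq_sym.
  + exact: inSR.
- by rewrite !fE //; apply: H2.
- have [h1 h2 h3] := TP w wT uw; rewrite h1 (fE u v) //; split.
  + have := AP _ (aA w wT uw); rewrite mem_cat negb_or => /andP[+ _].
    by apply: contraNneq => <-; apply: map_f.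
  + by have := srO _ h2; apply: contraNneq => <-; apply: map_f.
- have [h1 h2 h3] := TP v vT uv; rewrite h1 !fE //; have := AP _ (aA v vT uv).
  rewrite mem_cat negb_or => /andP[n1 n2]; split.
  + by apply: contraNneq n1 => ->; apply: map_f.
  + by apply: contraNneq n2 => ->; apply: (map_f (f^~ u)).
- have [h1 _ _] := TP v vT uv; have [h1' _ _] := TP w wT uw; rewrite h1 h1'; split.
  + exact: aI.
  + exact: inSR.
Qed.

End Extension.

(** * Reducible configurations *)

Section Reductions.
Variable G : sgraph.
Implicit Types (S T : {set G}).

Definition arc_colorable S := exists (c : G -> 'I_6) (f : G -> G -> 'I_6), arc_proper S c f.

(** The offers settle the surviving stars once and for all, so each reduction below only has to
    colour the stars of [T]. *)
Lemma extend_coloring S T (c : G -> 'I_6) (f : G -> G -> 'I_6) (o : G -> G) :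
  T \subset S -> arc_proper (S :\: T) c f ->
  {in S, forall u, size (nbrs S u) <= 3} ->
  {in S :\: T & T, forall u t, adj u t -> u = o t} ->
  exists a s r : G -> 'I_6, (forall t, uniq [:: a t; s t; r t; c (o t)]) /\
    forall c' f', {in S :\: T, c' =1 c} -> {in S :\: T &, f' =2 f} ->
      {in T, forall t, o t \in S :\: T -> adj (o t) t ->
        [/\ f' (o t) t = a t, f' t (o t) \in [:: s t; r t] & c' t != c (o t)]} ->
      {in T, forall t, star_proper c' f' t (nbrs S t)} ->
      arc_colorable S.
Proof.
move=> TS cf deg3 oP; have SE : (S :\: T) :|: T = S.
  by apply/setP => x; rewrite !inE; case: (boolP (x \in T)) => [/(fintype.subsetP TS) ->|]; rewrite ?orbF.
have [||a [s [r [u H]]]] := offers_exist cf _ _ oP.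
- by rewrite -finset.setI_eq0 finset.setDE -finset.setIA [X in _ :&: X]finset.setIC finset.setICr finset.setI0.
- by move=> u; rewrite SE => /finset.setDP[/deg3].
exists a, s, r; split=> // c' f' cE fE tP TP; exists c', f' => z zS.
have [/TP//|zT] := boolP (z \in T); rewrite SE in H.
by apply: (H c' f') => //; rewrite inE zT.
Qed.

Lemma star_proper_perm (T : eqType) (c : G -> T) (f : G -> G -> T) u ns ns' :
  uniq ns -> perm_eq ns ns' -> star_proper c f u ns' -> star_proper c f u ns.
Proof.
move=> uns pe; have uns' : uniq ns' by rewrite -(perm_uniq pe).
by apply: star_proper_sub => // x; rewrite (perm_mem pe).
Qed.

Lemma nbrs_rest S u (L : seq G) : uniq L -> {subset L <= nbrs S u} ->
  size (nbrs S u) <= (size L).+1 ->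
  exists2 xs, size xs <= 1 & perm_eq (nbrs S u) (L ++ xs).
Proof.
move=> uL sub sz; exists [seq x <- nbrs S u | x \notin L].
  rewrite size_filter; have e : count (fun x => x \in L) (nbrs S u) +
    count (fun x => x \notin L) (nbrs S u) = size (nbrs S u) by exact: count_predC.
  rewrite -(leq_add2l (size L)) addn1; apply: leq_trans sz; rewrite -e leq_add2r.
  rewrite -size_filter; apply: uniq_leq_size => // x xL.
  by rewrite mem_filter xL sub.
apply: uniq_perm; first exact: nbrs_uniq.
  rewrite cat_uniq uL filter_uniq ?nbrs_uniq // andbT.
  by apply/hasPn => x; rewrite mem_filter => /andP[].
move=> x; rewrite mem_cat mem_filter; case: (boolP (x \in L)) => //= xL; exact: sub.
Qed.

Lemma extend_deg1 S v : {in S, forall u, size (nbrs S u) <= 3} -> v \in S ->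
  size (nbrs S v) <= 1 -> arc_colorable (S :\ v) -> arc_colorable S.
Proof.
move=> deg3 vS sz [c [f cf]]; pose x := head v (nbrs S v).
have nx w : w \in nbrs S v -> w = x.
  by rewrite /x; case: (nbrs S v) sz => [|y []] //= _; rewrite inE => /eqP.
have [||a [s [r [u H]]]] := extend_coloring (T := [set v]%SET) (o := fun=> x) _ cf deg3.
- by rewrite finset.sub1set.
- move=> w t; rewrite !inE => /andP[wv wS] /eqP -> wv'.
  by apply: nx; rewrite mem_nbrs wS adj_sym.
have := u v; rewrite /= !inE !negb_or -!andbA => /and5P[as_ ar ak sr /and3P[sk rk _]].
(* The far incidence takes [s v], and the second allowed colour [r v] is then free for the vertex
   [v] itself. *)
apply: (H (fun z => if z == v then r v else c z)
          (fun y z => if y == v then s v else if z == v then a v else f y z)).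
- by move=> z; rewrite !inE => /andP[/negbTE ->].
- by move=> y z; rewrite !inE => /andP[/negbTE -> _] /andP[/negbTE -> _].
- move=> t; rewrite !inE => /eqP -> /andP[/negbTE xv _] _.
  by rewrite xv !eqxx.
move=> t; rewrite inE => /eqP ->.
have [e|[y e]] : nbrs S v = [::] \/ exists y, nbrs S v = [:: y].
  by case: (nbrs S v) sz => [|y []] //; [left|right; exists y].
  by rewrite e.
have yN : y \in nbrs S v by rewrite e mem_head.
have yv : (y == v) = false.
  by apply: contraTF yN => /eqP ->; rewrite mem_nbrs adj_irr andbF.
rewrite e star_properE /= eqxx yv (nx y yN) /star_colors /= !inE ?orbF ?andbT ?negb_or.
by rewrite [r v == s v]eq_sym sr [c x == r v]eq_sym rk ar as_.
Qed.

(** The search covers every pair of offers, including those made by a common outer neighbour of [u]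
    and [v]. *)
Lemma extend_edge S u v : {in S, forall w, size (nbrs S w) <= 3} ->
  u \in S -> v \in S -> adj u v -> size (nbrs S u) <= 2 -> size (nbrs S v) <= 2 ->
  arc_colorable (S :\: [set u; v]%SET) -> arc_colorable S.
Proof.
move=> deg3 uS vS uv szu szv [c [f cf]].
have vu : adj v u by rewrite adj_sym.
have nuv : (v == u) = false by apply/negbTE/adj_neq.
have nvu : (u == v) = false by apply/negbTE/adj_neq.
have [//|w|//|xs sx px] := @nbrs_rest S u [:: v].
  by rewrite inE => /eqP ->; rewrite mem_nbrs vS.
have [//|w|//|ys sy py] := @nbrs_rest S v [:: u].
  by rewrite inE => /eqP ->; rewrite mem_nbrs uS.
have xsP w : w \in xs -> [/\ w = head u xs, w \in S, adj u w, (w == u) = false & (w == v) = false].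
  move=> wx; have wN : w \in nbrs S u by rewrite (perm_mem px) inE wx orbT.
  have := nbrs_uniq S u; rewrite (perm_uniq px) /= => /andP[vx _].
  move: wN; rewrite mem_nbrs => /andP[-> uw]; split=> //.
  - by case: xs sx wx {px vx} => [|z []] //= _; rewrite inE => /eqP.
  - by rewrite eq_sym; apply/negbTE/adj_neq.
  - by apply: contraNF vx => /eqP <-.
have ysP w : w \in ys -> [/\ w = head v ys, w \in S, adj v w, (w == v) = false & (w == u) = false].
  move=> wx; have wN : w \in nbrs S v by rewrite (perm_mem py) inE wx orbT.
  have := nbrs_uniq S v; rewrite (perm_uniq py) /= => /andP[ux _].
  move: wN; rewrite mem_nbrs => /andP[-> uw]; split=> //.
  - by case: ys sy wx {py ux} => [|z []] //= _; rewrite inE => /eqP.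
  - by rewrite eq_sym; apply/negbTE/adj_neq.
  - by apply: contraNF ux => /eqP <-.
(* When [u] or [v] has no further neighbour, [head] returns the vertex itself, which lies in the
   deleted set. The offer is then void, and dropping its entry from the colours found leaves a
   proper star. *)
pose o z := if z == u then head u xs else head v ys.
have [||a [s [r [uq H]]]] := extend_coloring (T := [set u; v]%SET) (o := o) _ cf deg3.
- by apply/fintype.subsetP => z; rewrite !inE => /orP[]/eqP ->.
- move=> w t; rewrite !inE negb_or => /andP[/andP[wu wv] wS] /orP[]/eqP -> wt; rewrite /o.
    rewrite eqxx; have : w \in nbrs S u by rewrite mem_nbrs wS adj_sym.
    by rewrite (perm_mem px) inE (negbTE wv) => /xsP[].
  rewrite nuv; have : w \in nbrs S v by rewrite mem_nbrs wS adj_sym.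
  by rewrite (perm_mem py) inE (negbTE wu) => /ysP[].
have [g [h [p [q [cu [cv /and4P[gI hI star1 star2]]]]]]] := edge_extension_exists (uq u) (uq v).
pose c' z := if z == u then cu else if z == v then cv else c z.
pose f' y z := if y == u then (if z == v then p else g)
          else if y == v then (if z == u then q else h)
          else if z == u then a u else if z == v then a v else f y z.
have ou : o u = head u xs by rewrite /o eqxx.
have ov : o v = head v ys by rewrite /o nuv.
have k1 : cu != c (o u) by move: star1 => /and3P[_ /and3P[_ + _] _]; rewrite eq_sym.
have k2 : cv != c (o v) by move: star2 => /and3P[_ /and3P[_ + _] _]; rewrite eq_sym.
rewrite !inE in gI hI; apply: (H c' f').
- by move=> z; rewrite /c' !inE negb_or => /andP[/andP[/negbTE -> /negbTE ->]].
- move=> y z; rewrite /f' !inE !negb_or => /andP[/andP[/negbTE -> /negbTE -> _]].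
  by move=> /andP[/andP[/negbTE -> /negbTE -> _]].
- move=> t; rewrite !inE negb_or => /orP[]/eqP -> /andP[/andP[/negbTE n1 /negbTE n2] _] _.
    by rewrite /f' /c' !eqxx n1 n2.
  by rewrite /f' /c' !eqxx n1 n2 nuv.
clear H; clearbody o; move=> t; rewrite !inE => /orP[]/eqP ->.
  apply: star_proper_perm px _; first exact: nbrs_uniq.
  rewrite star_properE /=; case: xs sx xsP ou => [|x []] //= _ xsP ou.
    rewrite /c' /f' !(eqxx, nuv, nvu).
    by apply: star_colors_sub star1; rewrite /= eqxx.
  have [_ _ _ xu xv] := xsP x (mem_head _ _).
  by rewrite ou in star1; rewrite /c' /f' !(eqxx, nuv, nvu, xu, xv).
apply: star_proper_perm py _; first exact: nbrs_uniq.
rewrite star_properE /=.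
case: ys sy ysP ov => [|x []] //= _ ysP ov.
  rewrite /c' /f' !eqxx nuv.
  by apply: star_colors_sub star2; rewrite /= eqxx.
have [_ _ _ xv xu] := ysP x (mem_head _ _).
by rewrite ov in star2; rewrite /c' /f' xu xv !eqxx ?nuv ?nvu.
Qed.

Lemma extend_triangle S x v y : {in S, forall w, size (nbrs S w) <= 3} ->
  x \in S -> v \in S -> y \in S -> adj x v -> adj y v -> adj x y -> size (nbrs S v) <= 2 ->
  arc_colorable (S :\: [set x; v; y]%SET) -> arc_colorable S.
Proof.
move=> deg3 xS vS yS xv yv xy szv [c [f cf]].
have vx : adj v x by rewrite adj_sym.
have vy : adj v y by rewrite adj_sym.
have yx : adj y x by rewrite adj_sym.
have nxv : (x == v) = false by apply/negbTE/adj_neq.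
have nvx : (v == x) = false by apply/negbTE/adj_neq.
have nyv : (y == v) = false by apply/negbTE/adj_neq.
have nvy : (v == y) = false by apply/negbTE/adj_neq.
have nxy : (x == y) = false by apply/negbTE/adj_neq.
have nyx : (y == x) = false by apply/negbTE/adj_neq.
have [|w||xs sx px] := @nbrs_rest S x [:: v; y].
- by rewrite /= inE nvy.
- by rewrite !inE => /orP[]/eqP ->; rewrite mem_nbrs ?vS ?yS.
- exact: deg3.
have [|w||ys sy py] := @nbrs_rest S y [:: v; x].
- by rewrite /= inE nvx.
- by rewrite !inE => /orP[]/eqP ->; rewrite mem_nbrs ?vS ?xS.
- exact: deg3.
have pv : perm_eq (nbrs S v) [:: x; y].
  have uxy : uniq [:: x; y] by rewrite /= inE nxy.
  rewrite perm_sym; apply: uniq_perm (nbrs_uniq S v) _ => //.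
  have [|//|_ //] := uniq_min_size uxy (s2 := nbrs S v).
  by move=> w; rewrite !inE => /orP[]/eqP ->; rewrite mem_nbrs ?xS ?yS.
have xsP w : w \in xs -> [/\ w = head x xs, (w == x) = false, (w == v) = false & (w == y) = false].
  move=> wx; have wN : w \in nbrs S x by rewrite (perm_mem px) !inE wx !orbT.
  have := nbrs_uniq S x; rewrite (perm_uniq px) /= inE negb_or => /and3P[/andP[_ vX] yX _].
  move: wN; rewrite mem_nbrs => /andP[_ uw]; split=> //.
  - by case: xs sx wx {px vX yX} => [|z []] //= _; rewrite inE => /eqP.
  - by rewrite eq_sym; apply/negbTE/adj_neq.
  - by apply: contraNF vX => /eqP <-.
  - by apply: contraNF yX => /eqP <-.
have ysP w : w \in ys -> [/\ w = head y ys, (w == x) = false, (w == v) = false & (w == y) = false].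
  move=> wx; have wN : w \in nbrs S y by rewrite (perm_mem py) !inE wx !orbT.
  have := nbrs_uniq S y; rewrite (perm_uniq py) /= inE negb_or => /and3P[/andP[_ vX] xX _].
  move: wN; rewrite mem_nbrs => /andP[_ uw]; split=> //.
  - by case: ys sy wx {py vX xX} => [|z []] //= _; rewrite inE => /eqP.
  - by apply: contraNF xX => /eqP <-.
  - by apply: contraNF vX => /eqP <-.
  - by rewrite eq_sym; apply/negbTE/adj_neq.
(* All neighbours of the apex [v] lie in the triangle, so [o v] is a filler. *)
pose o z := if z == x then head x xs else head y ys.
have [||a [s [r [uq H]]]] := extend_coloring (T := [set x; v; y]%SET) (o := o) _ cf deg3.
- by apply/fintype.subsetP => z; rewrite !inE => /orP[/orP[]|]/eqP ->.
- move=> w t; rewrite !inE !negb_or -!andbA => /and4P[wx wv wy wS].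
  rewrite /o -orbA => /or3P[]/eqP -> wt.
  + rewrite eqxx; have : w \in nbrs S x by rewrite mem_nbrs wS adj_sym.
    by rewrite (perm_mem px) !inE (negbTE wv) (negbTE wy) => /xsP[].
  + have : w \in nbrs S v by rewrite mem_nbrs wS adj_sym.
    by rewrite (perm_mem pv) !inE (negbTE wx) (negbTE wy).
  + rewrite nyx; have : w \in nbrs S y by rewrite mem_nbrs wS adj_sym.
    by rewrite (perm_mem py) !inE (negbTE wv) (negbTE wx) => /ysP[].
have [g [h [fxy [fyx [fxv [fvx [fyv [fvy [cx [cy [cv]]]]]]]]]]] :=
  triangle_extension_exists (uq x) (uq y).
case/and5P=> gI hI starx stary starv.
pose c' z := if z == x then cx else if z == v then cv else if z == y then cy else c z.
pose f' w z := if w == x then (if z == v then fxv else if z == y then fxy else g)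
          else if w == v then (if z == x then fvx else fvy)
          else if w == y then (if z == v then fyv else if z == x then fyx else h)
          else if z == x then a x else if z == y then a y else f w z.
have ox : o x = head x xs by rewrite /o eqxx.
have oy : o y = head y ys by rewrite /o nyx.
have k1 : cx != c (o x) by move: starx => /and3P[_ /and4P[_ _ + _] _]; rewrite eq_sym.
have k2 : cy != c (o y) by move: stary => /and3P[_ /and4P[_ _ + _] _]; rewrite eq_sym.
rewrite !inE in gI hI; apply: (H c' f').
- by move=> z; rewrite /c' !inE !negb_or -!andbA => /and4P[/negbTE -> /negbTE -> /negbTE ->].
- move=> w z; rewrite /f' !inE !negb_or -!andbA => /and4P[/negbTE -> /negbTE -> /negbTE -> _].
  by move=> /and4P[/negbTE -> _ /negbTE ->].
- move=> t; rewrite !inE !negb_or -!andbA -orbA => /or3P[]/eqP -> /and4P[/negbTE n1 /negbTE n2 /negbTE n3 oS] ot.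
  + by rewrite /f' /c' !eqxx n1 n2 n3.
  + have : o v \in nbrs S v by rewrite mem_nbrs oS adj_sym.
    by rewrite (perm_mem pv) !inE n1 n3.
  + by rewrite /f' /c' !eqxx n1 n2 n3 nyx nyv.
clear H; clearbody o; move=> t; rewrite !inE -orbA => /or3P[]/eqP ->.
- apply: star_proper_perm px _; first exact: nbrs_uniq.
  rewrite star_properE /=; case: xs sx xsP ox => [|z []] //= _ xsP ox.
    rewrite /c' /f' !(eqxx, nvx, nyx, nyv, nvy, nxv, nxy).
    by apply: star_colors_sub starx; apply: (prefix_subseq [:: _; _] [:: _]).
  have [_ zx zv zy] := xsP z (mem_head _ _).
  by rewrite ox in starx; rewrite /c' /f' !(eqxx, nvx, nyx, nyv, nvy, nxv, nxy, zx, zv, zy).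
- apply: star_proper_perm pv _; first exact: nbrs_uniq.
  by rewrite star_properE /= /c' /f' !(eqxx, nvx, nyx, nyv, nvy, nxv, nxy).
- apply: star_proper_perm py _; first exact: nbrs_uniq.
  rewrite star_properE /=; case: ys sy ysP oy => [|z []] //= _ ysP oy.
    rewrite /c' /f' !(eqxx, nvx, nyx, nyv, nvy, nxv, nxy).
    by apply: star_colors_sub stary; apply: (prefix_subseq [:: _; _] [:: _]).
  have [_ zx zv zy] := ysP z (mem_head _ _).
  by rewrite oy in stary; rewrite /c' /f' !(eqxx, nvx, nyx, nyv, nvy, nxv, nxy, zx, zv, zy).
Qed.

(** With degrees at most 3 no edge leaves a K_4, so a fixed colouring of it can be put beside any
    colouring of the rest. *)
Lemma extend_K4 S (a b c d : G) : {in S, forall w, size (nbrs S w) <= 3} ->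
  uniq [:: a; b; c; d] -> {subset [:: a; b; c; d] <= S} ->
  {in [:: a; b; c; d] &, forall x y, x != y -> adj x y} ->
  arc_colorable (S :\: [set x in [:: a; b; c; d]]%SET) -> arc_colorable S.
Proof.
move LE : [:: a; b; c; d] => L deg3 uL LS LA [c0 [f0 cf]].
have nbL t : t \in L -> perm_eq (nbrs S t) (rem t L).
  move=> tL; rewrite perm_sym; have uR : uniq (rem t L) by rewrite rem_uniq.
  apply: uniq_perm (nbrs_uniq S t) _ => //.
  have [||_ e] := uniq_min_size uR (s2 := nbrs S t); last exact: e.
    move=> w; rewrite mem_rem_uniq // => /andP[wt wL].
    by rewrite mem_nbrs (LS w wL) (LA t w) // eq_sym.
  by rewrite size_rem // -LE; apply: deg3; apply: LS.
have [||al [s [r [_ H]]]] := extend_coloring (T := [set x in L]%SET) (o := id) _ cf deg3.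
- by apply/fintype.subsetP => z; rewrite inE => /LS.
- move=> w t; rewrite !inE => /andP[wL wS] tL wt.
  have : w \in nbrs S t by rewrite mem_nbrs wS adj_sym.
  by rewrite (perm_mem (nbL t tL)) => /mem_rem; rewrite (negbTE wL).
(* An explicit 6-colouring of K_4: [tc] lists the vertex colours, and entry [j] of row [i] in [tf]
   colours the incidence at vertex [i] towards vertex [j]. The diagonal of [tf] is filler. *)
pose tc := [:: 2; 0; 5; 1].
pose tf := [:: [:: 0; 4; 0; 3]; [:: 1; 0; 2; 3]; [:: 1; 4; 0; 3]; [:: 5; 4; 0; 0]].
pose h i : 'I_6 := inord i.
pose c' z := if z \in L then h (nth 0 tc (index z L)) else c0 z.
pose f' y z := if y \in L then h (nth 0 (nth [::] tf (index y L)) (index z L)) else f0 y z.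
apply: (H c' f').
- by move=> z; rewrite /c' !inE => /andP[/negbTE ->].
- by move=> y z; rewrite /f' !inE => /andP[/negbTE ->].
- by move=> t; rewrite !inE => tL; rewrite tL.
have hI : {in iota 0 6 &, injective h}.
  move=> i j; rewrite !mem_iota !add0n => i6 j6 /(congr1 val).
  by rewrite /= !inordK.
clear H; move=> t; rewrite inE => tL; apply: star_proper_perm (nbL t tL) _; first exact: nbrs_uniq.
have hstar k nb : k \in iota 0 6 ->
    all (fun x => [&& x.1.1 \in iota 0 6, x.1.2 \in iota 0 6 & x.2 \in iota 0 6]) nb ->
    star_colors k nb -> star_colors (h k) [seq (h x.1.1, h x.1.2, h x.2) | x <- nb].
  by move=> *; rewrite (star_colors_map hI).
move: uL tL; rewrite /c' /f' -LE /= !inE !negb_or -!andbA.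
case/and5P=> /negbTE ab /negbTE ac /negbTE ad /negbTE bc /and3P[/negbTE bd /negbTE cd _].
have ba : (b == a) = false by rewrite eq_sym.
have ca : (c == a) = false by rewrite eq_sym.
have da : (d == a) = false by rewrite eq_sym.
have cb : (c == b) = false by rewrite eq_sym.
have db : (d == b) = false by rewrite eq_sym.
have dc : (d == c) = false by rewrite eq_sym.
have E := (eqxx, ab, ac, ad, bc, bd, cd, ba, ca, da, cb, db, dc).
rewrite star_properE => /or4P[]/eqP ->; rewrite ?E /= ?inE ?E /=.
- by apply: (hstar 2 [:: (0, 4, 1); (5, 0, 1); (1, 3, 5)]).
- by apply: (hstar 0 [:: (2, 1, 4); (5, 2, 4); (1, 3, 4)]).
- by apply: (hstar 5 [:: (2, 1, 0); (0, 4, 2); (1, 3, 0)]).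
- by apply: (hstar 1 [:: (2, 5, 3); (0, 4, 3); (5, 0, 3)]).
Qed.

End Reductions.

(** * Theta-free graphs *)

Section Structure.
Variable G : sgraph.
Implicit Types (S T U : {set G}) (x y z w : G) (p s : seq G).
Local Notation path := (path (@adj G)).
Local Notation ucycle := (ucycle (@adj G)).

(* No subdivision of K_{2,3}: no three internally disjoint paths, each with an
   inner vertex, between two vertices. *)
Definition theta_free := forall q1 q2 s1 s2 s3,
  uniq (q1 :: q2 :: s1 ++ s2 ++ s3) -> s1 != [::] -> s2 != [::] -> s3 != [::] ->
  path q1 (rcons s1 q2) -> path q1 (rcons s2 q2) -> path q1 (rcons s3 q2) -> False.

Hypothesis no_theta : theta_free.

Lemma path_rev x s y : path x (rcons s y) = path y (rcons (rev s) x).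
Proof.
have := rev_path (@adj G) x (rcons s y).
rewrite last_rcons belast_rcons rev_cons => ->.
by apply: eq_path => a b; rewrite adj_sym.
Qed.

Lemma theta_perm x A z B y C w D :
  perm_eq ((x :: z :: A ++ (y :: rev B) ++ rcons (rev D) w) ++ C)
          (x :: A ++ z :: B ++ y :: C ++ w :: D).
Proof.
apply/permP => a; rewrite -!cats1 /= !count_cat /= !count_cat /= !count_rev !count_cat /=.
move: (count a A) (count a B) (count a C) (count a D) (nat_of_bool (a x)) (nat_of_bool (a y)).
by move: (nat_of_bool (a z)) (nat_of_bool (a w)); clear; lia.
Qed.

Lemma ear_perm x A y B C :
  perm_eq (x :: y :: A ++ rev B ++ C) ((x :: A ++ y :: B) ++ C).
Proof.
apply/permP => a; rewrite /= !count_cat /= count_rev ?count_cat /=.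
move: (count a A) (count a B) (count a C) (nat_of_bool (a x)) (nat_of_bool (a y)).
by clear; lia.
Qed.

(** The vertices [x] and [z] are hubs of three legs: along [A], through the chord to [y] and back
    along [B], and back along [D] to [w] and through the other chord. The last two always have inner
    vertices, so [A] must be empty. Rotating the cycle empties the other three arcs in the same
    way. *)
Lemma crossing_chords x A z B y C w D :
  ucycle (x :: A ++ z :: B ++ y :: C ++ w :: D) -> adj x y -> adj z w -> A = [::].
Proof.
case/andP => cyc uq xy zw; apply/eqP; apply/negPn/negP => nA.
move: cyc; rewrite /= !rcons_cat /= !rcons_cat /= !rcons_cat /=.
rewrite !cat_path /= !cat_path /= !cat_path /=.
move=> /andP[pA /andP[Az /andP[pB /andP[By /andP[pC /andP[Cw pD]]]]]].
apply: (no_theta (q1 := x) (q2 := z) (s1 := A) (s2 := y :: rev B) (s3 := rcons (rev D) w)) => //.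
- suff pe : perm_eq ((x :: z :: A ++ (y :: rev B) ++ rcons (rev D) w) ++ C)
                    (x :: A ++ z :: B ++ y :: C ++ w :: D).
    by move: uq; rewrite -(perm_uniq pe) cat_uniq => /and3P[].
  exact: theta_perm.
- by rewrite -size_eq0 size_rcons.
- by rewrite rcons_path pA.
- by rewrite /= xy -path_rev rcons_path pB.
- rewrite rcons_path last_rcons adj_sym zw andbT -path_rev; exact: pD.
Qed.

(** The two neighbours on the cycle leave room for only one more. *)
Lemma cycle_neighbours_distinct S x p u1 u2 : ucycle (x :: p) -> 1 < size p ->
  {subset p <= S} -> size (nbrs S x) <= 3 -> u1 \in nbrs S x -> u2 \in nbrs S x ->
  u1 \notin p -> u2 \notin p -> u1 = u2.
Proof.
move=> /andP[cyc uq] sp pS sz N1 N2 n1 n2; apply/eqP; apply/negPn/negP => n12.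
case: p => [|a p] // in cyc uq sp pS n1 n2 *; case/lastP: p => [|p b] // in cyc uq sp pS n1 n2 *.
have [xa bx] : adj x a /\ adj x b.
  move: cyc; rewrite /= rcons_path last_rcons => /andP[-> /andP[_]].
  by rewrite adj_sym.
have aP : a \in a :: rcons p b by rewrite mem_head.
have bP : b \in a :: rcons p b by rewrite inE mem_rcons mem_head orbT.
have ab : a != b.
  by move: uq => /= /and3P[_ + _]; apply: contraNneq => ->; rewrite mem_rcons mem_head.
suff : size [:: u1; u2; a; b] <= size (nbrs S x) by move/leq_trans/(_ sz).
apply: uniq_leq_size.
  rewrite /= !inE !negb_or n12 ab !andbT /=.
  by apply/andP; split; apply/andP; split;
     [apply: contraNneq n1|apply: contraNneq n1|apply: contraNneq n2|apply: contraNneq n2] => ->.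
move=> z; rewrite !inE => /or4P[]/eqP -> //; by rewrite mem_nbrs pS.
Qed.

(** * Minimal vertex sets with at most one leaving edge *)

Section MinimalCut.
Variables S T : {set G}.
Hypotheses (deg3 : {in S, forall u, size (nbrs S u) <= 3})
           (deg2 : {in S, forall u, 1 < size (nbrs S u)}).

Definition leaving U : {set G * G} :=
  [set e | [&& e.1 \in U, e.2 \in S :\: U & adj e.1 e.2]]%SET.

Hypotheses (TS : T \subset S) (T0 : T != finset.set0) (cutT : #|leaving T| <= 1)
  (minT : forall U, U \proper T -> U != finset.set0 -> 1 < #|leaving U|).

Lemma leaving_unique x y x' y' : x \in T -> y \in S -> y \notin T -> adj x y ->
  x' \in T -> y' \in S -> y' \notin T -> adj x' y' -> (x, y) = (x', y').
Proof.
move=> xT yS yT xy xT' yS' yT' xy'.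
have /card_le1_eqP H := cutT; apply: H; by rewrite !inE /= ?xT ?xT' ?yT ?yT' ?yS ?yS'.
Qed.

Lemma inner_neighbour x : x \in T -> exists2 y, y \in T & adj x y.
Proof.
move=> xT; have xS := fintype.subsetP TS _ xT.
have := deg2 xS; have := nbrs_uniq S x; have := mem_nbrs S x.
case: (nbrs S x) => [|y [|z s]] //= mem /andP[yz _] _.
have := mem y; rewrite mem_head => /esym/andP[yS xy].
have := mem z; rewrite !inE eqxx orbT => /esym/andP[zS xz].
have [yT|yT] := boolP (y \in T); first by exists y.
have [zT|zT] := boolP (z \in T); first by exists z.
have [yzE] := leaving_unique xT yS yT xy xT zS zT xz.
by rewrite yzE mem_head in yz.
Qed.

(* A component [U] of [T :\: C] sends at least two edges to [C]: otherwise [U]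
   or [T :\: U] would be a smaller set with at most one leaving edge. *)
Lemma two_attachments (C : {set G}) w : C \subset T -> C != finset.set0 -> w \in T :\: C ->
  exists u1 c1 u2 c2 p, [/\ (u1, c1) != (u2, c2), [/\ adj u1 c1, adj u2 c2, c1 \in C & c2 \in C],
    path u1 p, last u1 p = u2 & uniq (u1 :: p) /\ {subset u1 :: p <= T :\: C}].
Proof.
move=> CT C0 wTC; pose e : rel G := fun y z => [&& y \in T :\: C, z \in T :\: C & adj y z].
have esym : symmetric e by move=> y z; rewrite /e adj_sym andbCA.
pose U : {set G} := [set z | connect e w z]%SET.
have UTC z : z \in U -> z \in T :\: C.
  rewrite inE => /connectP[p]; elim/last_ind: p => [|p a _]; first by move=> _ ->.
  by rewrite rcons_path last_rcons => /andP[_ /and3P[_ + _]] ->.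
have UT : U \subset T by apply/fintype.subsetP => z /UTC /finset.setDP[].
have wU : w \in U by rewrite inE.
have Uclosed y z : y \in U -> z \in T :\: C -> adj y z -> z \in U.
  move=> yU zTC yz; have yTC := UTC _ yU; rewrite !inE in yU *.
  by apply: connect_trans yU _; apply: connect1; rewrite /e yTC zTC.
have Uconn y z : y \in U -> z \in U -> connect e y z.
  rewrite !inE => yU zU; by rewrite (connect_trans _ zU) // (sym_connect_sym esym).
clearbody U; have [c cC] : exists c, c \in C by apply/finset.set0Pn.
have cT : c \in T := fintype.subsetP CT _ cC.
have cU : c \notin U by apply: contraL cC => /UTC /finset.setDP[].
pose M := [set e | [&& e.1 \in U, e.2 \in C & adj e.1 e.2]]%SET.
suff : 1 < #|M|.
  case/card_gt1P => -[u1 c1] [[u2 c2] [m1 m2 ne]].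
  move: m1 m2; rewrite !inE /= => /and3P[U1 C1 a1] /and3P[U2 C2 a2].
  case/connectP: (Uconn _ _ U1 U2) => p0 ep0 lp0; case/shortenP: ep0 lp0 => p ep up _ lp.
  exists u1, c1, u2, c2, p; split=> //.
  - by apply: sub_path ep => a b /and3P[].
  - split=> // z; rewrite inE => /predU1P[->|zp].
      exact: UTC.
    elim: p u1 ep zp {lp up U1 a1 ne} => //= a p IH u1 /andP[/and3P[_ aT _] ep].
    by rewrite inE => /predU1P[->//|]; apply: IH ep.
rewrite ltnNge; apply/negP => M1.
have [/existsP[[u y] /and4P[/= uU yS yT uy]]|noU] :=
    boolP [exists e : G * G, [&& e.1 \in U, e.2 \in S, e.2 \notin T & adj e.1 e.2]].
  have : 1 < #|leaving (T :\: U)|.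
    apply: minT.
      apply/fintype.properP; split; first exact: finset.subsetDl.
      by exists w; [case/finset.setDP: wTC|rewrite !inE negb_and negbK wU].
    by apply/finset.set0Pn; exists c; rewrite !inE cU.
  move=> big; suff : #|leaving (T :\: U)| <= 1 by rewrite leqNgt big.
  apply: leq_trans M1.
  have swapI : injective (fun p : G * G => (p.2, p.1)) by move=> [? ?] [? ?] [-> ->].
  rewrite -(card_imset M swapI).
  apply: subset_leq_card; apply/fintype.subsetP => -[a b]; rewrite !inE /=.
  case/and3P => /andP[aU aT] /andP[/nandP bTU bS] ab.
  have bU : b \in U.
    case: bTU => [|bT]; first by rewrite negbK.
    have uT := fintype.subsetP UT _ uU.
    have [e1 _] := leaving_unique uT yS yT uy aT bS bT ab.
    by rewrite -e1 uU in aU.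
  apply/imsetP; exists (b, a) => //; rewrite !inE /= bU adj_sym ab andbT.
  apply: contraR aU => aC; apply: (Uclosed b) => //; last by rewrite adj_sym.
  by rewrite !inE aC aT.
have : 1 < #|leaving U|.
  apply: minT; last by apply/finset.set0Pn; exists w.
  by apply/fintype.properP; split=> //; exists c.
move=> big; suff : #|leaving U| <= 1 by rewrite leqNgt big.
apply: leq_trans M1.
apply: subset_leq_card; apply/fintype.subsetP => -[a b]; rewrite !inE /=.
case/and3P => aU /andP[bU bS] ab; rewrite aU ab andbT /=.
have bT : b \in T.
  apply: contraNT noU => bT; apply/existsP; exists (a, b); by rewrite /= aU bS bT.
by apply: contraR bU => bC; apply: (Uclosed a) => //; rewrite !inE bC.
Qed.

Definition cycle_in p := [/\ ucycle p, 2 < size p & {subset p <= T}].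

Lemma cycle_exists : exists p, cycle_in p.
Proof.
have [v vT] : exists v, v \in T by apply/finset.set0Pn.
have [w wT vw] := inner_neighbour vT.
have [|||u1 [c1 [u2 [c2 [p [ne [a1 a2 C1 C2] pp lp [up sub]]]]]]] :=
    @two_attachments [set v]%SET w.
- by rewrite finset.sub1set.
- by apply/finset.set0Pn; exists v; rewrite inE.
- by rewrite !inE wT eq_sym adj_neq.
move: C1 C2; rewrite !inE => /eqP c1v /eqP c2v; subst c1 c2.
have u12 : u1 != u2 by apply: contra ne => /eqP ->.
exists (v :: u1 :: p); split.
- rewrite /ucycle /= rcons_path pp lp adj_sym a1 a2 /= inE negb_or.
  have vn : v \notin u1 :: p by apply/negP => /sub; rewrite !inE eqxx.
  by move: vn up; rewrite /= inE negb_or => -> ->.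
- by case: p lp {pp up sub} => //= e; rewrite e eqxx in u12.
- move=> z; rewrite inE => /predU1P[->//|/sub]; by rewrite !inE => /andP[].
Qed.

(** A longest cycle is taken. If it misses a vertex of [T], two attachments give an ear; its feet
    [c1] and [c2] differ, as a vertex on the cycle has at most one neighbour off it. If the feet are
    consecutive the ear lengthens the cycle, and otherwise the ear and the two arcs of the cycle
    form a theta. *)
Lemma hamiltonian_cycle : exists p, cycle_in p /\ p =i T.
Proof.
pose P n := `[< exists2 p, cycle_in p & size p = n >].
have exP : exists n, P n.
  by have [p cp] := cycle_exists; exists (size p); apply/asboolP; exists p.
have ubP n : P n -> n <= #|T|.
  move/asboolP => [p [/andP[_ up] _ sub] <-].
  by rewrite -(card_uniqP up); apply/subset_leq_card/fintype.subsetP => z /sub.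
have [n /asboolP[p cp szp] maxn] := ex_maxnP exP ubP.
have {}maxn p' : cycle_in p' -> size p' <= size p.
  by move=> c'; rewrite szp; apply: maxn; apply/asboolP; exists p'.
exists p; split=> // z; apply/idP/idP; first by case: cp => _ _; apply.
apply: contraTT => zp; apply/negP => zT.
have [cycp szp3 pT] := cp.
have [|||u1 [c1 [u2 [c2 [q [ne [a1 a2 C1 C2] pq lq [uq sub]]]]]]] :=
    @two_attachments [set x in p]%SET z.
- by apply/fintype.subsetP => x; rewrite inE; apply: pT.
- by case: p szp3 {szp cp maxn cycp pT zp} => // x p _; apply/finset.set0Pn; exists x; rewrite !inE eqxx.
- by rewrite !inE zp zT.
rewrite !inE in C1 C2.
have {}sub x : x \in u1 :: q -> x \in T /\ x \notin p.
  by move/sub; rewrite finset.in_setD inE => /andP[].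
have u1q : u1 \in u1 :: q by rewrite mem_head.
have u2q : u2 \in u1 :: q by rewrite -lq mem_last.
have [i s rs] := rot_to C1.
have pE x : (x \in p) = (x \in c1 :: s) by rewrite -rs mem_rot.
have sz : size p = (size s).+1 by rewrite -(size_rot i p) rs.
have cyc : ucycle (c1 :: s) by rewrite -rs /ucycle rot_cycle rot_uniq.
have TSs x : x \in T -> x \in S by apply: (fintype.subsetP TS).
have sT : {subset s <= T} by move=> x xs; apply: pT; rewrite pE inE xs orbT.
have c1T : c1 \in T by apply: pT.
have c12 : c1 != c2.
  apply/negP => /eqP e; subst c2; move: ne; rewrite xpair_eqE eqxx andbT => /eqP; apply.
  have [u1T u1p] := sub _ u1q; have [u2T u2p] := sub _ u2q.
  apply: (cycle_neighbours_distinct (S := S) cyc).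
  - by rewrite -ltnS -sz.
  - by move=> x /sT/TSs.
  - exact/deg3/TSs.
  - by rewrite mem_nbrs TSs // adj_sym.
  - by rewrite mem_nbrs TSs // adj_sym.
  - by move: u1p; rewrite pE inE negb_or => /andP[].
  - by move: u2p; rewrite pE inE negb_or => /andP[].
have c2s : c2 \in s by move: C2; rewrite pE inE eq_sym (negbTE c12).
case/splitPr: c2s => p1 p2 in sz cyc pE sT rs *.
have /andP[cycs us] := cyc.
have [pp1 pp2] : path c1 (rcons p1 c2) /\ path c2 (rcons p2 c1).
  move: cycs; rewrite /= rcons_cat cat_path /= => /and3P[h1 h2 h3].
  by rewrite rcons_path h1 h2 h3.
have ps : path c1 (rcons (u1 :: q) c2) by rewrite /= rcons_path pq lq adj_sym a1 a2.
have usq : uniq ((c1 :: p1 ++ c2 :: p2) ++ u1 :: q).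
  rewrite cat_uniq us uq andbT; apply/hasPn => x /sub[_].
  by rewrite pE.
have subT x : x \in (c1 :: p1 ++ c2 :: p2) ++ u1 :: q -> x \in T.
  by rewrite mem_cat -pE => /orP[/pT//|/sub[]].
have longer p' : perm_eq p' ((c1 :: p1 ++ c2 :: p2) ++ u1 :: q) -> cycle (@adj G) p' -> False.
  move=> pe cycp'; have : cycle_in p'.
    split; last by move=> x; rewrite (perm_mem pe); apply: subT.
      by rewrite /ucycle (perm_uniq pe) usq andbT.
    by rewrite (perm_size pe) size_cat (leq_trans szp3) // sz leq_addr.
  by move/maxn; rewrite (perm_size pe) size_cat leqNgt sz addnS ltnS leq_addr.
have [p10|p10] := eqVneq p1 [::].
  subst p1; apply: (longer (c1 :: (u1 :: q) ++ c2 :: p2)).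
    by rewrite [X in perm_eq _ X]cat_cons perm_cons (perm_catC (u1 :: q)).
  by rewrite /cycle -cat_rcons rcons_cat cat_path ps last_rcons.
have [p20|p20] := eqVneq p2 [::].
  subst p2; apply: (longer (c1 :: p1 ++ c2 :: rev (u1 :: q))).
    by rewrite /= perm_cons -!catA !perm_cat2l /= perm_cons perm_rev.
  by rewrite /cycle -cat_rcons rcons_cat cat_path pp1 last_rcons -path_rev.
apply: (no_theta (q1 := c1) (q2 := c2) (s1 := p1) (s2 := rev p2) (s3 := u1 :: q)) => //.
- have pe : perm_eq (c1 :: c2 :: p1 ++ rev p2 ++ u1 :: q) ((c1 :: p1 ++ c2 :: p2) ++ u1 :: q).
    exact: ear_perm.
  by rewrite (perm_uniq pe).
- by apply: contra p20 => /eqP e; rewrite -(revK p2) e.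
- by rewrite -path_rev.
Qed.

(** The edge [xy] is a chord of the Hamiltonian cycle, or an edge of it when [p2] is empty. The last
    clause keeps the leaving edge of [T] away from the inner vertices of the arc [p1]. *)
Definition closed_arc x p1 y p2 :=
  [/\ ucycle (x :: p1 ++ y :: p2), x :: p1 ++ y :: p2 =i T, p1 != [::], adj x y &
      {in p1, forall z, {subset nbrs S z <= T}}].

Definition reducible :=
  [\/ exists u v, [/\ u \in S, v \in S, adj u v, size (nbrs S u) <= 2 & size (nbrs S v) <= 2],
      exists x v y, [/\ [/\ x \in S, v \in S & y \in S], adj x v, adj y v, adj x y &
                       size (nbrs S v) <= 2] |
      exists a b c d, [/\ uniq [:: a; b; c; d], {subset [:: a; b; c; d] <= S} &
                         {in [:: a; b; c; d] &, forall x y, x != y -> adj x y}]].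

Lemma closed_arc_exists : exists x p1 y p2, closed_arc x p1 y p2.
Proof.
have [p [[cyc sz3 pT] pE]] := hamiltonian_cycle.
(* Here [r] is the end in [T] of the leaving edge, or any vertex of [T] if there is none. The cycle
   is then cut at [r], so that all vertices but [r] and its predecessor are inside the arc. *)
have [r rP] : exists r, r \in T /\ {in T, forall z, z != r -> {subset nbrs S z <= T}}.
  have [/existsP[[r w] /and4P[/= rT wS wT rw]]|no] :=
    boolP [exists e : G * G, [&& e.1 \in T, e.2 \in S, e.2 \notin T & adj e.1 e.2]].
    exists r; split=> // z zT zr u; rewrite mem_nbrs => /andP[uS zu].
    apply: contraR zr => uT.
    by have [->] := leaving_unique zT uS uT zu rT wS wT rw.
  have [r rT] : exists r, r \in T by apply/finset.set0Pn.
  exists r; split=> // z zT _ u; rewrite mem_nbrs => /andP[uS zu].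
  by apply: contraR no => uT; apply/existsP; exists (z, u); rewrite /= zT uS uT.
case: rP => rT rP; have rp : r \in p by rewrite pE.
have [i s rs] := rot_to rp.
have cyc' : ucycle (r :: s) by rewrite -rs /ucycle rot_cycle rot_uniq.
have sE : r :: s =i T by move=> z; rewrite -rs mem_rot.
have : 1 < size s by rewrite -ltnS -[(size s).+1]/(size (r :: s)) -rs size_rot.
case/lastP: s => [|p1 y] // in rs cyc' sE *; rewrite size_rcons ltnS => sp1.
exists r, p1, y, [::]; rewrite -cats1 in cyc' sE; split=> //.
- by rewrite -size_eq0 -lt0n.
- by move: cyc'; rewrite cats1 => /andP[/=]; rewrite rcons_path last_rcons adj_sym => /andP[].
- move=> z zp; apply: rP; first by rewrite -sE inE mem_cat zp orbT.
  move: cyc' => /andP[_ /= /andP[+ _]]; apply: contraNneq => <-.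
  by rewrite mem_cat zp.
Qed.

(** Induction on the length of the arc. The third neighbour [w] of an inner vertex [z] of degree 3
    lies on the cycle. If it is on the arc or one of its ends, [zw] closes a shorter arc, which
    inherits closedness. Otherwise [zw] crosses [xy], and nothing but a K_4 is left. *)
Lemma closed_arc_reducible x p1 y p2 : closed_arc x p1 y p2 -> reducible.
Proof.
have [n] := ubnP (size p1); elim: n x p1 y p2 => // n IH x p1 y p2 szn arc.
have [cyc cE p1n xy clo] := arc; have /andP[cyc0 uq] := cyc.
have TSs z : z \in T -> z \in S by apply: (fintype.subsetP TS).
have xS : x \in S by apply: TSs; rewrite -cE mem_head.
have yS : y \in S by apply: TSs; rewrite -cE inE mem_cat mem_head !orbT.
have p1S z : z \in p1 -> z \in S by move=> zp; apply: TSs; rewrite -cE inE mem_cat zp orbT.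
have [/allP small|/allPn[z zp1]] := boolP (all (fun z => size (nbrs S z) <= 2) p1).
  move: cyc0; rewrite /= rcons_cat cat_path /=.
  case: p1 p1n p1S small {szn arc cyc cE clo uq} => [|z1 [|z2 p1]] //= _ p1S small.
    rewrite andbT => /and3P[xz zy _]; apply: Or32; exists x, z1, y.
    rewrite [adj y z1]adj_sym; split=> //; first by split=> //; apply: p1S; rewrite mem_head.
    by apply: small; rewrite mem_head.
  move=> /andP[/and3P[xz z12 _] _]; apply: Or31; exists z1, z2.
  by split; rewrite ?p1S ?small ?inE ?eqxx ?orbT.
rewrite -ltnNge => big.
have zS := p1S z zp1; have zT := clo z zp1.
have [l [m p1E]] : exists l m, p1 = l ++ z :: m.
  by case/splitPr: zp1 => l m; exists l, m.
have ucycleC (s1 s2 : seq G) : ucycle (s1 ++ s2) -> ucycle (s2 ++ s1).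
  by rewrite /path.ucycle -(rot_cycle (size s1)) -(rot_uniq (size s1)) rot_size_cat.
have memC (s1 s2 : seq G) : s1 ++ s2 =i T -> s2 ++ s1 =i T.
  by move=> e t; rewrite -e !mem_cat orbC.
(* The excluded vertices are the neighbours of [z] on the cycle; the defaults [x] and [y] serve when
   [l] or [m] is empty. *)
have [w wN wab] : exists2 w, w \in nbrs S z & w \notin [:: last x l; head y m].
  apply/hasP; rewrite -[has _ _]negbK -all_predC; apply/negP => /allP H.
  move: big; rewrite ltnNge => /negP; apply.
  apply: (uniq_leq_size (s2 := [:: last x l; head y m])) (nbrs_uniq S z) _ => t tN.
  by have := H t tN; rewrite /= negbK.
move: (wN); rewrite mem_nbrs => /andP[wS zw]; have wz : adj w z by rewrite adj_sym.
have : w \in x :: p1 ++ y :: p2 by rewrite cE; apply: zT.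
have wnz : (w == z) = false by apply/negbTE/adj_neq.
subst p1; rewrite -[x :: _]cat_cons -cat_cons -[(_ ++ _) ++ _]catA mem_cat cat_cons.
rewrite [w \in z :: _]inE wnz /= -cat_rcons mem_cat => /or3P[wl|wm|wp2].
- have [l1 [k lE]] : exists l1 k, x :: l = l1 ++ w :: k.
    by case/splitPr: wl => l1 k; exists l1, k.
  have kn : k != [::].
    apply: contra wab => /eqP k0; rewrite inE; have := congr1 (last x) lE.
    by rewrite k0 last_cat /= => ->; rewrite eqxx.
  have kl t : t \in k -> t \in l.
    case: l1 lE => [|x' l1] /= [_ ->] // tk.
    by rewrite mem_cat inE tk !orbT.
  have LE : x :: (l ++ z :: m) ++ y :: p2 = l1 ++ w :: k ++ z :: m ++ y :: p2.
    transitivity ((x :: l) ++ z :: m ++ y :: p2); first by rewrite /= -catA.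
    by rewrite lE -catA.
  apply: (IH w k z ((m ++ y :: p2) ++ l1)).
    have := congr1 size lE; rewrite size_cat /= => szl.
    move: szn; rewrite size_cat /= addnS !ltnS; apply: leq_trans.
    apply: leq_trans (leq_addr _ _); rewrite -ltnS szl addnS ltnS; exact: leq_addl.
  have rE : w :: k ++ z :: (m ++ y :: p2) ++ l1 = (w :: k ++ z :: m ++ y :: p2) ++ l1.
    by rewrite /= -!catA /= -?catA.
  rewrite /closed_arc rE; split=> //.
  + by apply: ucycleC; rewrite -LE.
  + by apply: memC; rewrite -LE.
  + by move=> t /kl tl; apply: clo; rewrite mem_cat tl.
- have [k [l2 mE]] : exists k l2, rcons m y = k ++ w :: l2.
    by case/splitPr: wm => k l2; exists k, l2.
  have kn : k != [::].
    have hE : head y m = head x (rcons m y) by clear; case: m.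
    by apply: contra wab => /eqP k0; rewrite !inE hE mE k0 eqxx orbT.
  have km t : t \in k -> t \in m.
    case/lastP: l2 mE => [|l2 y']; first by rewrite cats1 => /rcons_inj[-> _].
    by rewrite -rcons_cons -rcons_cat => /rcons_inj[-> _] tk; rewrite mem_cat tk.
  have LE : x :: (l ++ z :: m) ++ y :: p2 = (x :: l) ++ z :: k ++ w :: l2 ++ p2.
    transitivity ((x :: l) ++ z :: rcons m y ++ p2); first by rewrite /= -catA /= cat_rcons.
    by rewrite mE -catA.
  apply: (IH z k w ((l2 ++ p2) ++ x :: l)).
    have := congr1 size mE; rewrite size_cat size_rcons /= addnS => -[szm].
    move: szn; rewrite size_cat /= addnS !ltnS; apply: leq_trans.
    apply: leq_trans (leq_addl _ _); rewrite szm; exact: leq_addr.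
  have rE : z :: k ++ w :: (l2 ++ p2) ++ x :: l = (z :: k ++ w :: l2 ++ p2) ++ x :: l.
    by rewrite /= -!catA /= -?catA.
  rewrite /closed_arc rE; split=> //.
  + by apply: ucycleC; rewrite -LE.
  + by apply: memC; rewrite -LE.
  + by move=> t /km tm; apply: clo; rewrite mem_cat inE tm !orbT.
have [C [D p2E]] : exists C D, p2 = C ++ w :: D by case/splitPr: wp2 => C D; exists C, D.
subst p2; have cyc1 : ucycle (x :: l ++ z :: m ++ y :: C ++ w :: D).
  by move: cyc; rewrite -catA.
have yx : adj y x by rewrite adj_sym.
(* Each of the four rotations of the cycle empties one of the arcs between consecutive chord
   ends. *)
have l0 := crossing_chords cyc1 xy zw.
have cyc2 : ucycle (z :: m ++ y :: C ++ w :: D ++ x :: l).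
  by have /ucycleC := (cyc1 : ucycle ((x :: l) ++ z :: m ++ y :: C ++ w :: D)); rewrite /= -!catA /= -!catA.
have m0 := crossing_chords cyc2 zw yx.
have cyc3 : ucycle (y :: C ++ w :: D ++ x :: l ++ z :: m).
  by have /ucycleC := (cyc2 : ucycle ((z :: m) ++ y :: C ++ w :: D ++ x :: l)); rewrite /= -!catA /= -!catA.
have C0 := crossing_chords cyc3 yx wz.
have cyc4 : ucycle (w :: D ++ x :: l ++ z :: m ++ y :: C).
  by have /ucycleC := (cyc3 : ucycle ((y :: C) ++ w :: D ++ x :: l ++ z :: m)); rewrite /= -!catA /= -!catA.
have D0 := crossing_chords cyc4 wz xy; subst l m C D.
apply: Or33; exists x, z, y, w; move: cyc1 => /andP[/= /and5P[xz zy yw wx _] uq'].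
split=> //.
  by move=> t; rewrite !inE => /or4P[]/eqP ->.
have A := (xy, yx, xz, zy, yw, wx, zw, wz).
move=> s t; rewrite !inE => /or4P[]/eqP -> /or4P[]/eqP ->; rewrite ?eqxx ?A //;
  by rewrite adj_sym A.
Qed.



End MinimalCut.

(** No edge leaves [S] itself, so candidates exist, and one of least cardinality is minimal. *)
Lemma minimal_cut_exists S : S != finset.set0 -> exists T, [/\ T \subset S, T != finset.set0,
  #|leaving S T| <= 1 & forall U, U \proper T -> U != finset.set0 -> 1 < #|leaving S U|].
Proof.
move=> S0; pose P U := [&& U \subset S, U != finset.set0 & #|leaving S U| <= 1].
have PS : P S.
  rewrite /P fintype.subxx S0 /= (_ : leaving S S = finset.set0) ?cards0 //.
  by apply/setP => e; rewrite !inE andNb /= andbF.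
case: (arg_minnP (fun U : {set G} => #|U|) PS) => T /and3P[TS T0 cT] minT.
exists T; split=> // U UT U0; rewrite ltnNge; apply/negP => cU.
have := proper_card UT; rewrite ltnNge => /negP; apply; apply: minT.
by rewrite /P U0 cU (fintype.subset_trans (fintype.proper_sub UT) TS).
Qed.

Lemma theta_free_arc_colorable S :
  {in S, forall u, size (nbrs S u) <= 3} -> arc_colorable S.
Proof.
have [n] := ubnP #|S|; elim: n S => // n IH S szn deg3.
have deg3' S' : S' \subset S -> {in S', forall u, size (nbrs S' u) <= 3}.
  move=> sub u uS'; apply: leq_trans (deg3 u (fintype.subsetP sub _ uS')).
  apply: uniq_leq_size (nbrs_uniq _ _) _ => v; rewrite !mem_nbrs => /andP[vS ->].
  by rewrite (fintype.subsetP sub).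
have IH' T v : v \in S -> v \in T -> arc_colorable (S :\: T).
  move=> vS vT; apply: IH; last exact/deg3'/finset.subsetDl.
  rewrite -ltnS; apply: leq_trans szn; rewrite ltnS; apply: proper_card.
  apply/fintype.properP; split; first exact: finset.subsetDl.
  by exists v => //; rewrite inE vT.
have [->|S0] := eqVneq S finset.set0.
  by exists (fun=> ord0), (fun _ _ => ord0) => u; rewrite inE.
have [/existsP[v /andP[vS sz]]|no1] := boolP [exists v, (v \in S) && (size (nbrs S v) <= 1)].
  by apply: extend_deg1 sz _ => //; apply: (IH' _ v); rewrite // inE.
have deg2 : {in S, forall u, 1 < size (nbrs S u)}.
  move=> u uS; rewrite ltnNge; apply: contra no1 => sz.
  by apply/existsP; exists u; rewrite uS.
have [T [TS T0 cT minT]] := minimal_cut_exists S0.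
have [x [p1 [y [p2 arc]]]] := closed_arc_exists deg3 deg2 TS T0 cT minT.
have [[u [v [uS vS uv szu szv]]]|[a [v [b [[aS vS bS] av bv ab sz]]]]|[a [b [c [d [uq sub cl]]]]]] :=
  closed_arc_reducible TS arc.
- by apply: extend_edge uv szu szv _ => //; apply: (IH' _ u); rewrite // !inE eqxx.
- by apply: extend_triangle av bv ab sz _ => //; apply: (IH' _ a); rewrite // !inE eqxx.
- have aS : a \in S by apply: sub; rewrite mem_head.
  by apply: extend_K4 uq sub cl _ => //; apply: (IH' _ a); rewrite // !inE eqxx.
Qed.

Theorem theta_free_vi_colorable : max_degree G <= 3 -> vi_colorable G 6.
Proof.
move=> D3; apply/vi_colorableP; apply: theta_free_arc_colorable => u _.
apply: leq_trans D3; rewrite /max_degree.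
apply: leq_trans (leq_bigmax u); rewrite cardE; apply: uniq_leq_size (nbrs_uniq _ _) _ => v.
by rewrite mem_nbrs mem_enum !inE.
Qed.

End Structure.

Import Order.TTheory GRing.Theory Num.Theory.
Import numFieldNormedType.Exports.
Local Open Scope classical_set_scope.
Local Open Scope ring_scope.

(** * Crossing parity *)

(** The points reached from [x] form a nonempty subset that is open and closed in [F]. This one
    principle yields the constancy of parities, the chains of segments along a connected set, and
    the radius that serves a given pair of points. *)
Lemma connected_local_relation (X : topologicalType) (F : set X) (E : X -> X -> Prop) :
  connected F ->
  (forall x y z, F x -> F y -> F z -> E x y -> E y z -> E x z) ->
  (forall x, F x -> \forall y \near x, F y -> E x y /\ E y x) ->
  forall x y, F x -> F y -> E x y.
Proof.
move=> cF tr loc x y Fx Fy.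
pose O z := [set w | F w -> E z w /\ E w z]°.
have Oz z : F z -> O z z by move=> Fz; apply: loc.
have OP z w : O z w -> F w -> E z w /\ E w z by move=> /nbhs_singleton.
suff : [set z | F z /\ E x z] = F by move=> /seteqP[_ /(_ y Fy)[]].
apply: cF.
- by exists x; split=> //; have [] := OP _ _ (Oz _ Fx) Fx.
- exists (\bigcup_(z in [set z | F z /\ E x z]) O z).
    by apply: bigcup_open => z _; apply: open_interior.
  apply/seteqP; split=> w /= [Fw]; first by split=> //; exists w => //; apply: Oz.
  by move=> [z [Fz xz] /OP /(_ Fw)[zw _]]; split=> //; apply: tr zw.
- exists (~` \bigcup_(z in [set z | F z /\ ~ E x z]) O z).
    by apply: open_closedC; apply: bigcup_open => z _; apply: open_interior.
  apply/seteqP; split=> w /= [Fw].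
    move=> xw; split=> // -[z [Fz xz] /OP /(_ Fw)[_ wz]]; apply: xz; exact: tr wz.
  move=> H; split=> //; apply: contrapT => xw; apply: H; exists w => //; exact: Oz.
Qed.

Section PolygonParity.
Variable R : realType.
Notation plane := (R * R)%type.
Implicit Types (u v w z : plane) (p : seq plane).

Definition seg u v : set plane :=
  [set z | exists2 t, 0 <= t <= 1 & z = (u.1 + t * (v.1 - u.1), u.2 + t * (v.2 - u.2))].

(** The signed vertical distance from [z] up to the line [uv]. For a vertical edge the divisor is 0
    and the value has no such meaning, but both ends of the edge then compare alike with [z.1] and
    the edge is never counted. *)
Definition height u v z : R := u.2 + (v.2 - u.2) / (v.1 - u.1) * (z.1 - u.1) - z.2.

(* Both count crossings of the edge [uv] with the upward ray from [z]; they treat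
   an end of the edge on the ray as lying slightly to the left, resp. to the right,
   which makes them right, resp. left, continuous in [z.1]. Their total over a
   closed polygon is the same. *)
Definition crosses z u v : bool := ((u.1 <= z.1) != (v.1 <= z.1)) && (0 < height u v z).
Definition crosses_lt z u v : bool := ((u.1 < z.1) != (v.1 < z.1)) && (0 < height u v z).
Definition above z w : bool := (w.1 == z.1) && (z.2 < w.2).

Lemma seg_straddle u v z : u.1 != v.1 -> u.1 <= z.1 <= v.1 \/ v.1 <= z.1 <= u.1 ->
  seg u v (z.1, z.2 + height u v z).
Proof.
move=> nuv str; have nvu : v.1 - u.1 != 0 by rewrite subr_eq0 eq_sym.
exists ((z.1 - u.1) / (v.1 - u.1)).
  case: str => /andP[h1 h2].
    have d : 0 < v.1 - u.1 by rewrite subr_gt0 lt_neqAle nuv (le_trans h1 h2).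
    rewrite divr_ge0 ?subr_ge0 ?(ltW d) //=; last by rewrite -subr_ge0 ltW.
    by rewrite ler_pdivrMr // mul1r lerB.
  have d : 0 < u.1 - v.1 by rewrite subr_gt0 lt_neqAle eq_sym nuv (le_trans h1 h2).
  have -> : (z.1 - u.1) / (v.1 - u.1) = (u.1 - z.1) / (u.1 - v.1).
    by field; rewrite nvu (lt0r_neq0 d).
  rewrite divr_ge0 ?subr_ge0 ?(ltW d) //=; last by rewrite -subr_ge0 ltW.
  by rewrite ler_pdivrMr // mul1r lerB.
by rewrite /height; congr (_, _); field.
Qed.

Lemma height_neq0 u v z : ~ seg u v z -> u.1 != v.1 ->
  u.1 <= z.1 <= v.1 \/ v.1 <= z.1 <= u.1 -> height u v z != 0.
Proof.
move=> nz nuv str; apply/negP => /eqP h0; apply: nz.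
by have := seg_straddle nuv str; rewrite h0 addr0 -surjective_pairing.
Qed.

(** The two conventions disagree only about ends of the edge that lie on the ray. If both ends are
    on the vertical line through [z], nothing is counted, and they are both above or both below,
    because [z] is off the edge. *)
Lemma crosses_above z u v : ~ seg u v z ->
  crosses z u v (+) crosses_lt z u v = above z u (+) above z v.
Proof.
move=> nz; rewrite /crosses /crosses_lt /above.
have hu : u.1 = z.1 -> height u v z = u.2 - z.2 by rewrite /height => ->; rewrite subrr mulr0 addr0.
have hv : v.1 = z.1 -> u.1 != z.1 -> height u v z = v.2 - z.2.
  by rewrite /height => <- n; field; rewrite subr_eq0 eq_sym.
have [ul|ul|ue] := ltgtP u.1 z.1; have [vl|vl|ve] := ltgtP v.1 z.1 => //=;
  rewrite ?addbb ?addbF ?addFb //.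
- by rewrite hv ?subr_gt0 // lt_eqF.
- by rewrite hv ?subr_gt0 // gt_eqF.
- by rewrite hu // subr_gt0.
- by rewrite hu // subr_gt0.
have nu : u.2 != z.2.
  apply/negP => /eqP e; apply: nz; exists 0; rewrite ?lexx ?ler01 //.
  by rewrite !mul0r !addr0 ue e -surjective_pairing.
have nv : v.2 != z.2.
  apply/negP => /eqP e; apply: nz; exists 1; rewrite ?lexx ?ler01 //.
  by rewrite !mul1r !subrKC ve e -surjective_pairing.
have [h1|h1|e] := ltgtP z.2 u.2; have [h2|h2|e'] := ltgtP z.2 v.2 => //;
  rewrite ?e ?e' ?eqxx // in nu nv; exfalso; apply: nz.
- exists ((u.2 - z.2) / (u.2 - v.2)).
    have d : 0 < u.2 - v.2 by lra.
    by rewrite divr_ge0 ?ler_pdivrMr //; lra.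
  rewrite ue ve subrr mulr0 addr0 [LHS]surjective_pairing; congr (_, _); field.
  by lra.
- exists ((z.2 - u.2) / (v.2 - u.2)).
    have d : 0 < v.2 - u.2 by lra.
    by rewrite divr_ge0 ?ler_pdivrMr //; lra.
  rewrite ue ve subrr mulr0 addr0 [LHS]surjective_pairing; congr (_, _); field.
  by lra.
Qed.

Lemma crosses_local z u v : ~ seg u v z -> \forall z' \near z,
  (z.1 <= z'.1 -> crosses z' u v = crosses z u v) /\
  (z'.1 <= z.1 -> crosses_lt z' u v = crosses_lt z u v).
Proof.
move=> nz.
have c1 : (fun w : plane => w.1) @ z --> z.1 by exact: cvg_fst.
have c2 : (fun w : plane => w.2) @ z --> z.2 by exact: cvg_snd.
have right (a : R) : \forall z' \near z, z.1 <= z'.1 -> (a <= z'.1) = (a <= z.1).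
  have [az|za] := leP a z.1; first by near=> z' => h; rewrite (le_trans az h).
  apply: filterS (cvgr_lt _ c1 _ za) => z' h _.
  by apply/negbTE; rewrite -ltNge.
have left (a : R) : \forall z' \near z, z'.1 <= z.1 -> (a < z'.1) = (a < z.1).
  have [az|za] := ltP a z.1; last by near=> z' => h; apply/negbTE; rewrite -leNgt (le_trans h za).
  by apply: filterS (cvgr_gt _ c1 _ az) => z' h _.
have ch : height u v @ z --> height u v z.
  apply: cvgB => //; apply: cvgD; first exact: cvg_cst.
  by apply: cvgM; [exact: cvg_cst|apply: cvgB => //; exact: cvg_cst].
have [[/eqP nuv str]|nstr] : (u.1 <> v.1 /\ (u.1 <= z.1 <= v.1 \/ v.1 <= z.1 <= u.1)) \/
    ~ (u.1 <> v.1 /\ (u.1 <= z.1 <= v.1 \/ v.1 <= z.1 <= u.1)) by exact: EM.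
  have hn := height_neq0 nz nuv str.
  have hloc : \forall z' \near z, (0 < height u v z') = (0 < height u v z).
    have [hp|hp|/esym/eqP] := ltgtP 0 (height u v z); last by rewrite (negbTE hn).
      by apply: filterS (cvgr_gt _ ch _ hp).
    by apply: filterS (cvgr_lt _ ch _ hp) => z' h; apply/negbTE; rewrite -leNgt ltW.
  near=> z'; split=> h; rewrite /crosses /crosses_lt.
    have -> : (0 < height u v z') = (0 < height u v z) by near: z'.
    have -> : (u.1 <= z'.1) = (u.1 <= z.1) by move: h; near: z'; apply: right.
    by have -> : (v.1 <= z'.1) = (v.1 <= z.1) by move: h; near: z'; apply: right.
  have -> : (0 < height u v z') = (0 < height u v z) by near: z'.
  have -> : (u.1 < z'.1) = (u.1 < z.1) by move: h; near: z'; apply: left.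
  by have -> : (v.1 < z'.1) = (v.1 < z.1) by move: h; near: z'; apply: left.
(* What remains is a point outside the closed vertical strip of the edge, or a vertical edge: both
   ends compare alike, and nothing is counted at or near [z]. *)
have nle : (u.1 <= z.1) = (v.1 <= z.1).
  apply/idP/idP => h; apply: contrapT => /negP; rewrite -ltNge => h'; apply: nstr.
    by split; [move=> e; rewrite e leNgt h' in h|left; rewrite h ltW].
  by split; [move=> e; rewrite -e leNgt h' in h|right; rewrite h ltW].
have nlt : (u.1 < z.1) = (v.1 < z.1).
  apply/idP/idP => h; apply: contrapT => /negP; rewrite -leNgt => h'; apply: nstr.
    by split; [move=> e; rewrite e ltNge h' in h|left; rewrite h' ltW].
  by split; [move=> e; rewrite -e ltNge h' in h|right; rewrite h' ltW].
near=> z'; split=> h; rewrite /crosses /crosses_lt ?nle ?nlt.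
  have -> : (u.1 <= z'.1) = (u.1 <= z.1) by move: h; near: z'; apply: right.
  have -> : (v.1 <= z'.1) = (v.1 <= z.1) by move: h; near: z'; apply: right.
  by rewrite nle eqxx.
have -> : (u.1 < z'.1) = (u.1 < z.1) by move: h; near: z'; apply: left.
have -> : (v.1 < z'.1) = (v.1 < z.1) by move: h; near: z'; apply: left.
by rewrite nlt eqxx.
Unshelve. all: by end_near. Qed.

End PolygonParity.

(** * Polygonal chains and their parity *)

Section Polygons.
Variable R : realType.
Notation plane := (R * R)%type.
Implicit Types (u v w x y z : plane) (p : seq plane) (K F : set plane).

Fixpoint parity z x p : bool :=
  if p is y :: p' then crosses z x y (+) parity z y p' else false.

Fixpoint parity_lt z x p : bool :=
  if p is y :: p' then crosses_lt z x y (+) parity_lt z y p' else false.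

Fixpoint trace x p : set plane :=
  if p is y :: p' then seg x y `|` trace y p' else [set x].

(** The sum of [crosses_above] over the edges telescopes to the two ends of the chain. *)
Lemma parity_above z x p : ~ trace x p z ->
  parity z x p (+) parity_lt z x p = above z x (+) above z (last x p).
Proof.
elim: p x => [|y p IH] x /=; first by rewrite addbb.
move=> nz; rewrite addbACA IH; last by move=> h; apply: nz; right.
by rewrite crosses_above => [|h]; [rewrite -addbA [above z y (+) (_ (+) _)]addbA addbb|apply: nz; left].
Qed.

Lemma parity_local z x p : ~ trace x p z -> \forall z' \near z,
  (z.1 <= z'.1 -> parity z' x p = parity z x p) /\
  (z'.1 <= z.1 -> parity_lt z' x p = parity_lt z x p).
Proof.
elim: p x => [|y p IH] x /= nz; first by near=> z'.
have n1 : ~ seg x y z by move=> h; apply: nz; left.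
have n2 : ~ trace y p z by move=> h; apply: nz; right.
have h1 := crosses_local n1; have h2 := IH _ n2.
apply: filterS2 h1 h2 => z' [a1 b1] [a2 b2]; split=> h; first by rewrite a1 // a2.
by rewrite b1 // b2.
Unshelve. all: by end_near. Qed.

(** A closed polygon is given as two chains from [x] to a common end; modulo 2 the orientation of
    the second does not matter. *)
Definition closed_parity z x p p' := parity z x p (+) parity z x p'.

(** To the right of [z] the count [parity] is locally constant, to the left [parity_lt], and the
    ends cancel in [parity_above] when the polygon is closed. *)
Lemma closed_parity_connected F x p p' : connected F -> last x p = last x p' ->
  (forall z, F z -> ~ trace x p z /\ ~ trace x p' z) ->
  forall z z', F z -> F z' -> closed_parity z x p p' = closed_parity z' x p p'.
Proof.
move=> cF lp off; have lt_eq z : F z ->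
    closed_parity z x p p' = parity_lt z x p (+) parity_lt z x p'.
  move=> /off[n1 n2]; have := parity_above n1; have := parity_above n2; rewrite /closed_parity lp.
  move: (parity z x p) (parity z x p') (parity_lt z x p) (parity_lt z x p').
  by move: (above z x) (above z (last x p')); do 6!case.
apply: (connected_local_relation cF) => [z1 z2 z3 _ _ _ -> //|z Fz].
have [n1 n2] := off z Fz; have h1 := parity_local n1; have h2 := parity_local n2.
apply: filterS2 h1 h2 => z' [a1 b1] [a2 b2] Fz'.
suff e : closed_parity z x p p' = closed_parity z' x p p' by rewrite e.
have [h|/ltW h] := leP z.1 z'.1; first by rewrite /closed_parity a1 // a2.
by rewrite !lt_eq // b1 // b2.
Qed.

Lemma segl u v : seg u v u.
Proof. by exists 0; rewrite ?lexx ?ler01 // !mul0r !addr0 -surjective_pairing. Qed.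

Lemma segr u v : seg u v v.
Proof. by exists 1; rewrite ?lexx ?ler01 // !mul1r !subrKC -surjective_pairing. Qed.

Lemma seg_image u v :
  seg u v = (fun t : R => (u.1 + t * (v.1 - u.1), u.2 + t * (v.2 - u.2))) @` `[0, 1].
Proof.
apply/seteqP; split=> z /= [t]; first by move=> h ->; exists t => //; rewrite /= in_itv.
by rewrite /= in_itv /= => h <-; exists t.
Qed.

Lemma seg_continuous u v :
  continuous (fun t : R => (u.1 + t * (v.1 - u.1), u.2 + t * (v.2 - u.2)) : plane).
Proof.
move=> t; have h (a b : R) : (fun t => a + t * b) @ t --> a + t * b.
  by apply: cvgD; [exact: cvg_cst|apply: cvgM; [exact: cvg_id|exact: cvg_cst]].
exact: (cvg_pair (h _ _) (h _ _)).
Qed.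

Lemma seg_connected u v : connected (seg u v).
Proof.
rewrite seg_image; apply: connected_continuous_connected; first exact: segment_connected.
apply: continuous_subspaceT; exact: seg_continuous.
Qed.

Lemma seg_closed u v : closed (seg u v).
Proof.
rewrite seg_image; apply: compact_closed; first exact: norm_hausdorff.
apply: continuous_compact; last exact: segment_compact.
apply: continuous_subspaceT; exact: seg_continuous.
Qed.

Lemma seg_ball z r u v w : ball z r u -> ball z r v -> seg u v w -> ball z r w.
Proof.
move=> [/= u1 u2] [/= v1 v2] [t /andP[t0 t1] ->].
have conv (a b c : R) : `|a - b| < r -> `|a - c| < r -> `|a - (b + t * (c - b))| < r.
  rewrite !ltr_norml => /andP[h1 h2] /andP[h3 h4].
  have [->|tn] := eqVneq t 1; first by apply/andP; split; lra.
  have t1' : t < 1 by rewrite lt_neqAle tn.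
  by apply/andP; split; nra.
by split; apply: conv.
Qed.

Definition follows K (r : R) x p := forall w, trace x p w -> exists2 k, K k & ball k r w.

Lemma followsW K K' r r' x p : K `<=` K' -> r <= r' -> follows K r x p -> follows K' r' x p.
Proof. by move=> KK rr h w /h[k /KK Kk b]; exists k => //; apply: le_ball b. Qed.

Lemma follows_cons K r x y p : 0 < r -> seg x y `<=` K -> follows K r y p ->
  follows K r x (y :: p).
Proof.
move=> r0 sK h w /= [/sK Kw|/h//]; exists w => //; exact: ballxx.
Qed.

Lemma trace_cat x p p' : trace x (p ++ p') `<=` trace x p `|` trace (last x p) p'.
Proof.
elim: p x => [|y p IH] x /=; first by move=> w; right.
by move=> w [h|/IH[h|h]]; [left; left|left; right|right].
Qed.

(** A connected set may contain no path between two of its points, but it is chained by segments as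
    short as one likes. *)
Lemma follows_connected K r x y : connected K -> 0 < r -> K x -> K y ->
  exists2 p, last x p = y & follows K r x p.
Proof.
move=> cK r0 Kx Ky.
apply: (connected_local_relation (E := fun x y => exists2 p, last x p = y & follows K r x p) cK) => //.
  move=> a b c _ _ _ [p lp fp] [p' lp' fp']; exists (p ++ p'); first by rewrite last_cat lp.
  by move=> w /trace_cat[/fp//|]; rewrite lp => /fp'.
move=> {x y Kx Ky} x Kx; near=> y => Ky.
have step a b : K a -> K b -> ball a r b -> follows K r a [:: b].
  move=> Ka Kb ab w /= [sw|->]; last by exists b => //; apply: ballxx.
  by exists a => //; apply: seg_ball sw => //; apply: ballxx.
have xy : ball x r y by near: y; apply: nbhsx_ballx.
by split; [exists [:: y] | exists [:: x]] => //; apply: step => //; apply: ball_sym.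
Unshelve. all: by end_near. Qed.

(** The set [F] may come arbitrarily close to [K], so no radius need serve all of [F]; one is found
    for each pair of points, shrinking along the chain that joins them. *)
Lemma closed_parity_far K F : closed K -> connected F -> (forall z, F z -> ~ K z) ->
  forall z z', F z -> F z' -> exists2 r, 0 < r &
    forall x p p', last x p = last x p' -> follows K r x p -> follows K r x p' ->
      closed_parity z x p p' = closed_parity z' x p p'.
Proof.
move=> clK cF off; apply: (connected_local_relation cF).
  move=> a b c _ _ _ [r1 r10 h1] [r2 r20 h2]; exists (Num.min r1 r2); first by rewrite lt_min r10.
  move=> x p p' lp f1 f2; rewrite h1 ?h2 //; apply: followsW; try exact: f1; try exact: f2;
    by rewrite // ge_min lexx ?orbT.
move=> z Fz; have : nbhs z (~` K) by apply: (open_nbhs_nbhs (conj (closed_openC clK) (off z Fz))).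
(* One half of the radius is spent on moving the point, the other on the distance from the polygon
   to [K]. *)
move/nbhs_ballP => [r /= r0 br]; have r20 : 0 < r / 2 by rewrite divr_gt0.
have main z' : ball z (r / 2) z' -> forall x p p', last x p = last x p' ->
    follows K (r / 2) x p -> follows K (r / 2) x p' ->
    closed_parity z x p p' = closed_parity z' x p p'.
  move=> zz' x p p' lp f1 f2.
  apply: (closed_parity_connected (F := seg z z')) => //; try exact: segl; try exact: segr.
    exact: seg_connected.
  move=> w /(seg_ball (ballxx z r20) zz') zw.
  have far q : follows K (r / 2) x q -> ~ trace x q w.
    move=> f /f[k Kk kw]; apply: (br k) => //.
    rewrite [r]splitr; apply: ball_triangle zw _; exact: ball_sym.
  by split; apply: far.
near=> z' => Fz'; have zz' : ball z (r / 2) z' by near: z'; apply: nbhsx_ballx.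
by split; exists (r / 2) => // x p p' lp f1 f2; rewrite (main z').
Unshelve. all: by end_near. Qed.

Lemma crosses_vertical z z' u v : z.1 = z'.1 -> (forall w, seg z z' w -> ~ seg u v w) ->
  crosses z u v = crosses z' u v.
Proof.
move=> e off; rewrite /crosses -e; case str: ((u.1 <= z.1) != (v.1 <= z.1)) => //=.
have nuv : u.1 != v.1 by apply: contraTneq str => ->; rewrite eqxx.
have str' : u.1 <= z.1 <= v.1 \/ v.1 <= z.1 <= u.1.
  move: str; have [h1|h1] := leP u.1 z.1; have [h2|h2] := leP v.1 z.1 => // _.
    by left; rewrite ltW.
  by right; rewrite ltW.
have sw := seg_straddle nuv str'.
have hE : height u v z' = height u v z + z.2 - z'.2 by rewrite /height -e; ring.
apply/idP/idP => h; apply: contrapT => /negP; rewrite -leNgt => h'; apply: off sw.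
  exists (height u v z / (z'.2 - z.2)); rewrite hE in h'.
    have d : 0 < z'.2 - z.2 by lra.
    by rewrite divr_ge0 ?ler_pdivrMr //; lra.
  by rewrite /= -e subrr mulr0 addr0; congr (_, _); field; lra.
exists (- height u v z / (z.2 - z'.2)); rewrite hE in h.
  have d : 0 < z.2 - z'.2 by lra.
  by rewrite divr_ge0 ?ler_pdivrMr //; lra.
by rewrite /= -e subrr mulr0 addr0; congr (_, _); field; lra.
Qed.

(** The parity of an open chain can jump when the point passes below an end of the chain; a vertical
    move avoids this. *)
Lemma parity_vertical z z' x p : z.1 = z'.1 -> (forall w, seg z z' w -> ~ trace x p w) ->
  parity z x p = parity z' x p.
Proof.
move=> e; elim: p x => [|y p IH] x //= off; congr (_ (+) _).
  by apply: crosses_vertical => // w h1 h2; apply: (off w h1); left.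
by apply: IH => w h1 h2; apply: (off w h1); right.
Qed.

End Polygons.

(** * Three legs in a disc *)

Section Tripod.
Variable R : realType.
Notation plane := (R * R)%type.
Implicit Types (u v w x y z : plane) (p : seq plane) (K F A W : set plane).

(** Euclidean, whereas [ball] in the product is a square. Round discs are strictly convex: a segment
    from inside to a point of the circle meets the circle only there, and three distinct points of a
    circle are not collinear. *)
Definition sqdist (q w : plane) : R := (w.1 - q.1) ^+ 2 + (w.2 - q.2) ^+ 2.

Lemma seg_in_disc q (r : R) u x w : sqdist q u < r -> sqdist q x = r -> seg u x w ->
  sqdist q w <= r /\ (sqdist q w = r -> w = x).
Proof.
move=> ur xr [t /andP[t0 t1] ->].
have e : sqdist q (u.1 + t * (x.1 - u.1), u.2 + t * (x.2 - u.2)) =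
    (1 - t) * sqdist q u + t * r - t * (1 - t) * ((u.1 - x.1) ^+ 2 + (u.2 - x.2) ^+ 2).
  by rewrite -xr /sqdist /=; ring.
have pos : 0 <= t * (1 - t) * ((u.1 - x.1) ^+ 2 + (u.2 - x.2) ^+ 2).
  by apply: mulr_ge0; [apply: mulr_ge0 => //; lra|apply: addr_ge0; apply: sqr_ge0].
have [t1'|tn] := eqVneq t 1.
  by rewrite t1' !mul1r !subrKC -surjective_pairing xr.
have lt1 : 0 < 1 - t by rewrite subr_gt0 lt_neqAle tn.
have h : (1 - t) * sqdist q u < (1 - t) * r by rewrite ltr_pM2l.
by rewrite e; split=> [|h']; [lra|exfalso; lra].
Qed.

Definition same_side K (r : R) z z' := forall x p p', last x p = last x p' ->
  follows K r x p -> follows K r x p' -> closed_parity z x p p' = closed_parity z' x p p'.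

(* A leg of the theta graph outside the disc of squared radius [r] around [q]:
   [W] leads from the boundary point [x] to [e], and [A] is its part up to [p]. *)
Record outer_leg q (r : R) (e x p : plane) A W : Prop := OuterLeg {
  leg_conn : connected A;
  leg_x : A x;
  leg_p : A p;
  leg_sub : A `<=` W;
  leg_closed : closed W;
  leg_connW : connected W;
  leg_e : W e;
  leg_circle : sqdist q x = r;
  leg_out : forall w, W w -> r <= sqdist q w /\ (sqdist q w = r -> w = x) }.

Definition disc q (r : R) : set plane := [set w | sqdist q w <= r].

(** Along the line through [x1] and [x2] the squared distance is a quadratic polynomial in the
    parameter [t], and it takes the value [r] at 0 and 1 already. *)
Lemma sqdist_chord q (r : R) x1 x2 x3 : sqdist q x1 = r -> sqdist q x2 = r ->
  sqdist q x3 = r -> x1.1 < x2.1 ->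
  (x3.2 - x1.2) * (x2.1 - x1.1) = (x2.2 - x1.2) * (x3.1 - x1.1) -> x3 = x1 \/ x3 = x2.
Proof.
move=> h1 h2 h3 lt12 col; have d : x2.1 - x1.1 != 0 by rewrite subr_eq0 gt_eqF.
pose t := (x3.1 - x1.1) / (x2.1 - x1.1).
have e1 : x3.1 = x1.1 + t * (x2.1 - x1.1) by rewrite /t; field.
have e2 : x3.2 = x1.2 + t * (x2.2 - x1.2).
  by rewrite /t mulrAC [_ * (x2.2 - x1.2)]mulrC -col mulfK // addrC subrK.
have D0 : (x2.1 - x1.1) ^+ 2 + (x2.2 - x1.2) ^+ 2 != 0.
  apply: lt0r_neq0; apply: ltr_pwDl; last exact: sqr_ge0.
  by rewrite exprn_even_gt0.
have : t * (t - 1) * ((x2.1 - x1.1) ^+ 2 + (x2.2 - x1.2) ^+ 2) = 0.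
  have -> : t * (t - 1) * ((x2.1 - x1.1) ^+ 2 + (x2.2 - x1.2) ^+ 2) =
      sqdist q (x1.1 + t * (x2.1 - x1.1), x1.2 + t * (x2.2 - x1.2))
      - (1 - t) * sqdist q x1 - t * sqdist q x2 by rewrite /sqdist /=; ring.
  by rewrite -e1 -e2 -surjective_pairing h1 h2 h3; ring.
move/eqP; rewrite mulf_eq0 (negbTE D0) orbF mulf_eq0 subr_eq0 => /orP[]/eqP t01.
  by left; rewrite [LHS]surjective_pairing e1 e2 t01 !mul0r !addr0 -surjective_pairing.
by right; rewrite [LHS]surjective_pairing e1 e2 t01 !mul1r !subrKC -surjective_pairing.
Qed.

Lemma connectedU_at F F' z : connected F -> connected F' -> F z -> F' z -> connected (F `|` F').
Proof. by move=> cF cF' h h'; apply: connectedU => //; exists z. Qed.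

(** Since [x1.1] is less than [x2.1], a vertical move through the midpoint [o] of the chord changes
    sides. The polygon through legs 1 and 2 is tested at [z3], on the side of [x3]; the two others
    at [z'], on the opposite side, away from the segment from [o] to [x3]. Each of the three
    parities agrees with the one at the common point [y]. *)
Lemma tripod_contradiction_ordered q (r s : R) e y x1 x2 x3 (p1 p2 p3 : plane) A1 A2 A3 W1 W2 W3 :
  0 < s -> x1.1 < x2.1 ->
  outer_leg q r e x1 p1 A1 W1 -> outer_leg q r e x2 p2 A2 W2 -> outer_leg q r e x3 p3 A3 W3 ->
  (forall w, A1 w -> ~ W2 w /\ ~ W3 w) -> (forall w, A2 w -> ~ W1 w /\ ~ W3 w) ->
  (forall w, A3 w -> ~ W1 w /\ ~ W2 w) ->
  same_side (disc q r `|` (W2 `|` W3)) s p1 y ->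
  same_side (disc q r `|` (W1 `|` W3)) s p2 y ->
  same_side (disc q r `|` (W1 `|` W2)) s p3 y -> False.
Proof.
move=> s0 lt12 L1 L2 L3 A1W A2W A3W S1 S2 S3.
have c1 := leg_circle L1; have c2 := leg_circle L2; have c3 := leg_circle L3.
have n12 : x1 <> x2 by move=> h; move: lt12; rewrite h ltxx.
have n13 : x1 <> x3.
  by move=> h; have [_] := A1W _ (leg_x L1); apply; rewrite h; apply/(leg_sub L3)/(leg_x L3).
have n23 : x2 <> x3.
  by move=> h; have [_] := A2W _ (leg_x L2); apply; rewrite h; apply/(leg_sub L3)/(leg_x L3).
pose o : plane := ((x1.1 + x2.1) / 2, (x1.2 + x2.2) / 2).
have so : sqdist q o < r.
  have -> : sqdist q o = r - ((x2.1 - x1.1) ^+ 2 + (x2.2 - x1.2) ^+ 2) / 4.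
    have -> : r = (sqdist q x1 + sqdist q x2) / 2 by rewrite c1 c2; field.
    by rewrite /sqdist /o /=; field.
  rewrite ltrBlDr ltrDl divr_gt0 //; apply: ltr_pwDl; last exact: sqr_ge0.
  by rewrite exprn_gt0 // subr_gt0.
(* A linear form that vanishes exactly on the line through [x1] and [x2]; [sg] below is its sign at
   [x3]. *)
pose L w : R := (w.2 - x1.2) * (x2.1 - x1.1) - (x2.2 - x1.2) * (w.1 - x1.1).
have Lseg u v t : L (u.1 + t * (v.1 - u.1), u.2 + t * (v.2 - u.2)) = (1 - t) * L u + t * L v.
  by rewrite /L /=; ring.
have Lo : L o = 0 by rewrite /L /o /=; field.
have L10 : L x1 = 0 by rewrite /L; ring.
have L20 : L x2 = 0 by rewrite /L; ring.
have L3n : L x3 != 0.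
  apply/negP => /eqP h; have col := subr0_eq h.
  by case: (sqdist_chord c1 c2 c3 lt12 col) => h'; [apply: n13|apply: n23].
have [sg [sg3 sgsq]] : exists sg : R, 0 < sg * L x3 /\ (sg = 1 \/ sg = -1).
  have [h|h|h] := ltgtP 0 (L x3).
  - by exists 1; rewrite mul1r; split=> //; left.
  - by exists (-1); rewrite mulN1r oppr_gt0; split=> //; right.
  - by rewrite -h eqxx in L3n.
(* The tails of legs 1 and 2 will be compared between [z3] and [z'], so [W1] and [W2] are kept away
   from [o]; leg 3 will be compared only between [y] and [z']. *)
have [rho rho0 offW] : exists2 rho, 0 < rho & forall w, ball o rho w -> ~ W1 w /\ ~ W2 w.
  have cl : closed (W1 `|` W2) by apply: closedU; [apply: leg_closed L1|apply: leg_closed L2].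
  have no : (~` (W1 `|` W2)) o.
    by case=> [/(leg_out L1)[]|/(leg_out L2)[]]; rewrite leNgt so.
  have /nbhs_ballP[rho /= rho0 h] := open_nbhs_nbhs (conj (closed_openC cl) no).
  by exists rho => // w /h nw; split=> h'; apply: nw; [left|right].
have [eps [eps0 epsr epsd]] : exists eps : R, [/\ 0 < eps, eps < rho / 2 &
    forall t, `|t| <= eps -> sqdist q (o.1, o.2 + t) < r].
  pose M := `|o.2 - q.2| + 1; have M0 : 0 < M by rewrite ltr_wpDl.
  pose g := r - sqdist q o; have g0 : 0 < g by rewrite subr_gt0.
  have gM : 0 < g / (4 * M) by rewrite divr_gt0 // mulr_gt0.
  (* As [|t|] is at most 1, the squared distance grows by at most [2 * |t| * M], hence by at most
     [g / 2]. *)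
  exists (Num.min (Num.min 1 (rho / 4)) (g / (4 * M))); split.
  - by rewrite !lt_min ltr01 gM divr_gt0.
  - by rewrite !gt_min; apply/orP; left; apply/orP; right; lra.
  move=> t; rewrite !le_min => /andP[/andP[t1 _] t2].
  have -> : sqdist q (o.1, o.2 + t) = sqdist q o + 2 * t * (o.2 - q.2) + t ^+ 2.
    by rewrite /sqdist /=; ring.
  have b1 : t * (o.2 - q.2) <= `|t| * `|o.2 - q.2| by rewrite -normrM ler_norm.
  have b2 : t ^+ 2 <= `|t|.
    by rewrite -real_normK ?num_real // expr2 ler_piMl.
  have b3 : `|t| * M <= g / 4.
    have -> : g / 4 = g / (4 * M) * M by field; apply: lt0r_neq0.
    by rewrite ler_pM2r.
  have b4 : `|t| * M = `|t| * `|o.2 - q.2| + `|t| by rewrite /M; ring.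
  have t0 := normr_ge0 t; have u0 : 0 <= `|t| * `|o.2 - q.2| by apply: mulr_ge0.
  rewrite -mulrA; have gE : g = r - sqdist q o by [].
  by lra.
pose z3 : plane := (o.1, o.2 + sg * eps).
pose z' : plane := (o.1, o.2 - sg * eps).
have nsg : `|sg| = 1 by case: sgsq => ->; rewrite ?normrN normr1.
have sz3 : sqdist q z3 < r by apply: epsd; rewrite normrM nsg mul1r gtr0_norm.
have sz' : sqdist q z' < r by apply: epsd; rewrite normrN normrM nsg mul1r gtr0_norm.
have sgsg : sg * sg = 1 by case: sgsq => ->; ring.
have d12 : 0 < x2.1 - x1.1 by rewrite subr_gt0.
have Lz3 : 0 < sg * L z3.
  have -> : sg * L z3 = (sg * sg) * eps * (x2.1 - x1.1) + sg * L o by rewrite /L /z3 /=; ring.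
  by rewrite sgsg Lo mulr0 addr0 mul1r mulr_gt0.
have Lz' : sg * L z' < 0.
  have -> : sg * L z' = - ((sg * sg) * eps * (x2.1 - x1.1)) + sg * L o by rewrite /L /z' /=; ring.
  by rewrite sgsg Lo mulr0 addr0 mul1r oppr_lt0 mulr_gt0.
have in_out x (p : plane) A W xx w u : outer_leg q r e x p A W -> sqdist q u < r -> sqdist q xx = r ->
    W w -> seg u xx w -> xx = x.
  move=> LL ur xr /(leg_out LL)[h1 h2] /(seg_in_disc ur xr)[h3 h4].
  have e' : sqdist q w = r by apply/eqP; rewrite eq_le h3 h1.
  by rewrite -(h2 e') -(h4 e').
have segC u v w : seg u v w -> seg v u w.
  by move=> [t /andP[t0 t1] ->]; exists (1 - t); [apply/andP; split; lra|congr (_, _); ring].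
(* [z3] and [z'] lie next to [o] on the two sides of the chord [x1 x2]: leg 3 is
   extended to [z3], and legs 1 and 2 to [z']. *)
have [r3 r30 M3] : exists2 r3, 0 < r3 & same_side ((W1 `|` W2) `|` (seg o x1 `|` seg o x2)) r3 p3 z3.
  apply: (closed_parity_far (F := A3 `|` seg x3 z3)).
  - by apply: closedU; apply: closedU; try exact: seg_closed; [exact: leg_closed L1|exact: leg_closed L2].
  - apply: (connectedU_at (z := x3)); [exact: leg_conn L3|exact: seg_connected|exact: leg_x L3|exact: segl].
  - move=> w [Aw|sw].
      have [h1 h2] := A3W _ Aw; have Ww := leg_sub L3 Aw.
      by move=> [[//|//]|[/(in_out _ _ _ _ _ _ _ L3 so c1 Ww)|/(in_out _ _ _ _ _ _ _ L3 so c2 Ww)]].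
    have sw' := segC _ _ _ sw.
    move=> [[Ww|Ww]|].
    + by have /esym := in_out _ _ _ _ _ _ _ L1 sz3 c3 Ww sw'.
    + by have /esym := in_out _ _ _ _ _ _ _ L2 sz3 c3 Ww sw'.
    have Lw : 0 < sg * L w.
      move: sw => [t /andP[t0 t1] ->]; rewrite Lseg mulrDr !(mulrCA sg).
      have [->|tn] := eqVneq t 0; first by rewrite subr0 mul1r mul0r addr0.
      have tp : 0 < t by rewrite lt_neqAle eq_sym tn.
      by apply: ltr_wpDl; [apply: mulr_ge0; [lra|exact: ltW]|exact: mulr_gt0].
    by move=> [] [t _ e']; move: Lw; rewrite e' Lseg Lo ?L10 ?L20 !mulr0 addr0 mulr0 ltxx.
  - by left; apply: leg_p L3.
  - by right; apply: segr.
have below xx w : L xx = 0 -> seg xx z' w -> sg * L w <= 0 /\ (L w = 0 -> w = xx).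
  move=> Lx [t /andP[t0 t1] ->]; rewrite Lseg Lx mulr0 add0r; split.
    by rewrite mulrCA; apply: mulr_ge0_le0 => //; apply: ltW.
  move/eqP; rewrite mulf_eq0 => /orP[/eqP ->|/eqP h].
    by rewrite !mul0r !addr0 -surjective_pairing.
  by move: Lz'; rewrite h mulr0 ltxx.
have upper w : seg o x3 w -> 0 <= sg * L w /\ (L w = 0 -> w = o).
  move=> [t /andP[t0 t1] ->]; rewrite Lseg Lo mulr0 add0r; split.
    by rewrite mulrCA; apply: mulr_ge0 => //; apply: ltW.
  move/eqP; rewrite mulf_eq0 (negbTE L3n) orbF => /eqP ->.
  by rewrite !mul0r !addr0 -surjective_pairing.
have move_below (xa xb pa pb : plane) A W A' W' : outer_leg q r e xa pa A W -> outer_leg q r e xb pb A' W' ->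
    (forall w, A w -> ~ W' w /\ ~ W3 w) -> L xa = 0 -> L xb = 0 -> xa <> xb -> xa <> x3 ->
    exists2 ra, 0 < ra & same_side ((W' `|` W3) `|` (seg o xb `|` seg o x3)) ra pa z'.
  move=> La Lb AW La0 Lb0 nab na3; have ca := leg_circle La; have cb := leg_circle Lb.
  apply: (closed_parity_far (F := A `|` seg xa z')).
  - by apply: closedU; apply: closedU; try exact: seg_closed; [exact: leg_closed Lb|exact: leg_closed L3].
  - apply: (connectedU_at (z := xa)); [exact: leg_conn La|exact: seg_connected|exact: leg_x La|exact: segl].
  - move=> w [Aw|sw].
      have [h1 h2] := AW _ Aw; have Ww := leg_sub La Aw.
      move=> [[//|//]|[/(in_out _ _ _ _ _ _ _ La so cb Ww)/esym//|/(in_out _ _ _ _ _ _ _ La so c3 Ww)/esym//]].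
    have sw' := segC _ _ _ sw; have [b1 b2] := below xa w La0 sw.
    move=> [[Ww|Ww]|[so'|so']].
    + exact: nab (in_out _ _ _ _ _ _ _ Lb sz' ca Ww sw').
    + exact: na3 (in_out _ _ _ _ _ _ _ L3 sz' ca Ww sw').
    + have Lw : L w = 0 by move: so' => [t _ ->]; rewrite Lseg Lo Lb0 !mulr0 addr0.
      have wa := b2 Lw; have [_ h] := seg_in_disc so cb so'.
      by apply: nab; rewrite -wa; apply: h; rewrite wa.
    + have [u1 u2] := upper w so'.
      have Lw : L w = 0.
        have /eqP : sg * L w = 0 by apply/eqP; rewrite eq_le b1 u1.
        rewrite mulf_eq0 => /orP[/eqP h|/eqP //].
        by move: nsg => /eqP; rewrite h normr0 eq_sym oner_eq0.
      by move: so; rewrite -(u2 Lw) (b2 Lw) ca ltxx.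
  - by left; apply: leg_p La.
  - by right; apply: segr.
have n21 : x2 <> x1 by move=> h; apply: n12.
have [r1 r10 M1] := move_below _ _ _ _ _ _ _ _ L1 L2 A1W L10 L20 n12 n13.
have [r2 r20 M2] := move_below _ _ _ _ _ _ _ _ L2 L1 A2W L20 L10 n21 n23.
(* The same three chains enter all six relations, so they must respect all the radii; [rho / 2] is
   for the vertical move. *)
pose eta := Num.min (Num.min (Num.min s (rho / 2)) r3) (Num.min r1 r2).
have eta0 : 0 < eta by rewrite !lt_min s0 r30 r10 r20 divr_gt0.
have [eta_s eta_rho eta3 eta1 eta2] : [/\ eta <= s, eta <= rho / 2, eta <= r3, eta <= r1 & eta <= r2].
  by split; rewrite !ge_min lexx ?orbT.
have [t1 l1 f1] := follows_connected (leg_connW L1) eta0 (leg_sub L1 (leg_x L1)) (leg_e L1).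
have [t2 l2 f2] := follows_connected (leg_connW L2) eta0 (leg_sub L2 (leg_x L2)) (leg_e L2).
have [t3 l3 f3] := follows_connected (leg_connW L3) eta0 (leg_sub L3 (leg_x L3)) (leg_e L3).
have app K rr (za zb : plane) xa xb ta tb Wa Wb : same_side K rr za zb -> eta <= rr ->
    last xa ta = e -> last xb tb = e -> follows Wa eta xa ta -> follows Wb eta xb tb ->
    Wa `<=` K -> Wb `<=` K -> seg o xa `<=` K -> seg o xb `<=` K ->
    parity za o (xa :: ta) (+) parity za o (xb :: tb) =
    parity zb o (xa :: ta) (+) parity zb o (xb :: tb).
  have KK : K `<=` K by [].
  move=> ss err la lb fa fb WaK WbK sa sb; apply: ss; first by rewrite /= la lb.
    by apply: (followsW KK err); apply: follows_cons => //; apply: followsW fa.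
  by apply: (followsW KK err); apply: follows_cons => //; apply: followsW fb.
have sD x : sqdist q x = r -> seg o x `<=` disc q r.
  by move=> cx w /(seg_in_disc so cx)[].
have E1 := app _ _ _ _ _ _ _ _ _ _ S1 eta_s l2 l3 f2 f3.
have E2 := app _ _ _ _ _ _ _ _ _ _ S2 eta_s l1 l3 f1 f3.
have E3 := app _ _ _ _ _ _ _ _ _ _ S3 eta_s l1 l2 f1 f2.
have E4 := app _ _ _ _ _ _ _ _ _ _ M1 eta1 l2 l3 f2 f3.
have E5 := app _ _ _ _ _ _ _ _ _ _ M2 eta2 l1 l3 f1 f3.
have E6 := app _ _ _ _ _ _ _ _ _ _ M3 eta3 l1 l2 f1 f2.
have {}E1 := E1 (fun w h => or_intror (or_introl h)) (fun w h => or_intror (or_intror h))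
  (fun w h => or_introl (sD _ c2 _ h)) (fun w h => or_introl (sD _ c3 _ h)).
have {}E2 := E2 (fun w h => or_intror (or_introl h)) (fun w h => or_intror (or_intror h))
  (fun w h => or_introl (sD _ c1 _ h)) (fun w h => or_introl (sD _ c3 _ h)).
have {}E3 := E3 (fun w h => or_intror (or_introl h)) (fun w h => or_intror (or_intror h))
  (fun w h => or_introl (sD _ c1 _ h)) (fun w h => or_introl (sD _ c2 _ h)).
have {}E4 := E4 (fun w h => or_introl (or_introl h)) (fun w h => or_introl (or_intror h))
  (fun w h => or_intror (or_introl h)) (fun w h => or_intror (or_intror h)).
have {}E5 := E5 (fun w h => or_introl (or_introl h)) (fun w h => or_introl (or_intror h))
  (fun w h => or_intror (or_introl h)) (fun w h => or_intror (or_intror h)).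
have {}E6 := E6 (fun w h => or_introl (or_introl h)) (fun w h => or_introl (or_intror h))
  (fun w h => or_intror (or_introl h)) (fun w h => or_intror (or_intror h)).
(* The segment from [z3] to [z'] stays within [rho / 2] of [o] and the chain within [rho / 2] of
   [W], so they cannot meet. *)
have V x t W : follows W eta x t -> (forall w, ball o rho w -> ~ W w) ->
    parity z3 x t = parity z' x t.
  move=> ft off; apply: parity_vertical => // w sw /ft[k Wk kw]; apply: off Wk.
  have bz : ball o (rho / 2) w.
    apply: seg_ball sw; split; rewrite /ball /= ?subrr ?normr0 ?divr_gt0 //.
      by rewrite opprD addrA subrr sub0r normrN normrM nsg mul1r gtr0_norm.
    by rewrite opprB addrCA subrr addr0 normrM nsg mul1r gtr0_norm.
  rewrite [rho]splitr; apply: ball_triangle bz _; apply: ball_sym; exact: le_ball kw.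
have V1 := V _ _ _ f1 (fun w h => proj1 (offW w h)).
have V2 := V _ _ _ f2 (fun w h => proj2 (offW w h)).
have o1 : x1.1 < o.1 by rewrite /o /=; lra.
have o2 : o.1 < x2.1 by rewrite /o /=; lra.
(* The convention of [crosses] puts [o] to the left of the ray, so only the edge leaving [o] to the
   right can count. *)
have C1 z : z.1 = o.1 -> crosses z o x1 = false.
  by move=> zo; rewrite /crosses zo lexx (ltW o1).
have C2 z : z.1 = o.1 -> crosses z o x2 = (z.2 < o.2).
  move=> zo; rewrite /crosses /height zo lexx [x2.1 <= _]leNgt o2 /=.
  by rewrite subrr mulr0 addr0 subr_gt0.
(* In the sum of the six relations modulo 2, the values at [y] and at [p1], [p2], [p3] cancel, as do
   those of leg 3 at [z']. There remain legs 1 and 2 at [z3] and at [z']: their tails agree, but the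
   edge from [o] to [x2] is above exactly one of the two points. *)
move: E1 E2 E3 E4 E5 E6; rewrite /= V1 V2 (C1 z3) // (C1 z') // (C2 z3) // (C2 z') //.
have -> : (z3.2 < o.2) = ~~ (z'.2 < o.2).
  rewrite /z3 /z' /=; case: sgsq => ->; rewrite ?mul1r ?mulN1r ?opprK.
    by rewrite gtrDl gtrBl eps0 ltNge (ltW eps0).
  by rewrite gtrBl gtrDl eps0 ltNge (ltW eps0).
move=> E1 E2 E3; rewrite E1 E2 E3.
move: (z'.2 < o.2) (parity z' x1 t1) (parity z' x2 t2) (crosses z' o x3 (+) parity z' x3 t3).
move: (crosses y o x1 (+) parity y x1 t1) (crosses y o x2 (+) parity y x2 t2).
move: (crosses y o x3 (+) parity y x3 t3).
by do 7!case.
Qed.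

End Tripod.

(** * From crossing parity to legs leaving a small disc *)

Section OuterTheta.
Variable R : realType.
Notation plane := (R * R)%type.
Implicit Types (w x y z : plane) (K F A W : set plane).

(** The legs can be permuted so that the chord is not vertical, since a vertical line meets the
    circle in at most two points. *)
Lemma tripod_contradiction q (r s : R) e y x1 x2 x3 (p1 p2 p3 : plane) A1 A2 A3 W1 W2 W3 :
  0 < s ->
  outer_leg q r e x1 p1 A1 W1 -> outer_leg q r e x2 p2 A2 W2 -> outer_leg q r e x3 p3 A3 W3 ->
  (forall w, A1 w -> ~ W2 w /\ ~ W3 w) -> (forall w, A2 w -> ~ W1 w /\ ~ W3 w) ->
  (forall w, A3 w -> ~ W1 w /\ ~ W2 w) ->
  same_side (disc q r `|` (W2 `|` W3)) s p1 y ->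
  same_side (disc q r `|` (W1 `|` W3)) s p2 y ->
  same_side (disc q r `|` (W1 `|` W2)) s p3 y -> False.
Proof.
move=> s0 L1 L2 L3 A1W A2W A3W S1 S2 S3.
have S1' : same_side (disc q r `|` (W3 `|` W2)) s p1 y by rewrite (setUC W3).
have S2' : same_side (disc q r `|` (W3 `|` W1)) s p2 y by rewrite (setUC W3).
have S3' : same_side (disc q r `|` (W2 `|` W1)) s p3 y by rewrite (setUC W2).
have swap A W W' : (forall w, A w -> ~ W w /\ ~ W' w) -> forall w, A w -> ~ W' w /\ ~ W w.
  by move=> h w /h[].
have [lt12|lt21|e12] := ltgtP x1.1 x2.1.
- exact: (tripod_contradiction_ordered s0 lt12 L1 L2 L3 A1W A2W A3W S1 S2 S3).
- exact: (tripod_contradiction_ordered s0 lt21 L2 L1 L3 A2W A1W (swap _ _ _ A3W) S2 S1 S3').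
have [lt13|lt31|e13] := ltgtP x1.1 x3.1.
- exact: (tripod_contradiction_ordered s0 lt13 L1 L3 L2 (swap _ _ _ A1W) A3W A2W S1' S3 S2).
- exact: (tripod_contradiction_ordered s0 lt31 L3 L1 L2 A3W (swap _ _ _ A1W) (swap _ _ _ A2W) S3 S1' S2').
have c1 := leg_circle L1; have c2 := leg_circle L2; have c3 := leg_circle L3.
have ne x p A W x' p' A' W' : outer_leg q r e x p A W -> outer_leg q r e x' p' A' W' ->
    (forall w, A w -> ~ W' w) -> x.1 = x'.1 -> x'.2 - q.2 = - (x.2 - q.2).
  move=> La Lb AW e1; have : (x'.2 - q.2) ^+ 2 == (x.2 - q.2) ^+ 2.
    have := leg_circle La; rewrite -(leg_circle Lb) /sqdist e1 => /addrI ->; exact: eqxx.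
  rewrite eqf_sqr => /orP[/eqP e2|/eqP //].
  exfalso; apply: (AW _ (leg_x La)); rewrite (_ : x = x'); first exact/(leg_sub Lb)/(leg_x Lb).
  by rewrite [x]surjective_pairing [x']surjective_pairing e1; congr (_, _); lra.
have h12 := ne _ _ _ _ _ _ _ _ L1 L2 (fun w h => proj1 (A1W w h)) e12.
have h13 := ne _ _ _ _ _ _ _ _ L1 L3 (fun w h => proj2 (A1W w h)) e13.
have h23 := ne _ _ _ _ _ _ _ _ L2 L3 (fun w h => proj2 (A2W w h)) (etrans (esym e12) e13).
apply: (proj1 (A1W _ (leg_x L1))); rewrite (_ : x1 = x2); first exact/(leg_sub L2)/(leg_x L2).
by rewrite [x1]surjective_pairing [x2]surjective_pairing e12; congr (_, _); lra.
Qed.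

Lemma sqdist_continuous (q : plane) : continuous (sqdist q).
Proof.
move=> w; have c1 : (fun w : plane => w.1) @ w --> w.1 by exact: cvg_fst.
have c2 : (fun w : plane => w.2) @ w --> w.2 by exact: cvg_snd.
have sq (f : plane -> R) (a : R) : f @ w --> f w -> (fun w => (f w - a) ^+ 2) @ w --> (f w - a) ^+ 2.
  by move=> cf; rewrite expr2; apply: cvgM; apply: cvgB => //; exact: cvg_cst.
by apply: cvgD; [exact: (sq (fun w => w.1))|exact: (sq (fun w => w.2))].
Qed.

(** The time sought is the supremum of those spent in the disc. A first exit would not do: the leg
    must not enter the disc again. *)
Lemma last_exit (a : R -> plane) (q : plane) (r : R) : {within `[0, 1], continuous a} ->
  sqdist q (a 0) < r -> r < sqdist q (a 1) ->
  exists t0, [/\ 0 < t0, t0 < 1, sqdist q (a t0) = r &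
    forall t, t0 < t <= 1 -> r < sqdist q (a t)].
Proof.
move=> ca a0 a1; pose g t := sqdist q (a t).
have cgt (t : R) : 0 <= t <= 1 -> g @ within `[0, 1] (nbhs t) --> g t.
  move=> t01; apply: cvg_comp; last exact: sqdist_continuous.
  by apply: (proj1 (subspace_continuousP _ _) ca); rewrite /= in_itv.
have up (t c : R) : 0 <= t <= 1 -> g t < c ->
    exists2 d : R, 0 < d & forall t' : R, ball t d t' -> 0 <= t' <= 1 -> g t' < c.
  move=> t01 h; have near_t : nbhs t [set t' : R | `[0, 1]%classic t' -> g t' < c].
    exact: (@cvgr_lt _ _ _ (within_filter _ (nbhs_filter t)) _ _ (cgt t t01) _ h).
  have [d /= d0 bd] := proj1 (@nbhs_ballP R R t _) near_t.
  by exists d.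
have down (t c : R) : 0 <= t <= 1 -> c < g t ->
    exists2 d : R, 0 < d & forall t' : R, ball t d t' -> 0 <= t' <= 1 -> c < g t'.
  move=> t01 h; have near_t : nbhs t [set t' : R | `[0, 1]%classic t' -> c < g t'].
    exact: (@cvgr_gt _ _ _ (within_filter _ (nbhs_filter t)) _ _ (cgt t t01) _ h).
  have [d /= d0 bd] := proj1 (@nbhs_ballP R R t _) near_t.
  by exists d.
pose E := [set t : R | 0 <= t <= 1 /\ g t <= r].
have E0 : E 0 by split; [rewrite lexx ler01|exact: ltW].
have ubE : has_ubound E by exists 1 => t [/andP[]].
have supE : has_sup E by split=> //; exists 0.
pose t0 := sup E.
have t00 : 0 <= t0 by apply: sup_ubound.
have t01 : t0 <= 1 by apply: ge_sup; [exists 0|move=> t [/andP[]]].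
have t0I : 0 <= t0 <= 1 by rewrite t00 t01.
have after (t : R) : t0 < t <= 1 -> r < g t.
  case/andP => lt t1; rewrite ltNge; apply/negP => h.
  suff : t <= t0 by rewrite leNgt lt.
  by apply: sup_ubound => //; split=> //; rewrite t1 andbT (le_trans t00 (ltW lt)).
have le0 : g t0 <= r.
  rewrite leNgt; apply/negP => h; have [d d0 bd] := down t0 r t0I h.
  have [t [[tI tr] /bd/(_ tI)]] := closure_sup (ex_intro _ 0 E0) ubE (nbhsx_ballx t0 d d0).
  by rewrite ltNge tr.
have lt1 : t0 < 1.
  by rewrite lt_neqAle t01 andbT; apply: contraTneq le0 => ->; rewrite -ltNge.
have eq0 : g t0 = r.
  apply/eqP; rewrite eq_le le0 /= leNgt; apply/negP => h.
  have [d d0 bd] := up t0 r t0I h.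
  (* A time just after [t0], still before 1 and within the radius where [g] stays below [r]. *)
  pose t := t0 + Num.min d (1 - t0) / 2.
  have m0 : 0 < Num.min d (1 - t0) by rewrite lt_min d0 subr_gt0.
  have m1 : Num.min d (1 - t0) <= 1 - t0 by rewrite ge_min lexx orbT.
  have m2 : Num.min d (1 - t0) <= d by rewrite ge_min lexx.
  have tt : t0 < t <= 1 by rewrite /t; apply/andP; split; lra.
  have := after t tt; rewrite ltNge => /negP; apply; apply: ltW; apply: bd.
    by rewrite /ball /= /t opprD addrA subrr sub0r normrN gtr0_norm; lra.
  by case/andP: tt => h1 h2; rewrite h2 andbT (le_trans t00 (ltW h1)).
exists t0; split=> //.
by rewrite lt_neqAle t00 andbT; apply/negP => /eqP h; move: a0; rewrite [a 0](_ : _ = a t0) ?h // -/(g t0) eq0 ltxx.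
Qed.

Lemma sqdist_ball (q : plane) (d : R) w : 0 < d -> ~ ball q d w -> d ^+ 2 <= sqdist q w.
Proof.
move=> d0 nb; rewrite leNgt; apply/negP => h; apply: nb.
have b (a c : R) : (a - c) ^+ 2 < d ^+ 2 -> `|c - a| < d.
  by rewrite distrC => h'; rewrite -(ger0_norm (ltW d0)) -ltr_sqr ?nnegrE // !real_normK ?num_real.
have s1 := sqr_ge0 (w.1 - q.1); have s2 := sqr_ge0 (w.2 - q.2).
by split; apply: b; apply: le_lt_trans h; rewrite /sqdist; [rewrite lerDl|rewrite lerDr].
Qed.

Lemma disc_ball (q : plane) (d d' : R) w : 0 < d -> d < d' -> disc q (d ^+ 2) w -> ball q d' w.
Proof.
move=> d0 dd' h; apply: contrapT => nb.
have := sqdist_ball (lt_trans d0 dd') nb; rewrite leNgt => /negP; apply.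
by apply: le_lt_trans h _; rewrite ltr_sqr ?nnegrE ?ltW // (lt_trans d0).
Qed.

End OuterTheta.

(** * Outerplanar graphs are theta-free *)

Lemma closed_image (R : realType) (a : R -> R * R) (c d : R) :
  {within `[c, d], continuous a} -> closed (a @` `[c, d]).
Proof.
move=> ca; apply: compact_closed; first exact: norm_hausdorff.
by apply: continuous_compact => //; apply: segment_compact.
Qed.

Lemma connected_image (R : realType) (a : R -> R * R) (c d : R) :
  {within `[c, d], continuous a} -> connected (a @` `[c, d]).
Proof. by move=> ca; apply: connected_continuous_connected => //; apply: segment_connected. Qed.

Section Theta.
Variable R : realType.
Notation plane := (R * R)%type.

(** Each leg is split into its first edge [a i], handled as a parametrized arc so that it can be cut
    at the small circle, and a closed connected remainder [B i] leading to the other hub [e]. The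
    inner vertex near the face is [a i 1]. *)
Lemma outer_theta (q e : plane) (a : 'I_3 -> R -> plane) (B : 'I_3 -> set plane) (F : set plane) :
  (forall i, {within `[0, 1], continuous (a i)}) -> (forall i, a i 0 = q) ->
  (forall i, connected (B i)) -> (forall i, closed (B i)) ->
  (forall i, B i (a i 1)) -> (forall i, B i e) -> (forall i, ~ B i q) ->
  (forall i j (t t' : R), i != j -> 0 <= t <= 1 -> 0 <= t' <= 1 -> a i t = a j t' -> t = 0) ->
  (forall i j (t : R), i != j -> 0 <= t <= 1 -> ~ B j (a i t)) ->
  connected F ->
  (forall z, F z -> forall i, ~ B i z /\ forall t : R, 0 <= t <= 1 -> a i t <> z) ->
  (forall i, closure F (a i 1)) -> False.
Proof.
move=> ca a0 cB clB B1 Be Bq disj disjB cF offF clF.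
pose I i := a i @` `[0, 1]; pose K j k := (I j `|` B j) `|` (I k `|` B k).
have clK j k : closed (K j k) by do !apply: closedU => //; apply: closed_image.
have i1 : 0 <= (1 : R) <= 1 by apply/andP; split; [exact: ler01|exact: lexx].
have [y [Fy _]] : exists y, (F `&` setT) y by apply: (clF ord0); apply: filterT.
have offI z j : F z -> ~ (I j `|` B j) z.
  move=> Fz [[t /=]|]; last by case: (offF z Fz j).
  by rewrite in_itv /= => t01; case: (offF z Fz j) => _; apply.
have side i j k : i != j -> i != k ->
    exists2 r : R, 0 < r & same_side (K j k) r (a i 1) y.
  move=> ij ik; have np l : i != l -> ~ (I l `|` B l) (a i 1).
    move=> il [[t /=]|]; last exact: disjB.
    by rewrite in_itv /= => t01 /esym/(disj _ _ _ _ il i1 t01)/eqP; rewrite oner_eq0.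
  have nK : (~` K j k) (a i 1) by case=> [/(np _ ij)|/(np _ ik)].
  have /nbhs_ballP[rho /= rho0 brho] := open_nbhs_nbhs (conj (closed_openC (clK j k)) nK).
  (* The face itself need not contain [a i 1]; a short segment, too short to meet [K j k], leads
     into it. *)
  have [f [Ff fb]] := clF i _ (nbhsx_ballx (a i 1) rho rho0).
  apply: (closed_parity_far (F := seg (a i 1) f `|` F) (clK j k)).
  - by apply: (connectedU_at (z := f)) => //; [exact: seg_connected|exact: segr].
  - move=> z [/(seg_ball (ballxx (a i 1) rho0) fb)/brho//|Fz].
    by case=> [/(offI _ _ Fz)|/(offI _ _ Fz)].
  - by left; apply: segl.
  - by right.
pose o0 : 'I_3 := @Ordinal 3 0 isT; pose o1 : 'I_3 := @Ordinal 3 1 isT.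
pose o2 : 'I_3 := @Ordinal 3 2 isT.
have [r0 r00 S0] := side o0 o1 o2 isT isT.
have [r1 r10 S1] := side o1 o0 o2 isT isT.
have [r2 r20 S2] := side o2 o0 o1 isT isT.
have [d d0 bd] : exists2 d : R, 0 < d & forall w i, ball q d w -> ~ B i w.
  have clU : closed (B o0 `|` (B o1 `|` B o2)) by do !apply: closedU.
  have nq : (~` (B o0 `|` (B o1 `|` B o2))) q by move=> [/Bq|[/Bq|/Bq]].
  have /nbhs_ballP[d /= d0 bd] := open_nbhs_nbhs (conj (closed_openC clU) nq).
  exists d => // w i /bd nw Bw; apply: nw.
  case: i Bw => -[|[|[|//]]] h; rewrite (bool_irrelevance h isT) => Bw; [by left|by right; left|by right; right].
pose s := Num.min (Num.min r0 r1) r2.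
have s0 : 0 < s by rewrite !lt_min r00 r10 r20.
(* The bound by [d] keeps every [B i] out of the disc. The bound by [s / 2] places a point within
   [s / 2] of the disc within [s] of [q], which belongs to [K j k], so [side] applies to polygons
   passing through the disc. *)
pose rho := Num.min d (s / 2) / 2.
have m0 : 0 < Num.min d (s / 2) by rewrite lt_min d0 divr_gt0.
have rho0 : 0 < rho by rewrite divr_gt0.
have rhod : rho < d.
  have : Num.min d (s / 2) <= d by rewrite ge_min lexx.
  by rewrite /rho; lra.
have rhos : rho < s / 2.
  have : Num.min d (s / 2) <= s / 2 by rewrite ge_min lexx orbT.
  by rewrite /rho; lra.
have outB i w : B i w -> rho ^+ 2 < sqdist q w.
  move=> Bw; apply: (@lt_le_trans _ _ (d ^+ 2)); first by rewrite ltr_sqr ?nnegrE ?ltW.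
  by apply: sqdist_ball => // /bd/(_ Bw).
have leg i : exists x A, outer_leg q (rho ^+ 2) e x (a i 1) A (A `|` B i) /\
    (forall w, A w -> exists2 t : R, 0 < t <= 1 & a i t = w).
  have h0 : sqdist q (a i 0) < rho ^+ 2.
    by rewrite a0 /sqdist !subrr expr0n /= addr0 exprn_gt0.
  have [t0 [t00 t01 t0r after]] := last_exit (ca i) h0 (outB _ _ (B1 i)).
  have sub01 : `[t0, 1] `<=` `[0, 1].
    by move=> t /=; rewrite !in_itv /= => /andP[h1 ->]; rewrite andbT (le_trans (ltW t00)).
  have ca' := continuous_subspaceW sub01 (ca i).
  have A1 : (a i @` `[t0, 1]) (a i 1) by exists 1 => //=; rewrite in_itv /= lexx (ltW t01).
  exists (a i t0), (a i @` `[t0, 1]); split; last first.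
    move=> w [t /=]; rewrite in_itv /= => /andP[h1 h2] <-; exists t => //.
    by rewrite h2 (lt_le_trans t00 h1).
  split=> //.
  - exact: connected_image.
  - by exists t0 => //=; rewrite in_itv /= lexx (ltW t01).
  - by apply: closedU => //; apply: closed_image.
  - by apply: (connectedU_at (z := a i 1)) => //; apply: connected_image.
  - by right.
  - move=> w [[t /=]|/outB h]; last by split=> [|h']; [exact: ltW|move: h; rewrite h' ltxx].
    rewrite in_itv /= => /andP[h1 h2] <-.
    have [->|tn] := eqVneq t t0; first by rewrite t0r.
    have h : rho ^+ 2 < sqdist q (a i t) by apply: after; rewrite h2 lt_neqAle eq_sym tn h1.
    by split=> [|h']; [exact: ltW|move: h; rewrite h' ltxx].
have [x0 [A0 [L0 P0]]] := leg o0.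
have [x1 [A1 [L1 P1]]] := leg o1.
have [x2 [A2 [L2 P2]]] := leg o2.
have PI (t : R) : 0 < t <= 1 -> 0 <= t <= 1 by move=> /andP[h ->]; rewrite ltW.
have avoid i j (A A' : set plane) : i != j -> (forall w, A w -> exists2 t : R, 0 < t <= 1 & a i t = w) ->
    (forall w, A' w -> exists2 t : R, 0 < t <= 1 & a j t = w) -> forall w, A w -> ~ (A' `|` B j) w.
  move=> ij PA PA' w /PA[t ti <-] [/PA'[t' ti']|]; last exact: disjB (PI _ ti).
  move/esym/(disj _ _ _ _ ij (PI _ ti) (PI _ ti')) => t_0.
  by move: ti; rewrite t_0 ltxx.
have subI i (A : set plane) w : (forall w, A w -> exists2 t : R, 0 < t <= 1 & a i t = w) -> A w -> I i w.
  by move=> PA /PA[t ti <-]; exists t => //=; rewrite in_itv /= PI.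
have widen i j k (r : R) (A A' : set plane) : same_side (K j k) r (a i 1) y -> s <= r ->
    (forall w, A w -> exists2 t : R, 0 < t <= 1 & a j t = w) ->
    (forall w, A' w -> exists2 t : R, 0 < t <= 1 & a k t = w) ->
    same_side (disc q (rho ^+ 2) `|` ((A `|` B j) `|` (A' `|` B k))) (s / 2) (a i 1) y.
  move=> ss sr PA PA' x p p' lp f1 f2.
  have half : s / 2 <= r by lra.
  have fol t : follows (disc q (rho ^+ 2) `|` ((A `|` B j) `|` (A' `|` B k))) (s / 2) x t ->
      follows (K j k) r x t.
    move=> f w /f[k0 [dk|Kk] kw].
      exists q; first by left; left; exists 0; rewrite ?a0 //= in_itv /= lexx ler01.
      apply: (@le_ball _ _ q s r sr); rewrite [s]splitr.
      by apply: ball_triangle kw; apply: disc_ball dk.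
    exists k0; last exact: le_ball kw.
    by case: Kk => -[h|h]; [left; left; apply: subI h|left; right|right; left; apply: subI h|right; right].
  by apply: ss => //; apply: fol.
have [sr0 sr1 sr2] : [/\ s <= r0, s <= r1 & s <= r2] by split; rewrite !ge_min lexx ?orbT.
have s20 : 0 < s / 2 by rewrite divr_gt0.
apply: (tripod_contradiction s20 L0 L1 L2).
- by move=> w Aw; split; [exact: (avoid o0 o1 A0 A1)|exact: (avoid o0 o2 A0 A2)].
- by move=> w Aw; split; [exact: (avoid o1 o0 A1 A0)|exact: (avoid o1 o2 A1 A2)].
- by move=> w Aw; split; [exact: (avoid o2 o0 A2 A0)|exact: (avoid o2 o1 A2 A1)].
- exact: (widen o0 o1 o2 r0).
- exact: (widen o1 o0 o2 r1).
- exact: (widen o2 o0 o1 r2).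
Qed.

End Theta.

Lemma continuous_rev (R : realType) (a : R -> R * R) : {within `[0, 1], continuous a} ->
  {within `[0, 1], continuous (fun t => a (1 - t))}.
Proof.
move=> ca; apply/subspace_continuousP => t /=; rewrite in_itv /= => /andP[t0 t1].
have t'01 : `[0, 1]%classic (1 - t) by rewrite /= in_itv /=; apply/andP; split; lra.
have ct := proj1 (subspace_continuousP _ _) ca (1 - t) t'01.
apply/cvg_ballP => eps eps0.
have near_t : nbhs (1 - t) [set u : R | `[0, 1]%classic u -> ball (a (1 - t)) eps (a u)].
  exact: (proj1 (cvg_ballP _ _) ct eps eps0).
have [d /= d0 bd] := proj1 (@nbhs_ballP R R (1 - t) _) near_t.
have : nbhs t (ball t d) by exact: nbhsx_ballx.
apply: filterS => u tu /=; rewrite in_itv /= => /andP[u0 u1].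
apply: bd; last by rewrite /= in_itv /=; apply/andP; split; lra.
have tu' : `|t - u| < d by exact: tu.
suff : `|(1 - t) - (1 - u)| < d by [].
by have -> : 1 - t - (1 - u) = - (t - u); [ring|rewrite normrN].
Qed.

(** * Paths in a planar drawing *)

Section Drawing.
Variables (R : realType) (G : sgraph).
Notation plane := (R * R)%type.
Variables (pos : G -> plane) (arc : {set G} -> R -> plane).
Hypothesis D : planar_drawing pos arc.
Implicit Types (u v x y : G) (p : seq G) (w : plane).

(** An edge is an unordered pair, so its arc may have to be traversed backwards. *)
Lemma oriented_arc u v : adj u v -> exists a : R -> plane,
  [/\ {within `[0, 1], continuous a}, a 0 = pos u, a 1 = pos v,
      (forall t, 0 <= t <= 1 -> [\/ t = 0, t = 1 |
         exists2 t', 0 < t' < 1 & a t = arc [set u; v]%SET t']) &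
      a @` `[0, 1] = arc [set u; v]%SET @` `[0, 1]].
Proof.
move=> uv; have eE : [set u; v]%SET \in edges G by rewrite mem_edges.
have [u' [v' [e' h0 h1]]] := arc_ends D eE.
have uv_case : (u = u' /\ v = v') \/ (u = v' /\ v = u').
  have nuv := adj_neq uv; have /setP ee := e'.
  have := ee u; have := ee v; rewrite !inE !eqxx !orbT /= => /esym hv /esym hu.
  case/orP: hu => /eqP eu; case/orP: hv => /eqP ev.
  - by rewrite eu ev eqxx in nuv.
  - by left.
  - by right.
  - by rewrite eu ev eqxx in nuv.
case: uv_case => -[? ?]; subst u' v'.
  exists (arc [set u; v]%SET); split=> //; first exact: arc_continuous D _ eE.
  move=> t /andP[t0 t1]; have [->|n0] := eqVneq t 0; first by constructor 1.
  have [->|n1] := eqVneq t 1; first by constructor 2.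
  by constructor 3; exists t => //; rewrite !lt_neqAle eq_sym n0 t0 n1 t1.
exists (fun t => arc [set u; v]%SET (1 - t)); split.
- exact: continuous_rev (arc_continuous D eE).
- by rewrite subr0.
- by rewrite subrr.
- move=> t /andP[t0 t1]; have [->|n0] := eqVneq t 0; first by constructor 1.
  have [->|n1] := eqVneq t 1; first by constructor 2.
  have t0' : 0 < t by rewrite lt_neqAle eq_sym n0.
  have t1' : t < 1 by rewrite lt_neqAle n1.
  by constructor 3; exists (1 - t) => //; apply/andP; split; lra.
- apply/seteqP; split=> z [t /=]; rewrite in_itv /= => /andP[t0 t1] <-.
    by exists (1 - t) => //=; rewrite in_itv /=; apply/andP; split; lra.
  exists (1 - t); last by rewrite opprB addrCA subrr addr0.
  by rewrite /= in_itv /=; apply/andP; split; lra.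
Qed.

(** The part of the drawing supported by the subgraph induced on [S]. It turns disjointness in the
    plane into disjointness of lists of vertices. *)
Definition drawn_on (S : seq G) w :=
  (exists2 v, v \in S & w = pos v) \/
  (exists u v, [/\ u \in S, v \in S, adj u v & exists2 t : R, 0 < t < 1 & w = arc [set u; v]%SET t]).

Lemma drawn_on_inter S S' w : drawn_on S w -> drawn_on S' w ->
  (exists v, [/\ v \in S, v \in S' & w = pos v]) \/
  (exists u v, [/\ adj u v, u \in S, v \in S, u \in S' & v \in S']).
Proof.
have no u v (t : R) x : adj u v -> 0 < t < 1 -> arc [set u; v]%SET t = pos x -> False.
  move=> uv t01; apply: (arc_avoids_vertices D); first by rewrite mem_edges.
  by rewrite in_itv.
case=> [[v vS ->]|[u [v [uS vS uv [t t01 ->]]]]] [[v' vS' e]|[u' [v' [uS' vS' uv' [t' t01' e]]]]].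
- by left; exists v; rewrite {2}(pos_inj D e).
- by case: (no _ _ _ _ uv' t01' (esym e)).
- by case: (no _ _ _ _ uv t01 e).
right; have [ee|ne] := eqVneq [set u; v]%SET [set u'; v']%SET.
  have sub z : z \in [set u; v]%SET -> z \in S'.
    by rewrite ee !inE => /orP[]/eqP ->.
  by exists u, v; split=> //; apply: sub; rewrite !inE eqxx ?orbT.
exfalso; move: e; apply: (arcs_disjoint D) ne _ _; rewrite ?mem_edges ?in_itv //.
Qed.

Lemma drawn_on_drawn S w : drawn_on S w -> drawn_set pos arc w.
Proof.
move=> [[v _ ->]|[u [v [_ _ uv [t /andP[t0 t1] ->]]]]]; first by left; exists v.
right; exists [set u; v]%SET => /=; first by rewrite mem_edges.
by exists t => //=; rewrite in_itv /= !ltW.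
Qed.

Lemma drawn_on_edge u v (a : R -> plane) (t : R) : adj u v -> a 0 = pos u -> a 1 = pos v ->
  [\/ t = 0, t = 1 | exists2 t', 0 < t' < 1 & a t = arc [set u; v]%SET t'] ->
  drawn_on [:: u; v] (a t).
Proof.
move=> uv h0 h1 [->|->|[t' t01' ->]].
- by left; exists u; rewrite ?inE ?eqxx.
- by left; exists v; rewrite ?inE ?eqxx ?orbT.
- by right; exists u, v; rewrite !inE !eqxx orbT; split=> //; exists t'.
Qed.

Lemma drawn_on_sub (S S' : seq G) w : {subset S <= S'} -> drawn_on S w -> drawn_on S' w.
Proof.
move=> sub [[v /sub vS ->]|[u [v [/sub uS /sub vS uv h]]]]; first by left; exists v.
by right; exists u, v.
Qed.

Fixpoint draw x p : set plane :=
  if p is y :: p' then (arc [set x; y]%SET @` `[0, 1]) `|` draw y p' else [set pos x].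

Lemma drawP x p : path (@adj G) x p ->
  [/\ closed (draw x p), connected (draw x p), draw x p (pos x), draw x p (pos (last x p)) &
      draw x p `<=` drawn_on (x :: p)].
Proof.
elim: p x => [|y p IH] x /=.
  move=> _; split=> //.
  - exact: accessible_closed_set1 (hausdorff_accessible (@norm_hausdorff _ _)) _.
  - exact: connected1.
  - by move=> w ->; left; exists x; rewrite ?inE.
case/andP => xy /IH[cl co dy dl sub].
have [a [ca a0 a1 aP aE]] := oriented_arc xy.
have i0 : `[0, 1]%classic (0 : R) by rewrite /= in_itv /= lexx ler01.
have i1 : `[0, 1]%classic (1 : R) by rewrite /= in_itv /= lexx ler01.
rewrite -aE; split.
- by apply: closedU => //; apply: closed_image.
- apply: (connectedU_at (z := pos y)) => //; first exact: connected_image.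
  by exists 1.
- by left; have : (a @` `[0, 1]) (pos x); [exists 0|rewrite aE].
- by right.
- move=> w [[t /=]|/sub].
    rewrite in_itv /= => t01 <-; apply: (@drawn_on_sub [:: x; y]).
      by move=> z; rewrite !inE => /orP[]/eqP ->; rewrite eqxx ?orbT.
    exact: drawn_on_edge (aP t t01).
  by apply: drawn_on_sub => z zp; rewrite inE zp orbT.
Qed.

End Drawing.

(** The hubs are drawn at [pos q1] and [pos q2]; [h i] is the first inner vertex of leg [i], and it
    lies in the closure of the outer face as every vertex does. *)
Lemma outerplanar_theta_free (R : realType) (G : sgraph) : outerplanar R G -> theta_free G.
Proof.
move=> [pos [arc [D [F [[x0 _ FE] _] clF]]]] q1 q2 s1 s2 s3 uq n1 n2 n3 p1 p2 p3.
pose s (i : 'I_3) := nth [::] [:: s1; s2; s3] i.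
have sP i : [/\ s i != [::], path (@adj G) q1 (rcons (s i) q2), q1 \notin s i & q2 \notin s i].
  move: uq; rewrite /= !inE !mem_cat !negb_or => /and3P[/and4P[_ a1 a2 a3] /and3P[b1 b2 b3] _].
  by case: i => -[|[|[|//]]].
have q12 : q1 != q2 by move: uq; rewrite /= inE negb_or => /andP[/andP[]].
have sD i j v : i != j -> v \in s i -> v \in s j -> False.
  move: uq; rewrite /= !cat_uniq has_cat negb_or => /and3P[_ _ /and4P[_ /andP[/hasPn d12 /hasPn d13] _]].
  case/andP => /hasPn d23 _.
  case: i => -[|[|[|//]]] hi; case: j => -[|[|[|//]]] hj //= _ h h'.
  - by have := d12 v h'; rewrite /= h.
  - by have := d13 v h'; rewrite /= h.
  - by have := d12 v h; rewrite /= h'.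
  - by have := d23 v h'; rewrite /= h.
  - by have := d13 v h; rewrite /= h'.
  - by have := d23 v h; rewrite /= h'.
have : forall i, exists hta : G * seq G * (R -> R * R), let: (h, t, a) := hta in
    [/\ s i = h :: t, adj q1 h, path (@adj G) h (rcons t q2) &
    [/\ {within `[0, 1], continuous a}, a 0 = pos q1, a 1 = pos h &
      (forall t, 0 <= t <= 1 -> [\/ t = 0, t = 1 |
         exists2 t', 0 < t' < 1 & a t = arc [set q1; h]%SET t'])]].
  move=> i; have [] := sP i; case: (s i) => // h t _ /= /andP[q1h pt] _ _.
  by have [a [ca a0 a1 aP _]] := oriented_arc D q1h; exists (h, t, a).
case/choice => f fP.
pose h i := (f i).1.1; pose t i := (f i).1.2; pose a i := (f i).2.
have {}fP i : [/\ s i = h i :: t i, adj q1 (h i), path (@adj G) (h i) (rcons (t i) q2) &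
    [/\ {within `[0, 1], continuous (a i)}, a i 0 = pos q1, a i 1 = pos (h i) &
      (forall u, 0 <= u <= 1 -> [\/ u = 0, u = 1 |
         exists2 t', 0 < t' < 1 & a i u = arc [set q1; h i]%SET t'])]].
  by have := fP i; rewrite /h /t /a; case: (f i) => [[? ?] ?].
have hs i : h i \in s i by have [-> _ _ _] := fP i; rewrite mem_head.
have hq i : h i != q1 by have [_ _ qn _] := sP i; apply: contraNneq qn => <-.
have aon i (u : R) : 0 <= u <= 1 -> drawn_on pos arc [:: q1; h i] (a i u).
  by move=> u01; have [_ q1h _ [_ a0 a1 aP]] := fP i; apply: drawn_on_edge (aP u u01).
pose B i := draw pos arc (h i) (rcons (t i) q2).
have BP i := drawP D (let: And4 _ _ h _ := fP i in h).
have memB i v : v \in h i :: rcons (t i) q2 -> v \in s i \/ v = q2.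
  have [-> _ _ _] := fP i; rewrite !inE mem_rcons inE => /or3P[->|/eqP->|->]; [by left|by right|].
  by left; rewrite orbT.
have noq1 i : q1 \notin h i :: rcons (t i) q2.
  apply/negP => /memB[]; first by have [_ _ /negbTE -> _] := sP i.
  by move/eqP; rewrite (negbTE q12).
have FO z : F z -> ~ drawn_set pos arc z by rewrite FE; apply: connected_component_sub.
apply: (outer_theta (q := pos q1) (e := pos q2) (a := a) (B := B) (F := F)).
- by move=> i; have [_ _ _ []] := fP i.
- by move=> i; have [_ _ _ []] := fP i.
- by move=> i; have [] := BP i.
- by move=> i; have [] := BP i.
- by move=> i; have [_ _ _ [_ _ -> _]] := fP i; have [] := BP i.
- by move=> i; have [_ _ _ + _] := BP i; rewrite last_rcons.
- move=> i; have [_ _ _ _ sub] := BP i => /sub don.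
  have qon : drawn_on pos arc [:: q1] (pos q1) by left; exists q1; rewrite ?inE.
  have [[v []]|[u [v [uv]]]] := drawn_on_inter D qon don; rewrite !inE => /eqP ->.
    by rewrite -in_cons (negbTE (noq1 i)).
  by move=> _; rewrite -in_cons (negbTE (noq1 i)).
- move=> i j u u' ij u01 u01' e; have := aon j u' u01'; rewrite -e => onj.
  have hij : h i != h j by apply/negP => /eqP e'; apply: (sD i j (h i) ij); rewrite ?hs // e' hs.
  have memq v : v \in [:: q1; h i] -> v \in [:: q1; h j] -> v = q1.
    rewrite !inE => /orP[/eqP //|/eqP ->]; rewrite (negbTE hij) orbF => /eqP //.
  have [[v [vi vj ve]]|[v [v' [vv vi vi' vj vj']]]] := drawn_on_inter D (aon i u u01) onj; last first.
    by move: vv; rewrite (memq v) // (memq v') // adj_irr.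
  rewrite (memq v) // in ve; have [_ q1h _ [_ _ a1 aP]] := fP i.
  have [//|u1|[t' t01' at']] := aP u u01.
    by move: ve; rewrite u1 a1 => /(pos_inj D)/eqP; rewrite (negbTE (hq i)).
  exfalso; move: ve; rewrite at'; apply: (arc_avoids_vertices D); first by rewrite mem_edges.
  by rewrite in_itv.
- move=> i j u ij u01 /(let: And5 _ _ _ _ sub := BP j in sub) onj.
  have memq v : v \in [:: q1; h i] -> v \in h j :: rcons (t j) q2 -> False.
    rewrite !inE -in_cons => /orP[/eqP ->|/eqP ->]; first by rewrite (negbTE (noq1 j)).
    case/memB => [hj|e]; first exact: (sD i j (h i)).
    by have [_ _ _ /negP] := sP i; apply; rewrite -e.
  have [[v [vi vj _]]|[v [v' [_ vi _ vj _]]]] := drawn_on_inter D (aon i u u01) onj; exact: memq vi vj.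
- by rewrite FE; apply: component_connected.
- move=> z Fz i; split.
    by move=> /(let: And5 _ _ _ _ sub := BP i in sub)/drawn_on_drawn; apply: FO.
  by move=> u u01 e; apply: (FO z Fz); rewrite -e; apply: drawn_on_drawn (aon i u u01).
- by move=> i; have [_ _ _ [_ _ -> _]] := fP i; apply: clF.
Qed.

Theorem theorem16 (R : realType) (G : sgraph)
  (hG : has_subgraph G G1 \/ has_subgraph G G2 \/
        has_subgraph G G3 \/ has_subgraph G G4) :
  (~ vi_colorable G 5 /\ (6 <= chi_vi G)%N) /\
  (outerplanar R G -> max_degree G = 3%N -> chi_vi G = 6%N).
Proof.
have n5 : ~~ vi_colorable G 5.
  case: hG => [|[|[|]]]; [exact: G1_not_colorable|exact: G2_not_colorable|
    exact: G3_not_colorable|exact: G4_not_colorable].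
(* Monotonicity in the number of colours turns the failure of five colours into the failure of any
   smaller number. *)
have mono k l : (k <= l)%N -> vi_colorable G k -> vi_colorable G l.
  move=> kl /vi_colorableP[c [f cf]]; apply/vi_colorableP.
  exists (fun u => widen_ord kl (c u)), (fun u v => widen_ord kl (f u v)) => u uS.
  have /(star_properP _ _ _ (nbrs_uniq _ u))[H1 H2] := cf u uS.
  by apply/star_properP; [exact: nbrs_uniq|split; [exact: H1|exact: H2]].
have ge6 : (6 <= chi_vi G)%N.
  rewrite /chi_vi; case: ex_minnP => m colm _; rewrite ltnNge; apply: contra n5 => m5.
  exact: mono colm.
split; first by split=> //; apply/negP.
move=> out D3; apply/eqP; rewrite eqn_leq ge6 andbT.
rewrite /chi_vi; case: ex_minnP => m _ minm; apply: minm.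
by apply: theta_free_vi_colorable; [exact: outerplanar_theta_free out|rewrite D3].
Qed.
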